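(* Assume the Vertical Template Hypothesis stated in the context. Then there exist $k,n\in\mathbb{Z}_+$ such that a vertically $k$-connected binary matroid $M$ with an $M(K_n)$-minor has no minor isomorphic to any of $\mathrm{PG}(3,2)\backslash e$, $L_{19}$, $L_{11}$ if and only if $M$ is an even-cycle matroid.
   Context: Binary frame template: a tuple $\Phi=(C,X,Y_0,Y_1,A_1,\Delta,\Lambda)$ where $C,X,Y_0,Y_1$ are disjoint finite sets, $A_1$ is a binary matrix with rows indexed by $X$ and columns by $Y_0\cup Y_1\cup C$, $\Lambda$ is a subgroup of $\mathrm{GF}(2)^X$ and $\Delta$ a subgroup of $\mathrm{GF}(2)^{Y_0\cup Y_1\cup C}$; moreover (standard form) there are partitions $C=C_0\cup C_1$, $X=X_0\cup X_1$ with $A_1[X_0,C_0]$ an identity matrix and $A_1[X_1,C]$ a zero matrix. A binary frame matrix is a binary matrix each of whose columns has at most two nonzero entries. A binary matrix $A'$ with rows indexed by $B$ and columns by $E$ respects $\Phi$ if: $X\subseteq B$ and $C,Y_0,Y_1\subseteq E$; $A'[X,C\cup Y_0\cup Y_1]=A_1$; there is $Z\subseteq E-(C\cup Y_0\cup Y_1)$ with $A'[X,Z]=0$, each column of $A'[B-X,Z]$ a unit vector, and $A'[B-X,E-(C\cup Y_0\cup Y_1\cup Z)]$ a binary frame matrix; each column of $A'[X,E-(C\cup Y_0\cup Y_1\cup Z)]$ lies in $\Lambda$; each row of $A'[B-X,C\cup Y_0\cup Y_1]$ lies in $\Delta$. A matrix $A$ conforms to $\Phi$ if for such $A'$ and $Z$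 we have $A[B,E-Z]=A'[B,E-Z]$ and for each $i\in Z$ there is $j\in Y_1$ such that column $i$ of $A$ equals the sum of columns $i$ and $j$ of $A'$. A matroid $M$ conforms to $\Phi$ if $M\cong M(A)/C\backslash Y_1$ for some $A$ conforming to $\Phi$; $\mathcal{M}(\Phi)$ is the set of such matroids. A matroid $M$ is vertically $k$-connected if for every partition $(P,Q)$ of $E(M)$ with $r(P)+r(Q)-r(M)<k-1$, either $P$ or $Q$ is spanning; $M$ is cyclically $k$-connected if $M^*$ is vertically $k$-connected. Vertical Template Hypothesis: for every proper minor-closed class $\mathcal{M}$ of binary matroids there exist $k,n\in\mathbb{Z}_+$ and binary frame templates $\Phi_1,\dots,\Phi_s,\Psi_1,\dots,\Psi_t$ such that $\mathcal{M}$ contains each $\mathcal{M}(\Phi_i)$ and the duals of the matroids in each $\mathcal{M}(\Psi_j)$; every simple vertically $k$-connected member of $\mathcal{M}$ with an $M(K_n)$-minor lies in some $\mathcal{M}(\Phi_i)$; and every cosimple cyclically $k$-connected member $M$ of $\mathcal{M}$ with an $M^*(K_n)$-minor has $M^*$ in some $\mathcal{M}(\Psi_j)$. Even-cycle matroid: a binary matroid $M\binom{w}{D}$ where $D$ is the vertex-edge incidence matrix over $\mathrm{GF}(2)$ of a graph $G=(V,E)$ and $w$ is the characteristic vector of a set $W\subseteq E$. $\mathrm{PG}(3,2)\backslash e$ is $\mathrm{PG}(3,2)$ with one element deleted. $L_{19}$ is the dual of the cycle matroid of $K_7$ with two adjacent edges deleted. $L_{11}$ is the vector matroid over $\mathrm{GF}(2)$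 of the matrix with rows $10000010101$, $01000010011$, $00100001110$, $00010001101$, $00001001011$, $00000100111$. *)

(* Defs.v *)
From HB Require Import structures.
From mathcomp Require Import all_boot all_order all_algebra.

Set Implicit Arguments.
Unset Strict Implicit.
Unset Printing Implicit Defensive.

Import GRing.Theory.

Local Open Scope ring_scope.

(* The ground set of a [matroid T] is the whole of [T]; minors live on
   subtypes of [T]. *)
Record matroid (T : finType) := Matroid {
  indep :> {set T} -> bool;
  indep0 : indep set0;
  indepS : forall I J : {set T}, I \subset J -> indep J -> indep I;
  indep_aug : forall I J : {set T}, indep I -> indep J -> (#|I| < #|J|)%N ->
    exists2 x, x \in J :\: I & indep (x |: I)
}.

Section MatroidBasics.
Variables (T : finType) (M : matroid T).

Definition rk (S : {set T}) : nat :=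
  \max_(I : {set T} | indep M I && (I \subset S)) #|I|.

Definition basis (B : {set T}) : bool := maxset (indep M) B.

Definition spanning (S : {set T}) : bool := rk S == rk setT.

(* No loops and no parallel pairs. *)
Definition simple : bool := [forall x, forall y, indep M [set x; y]].

Lemma indep_extend (I J : {set T}) : indep M I -> indep M J -> (#|I| <= #|J|)%N ->
  exists K : {set T}, [/\ indep M K, I \subset K, K \subset I :|: J & #|K| = #|J|].
Proof.
move: {2}(#|J| - #|I|)%N (leqnn (#|J| - #|I|)%N) => n.
elim: n I => [|n IHn] I.
  rewrite leqn0 subn_eq0 => leJI iI iJ leIJ; exists I; split => //.
    exact: subsetUl.
  by apply/eqP; rewrite eqn_leq leIJ leJI.
move=> len iI iJ; rewrite leq_eqVlt => /orP[/eqP eqIJ|ltIJ].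
  by exists I; split=> //; exact: subsetUl.
have [x /setDP[xJ xI] ixI] := indep_aug iI iJ ltIJ.
have cI : #|x |: I| = #|I|.+1 by rewrite cardsU1 xI.
have [||K [iK sK KsU cK]] := IHn (x |: I) _ ixI iJ.
- by rewrite cI subnS -ltnS prednK ?subn_gt0.
- by rewrite cI.
exists K; split=> //; first exact: subset_trans (subsetUr _ _) sK.
apply: subset_trans KsU _.
by rewrite !subUset subsetUl subsetUr sub1set inE xJ orbT.
Qed.

Lemma basisP (B : {set T}) :
  reflect (indep M B /\ forall J : {set T}, indep M J -> (#|J| <= #|B|)%N)
          (basis B).
Proof.
apply: (iffP maxsetP) => [[iB maxB]|[iB maxB]]; split=> //.
  move=> J iJ; rewrite leqNgt; apply/negP => ltBJ.
  have [x /setDP[_ xB] ixB] := indep_aug iB iJ ltBJ.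
  have := maxB _ ixB (subsetUr _ _) => eqB.
  by move: xB; rewrite -eqB setU11.
move=> J iJ sBJ; apply/eqP; rewrite eq_sym eqEcard sBJ /=; exact: maxB.
Qed.

Lemma exists_basis (I : {set T}) : indep M I -> exists2 B, basis B & I \subset B.
Proof. by move=> iI; have [B mB sIB] := maxset_exists iI; exists B. Qed.

(* The bases of the dual are the complements of the bases. *)

Definition dual_indep (I : {set T}) : bool :=
  [exists B : {set T}, basis B && (I \subset ~: B)].

Fact dual_indep0 : dual_indep set0.
Proof.
have [B bB _] := exists_basis (indep0 M).
by apply/existsP; exists B; rewrite bB sub0set.
Qed.

Fact dual_indepS (I J : {set T}) :
  I \subset J -> dual_indep J -> dual_indep I.
Proof.
move=> sIJ /existsP[B /andP[bB sJ]]; apply/existsP; exists B.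
by rewrite bB (subset_trans sIJ sJ).
Qed.

Fact dual_indep_aug (I J : {set T}) :
  dual_indep I -> dual_indep J -> (#|I| < #|J|)%N ->
  exists2 x, x \in J :\: I & dual_indep (x |: I).
Proof.
move=> /existsP[BI /andP[/basisP[iBI mBI] sI]].
move=> /existsP[BJ /andP[/basisP[iBJ mBJ] sJ]] ltIJ.
have cB : #|BI| = #|BJ| by apply/eqP; rewrite eqn_leq mBI ?mBJ.
have iD : indep M (BJ :\: I) by apply: indepS iBJ; exact: subsetDl.
have [|K [iK sDK sK cK]] := indep_extend iD iBI; first exact: mBI.
have bK : basis K by apply/basisP; split=> // L iL; rewrite cK mBI.
have IK x : x \in I -> x \notin K.
  move=> xI; apply/negP => /(subsetP sK); rewrite !inE xI /= => xBI.
  by move/subsetP/(_ x xI): sI; rewrite inE xBI.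
have [sJK|/subsetPn[x xD xK]] := boolP (J :\: I \subset K); last first.
  exists x => //; apply/existsP; exists K; rewrite bK subUset sub1set inE xK /=.
  by apply/subsetP=> y yI; rewrite inE IK.
have lt : (#|BJ| < #|K|)%N.
  have sU : (BJ :\: I) :|: (J :\: I) \subset K by rewrite subUset sDK.
  apply: leq_trans (subset_leq_card sU).
  rewrite cardsU (_ : _ :&: _ = set0) ?cards0 ?subn0; last first.
    apply/setP=> y; rewrite !inE; apply/negP => /andP[/andP[_ yB] /andP[_ yJ]].
    by move/subsetP/(_ y yJ): sJ; rewrite inE yB.
  have := cardsID I BJ; have := cardsID I J; have := cardsID J I.
  have : (#|BJ :&: I| <= #|I :\: J|)%N.
    apply/subset_leq_card/subsetP=> y; rewrite !inE => /andP[yB ->].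
    rewrite andbT; apply/negP=> yJ.
    by move/subsetP/(_ y yJ): sJ; rewrite inE yB.
  move=> le1 eI eJ eB; rewrite -eB addnC ltn_add2l (leq_ltn_trans le1) //.
  by rewrite -(ltn_add2l #|I :&: J|) eI setIC eJ.
by move: lt; rewrite cK cB ltnn.
Qed.

Definition dual : matroid T :=
  Matroid dual_indep0 dual_indepS dual_indep_aug.

Variable D : {set T}.

Definition delete_indep (I : {set {x : T | x \notin D}}) : bool :=
  indep M (val @: I).

Fact delete_indep0 : delete_indep set0.
Proof. by rewrite /delete_indep imset0 indep0. Qed.

Fact delete_indepS (I J : {set {x : T | x \notin D}}) :
  I \subset J -> delete_indep J -> delete_indep I.
Proof. by move=> sIJ; apply: indepS; exact: imsetS. Qed.

Fact delete_indep_aug (I J : {set {x : T | x \notin D}}) :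
  delete_indep I -> delete_indep J -> (#|I| < #|J|)%N ->
  exists2 x, x \in J :\: I & delete_indep (x |: I).
Proof.
move=> iI iJ; rewrite -(card_imset I val_inj) -(card_imset J val_inj) => ltIJ.
have [_ /setDP[/imsetP[x xJ ->] xI] ixI] := indep_aug iI iJ ltIJ.
exists x; last by rewrite /delete_indep imsetU1.
by rewrite inE xJ andbT; apply: contra xI; exact: imset_f.
Qed.

Definition delete : matroid {x : T | x \notin D} :=
  Matroid delete_indep0 delete_indepS delete_indep_aug.

End MatroidBasics.

Definition contract (T : finType) (M : matroid T) (C : {set T}) :
  matroid {x : T | x \notin C} := dual (delete (dual M) C).

(* [M / C \ D] *)
Definition contract_delete (T : finType) (M : matroid T) (C D : {set T}) :=
  delete (contract M C) [set x | val x \in D].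

Definition iso (T U : finType) (M : matroid T) (N : matroid U) : Prop :=
  exists2 f : T -> U, bijective f & forall I : {set T}, indep N (f @: I) = indep M I.

Definition has_minor (T U : finType) (M : matroid T) (N : matroid U) : Prop :=
  exists C D : {set T}, [disjoint C & D] /\ iso N (contract_delete M C D).

(* The truncated subtractions are exact: [rk] is submodular, and for [k = 0]
   the condition cannot hold in either reading. *)
Definition vertically_connected (k : nat) (T : finType) (M : matroid T) : Prop :=
  forall P Q : {set T}, P :|: Q = setT -> [disjoint P & Q] ->
    (rk M P + rk M Q - rk M setT < k - 1)%N -> spanning M P \/ spanning M Q.

Definition cyclically_connected (k : nat) (T : finType) (M : matroid T) : Prop :=
  vertically_connected k (dual M).

Definition cosimple (T : finType) (M : matroid T) : bool := simple (dual M).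

(* A matrix with rows indexed by [B] and columns indexed by [E]. *)
Notation binmx B E := (B -> E -> 'F_2).

Section VectorMatroid.
Variables (B E : finType) (A : binmx B E).

Definition column (e : E) : {ffun B -> ('F_2)^o} := [ffun b => A b e].

Definition vector_indep (I : {set E}) : bool := free [seq column e | e in I].

Lemma perm_enumU (I J : {set E}) : [disjoint I & J] ->
  perm_eq (enum (I :|: J)) (enum I ++ enum J).
Proof.
move=> dIJ; apply: uniq_perm; rewrite ?enum_uniq //.
  rewrite cat_uniq !enum_uniq andbT /=; apply/hasPn => x.
  rewrite !mem_enum => xJ; apply/negP => xI.
  by move: dIJ; rewrite disjoints_subset => /subsetP/(_ x xI); rewrite inE xJ.
by move=> x; rewrite mem_cat !mem_enum inE.
Qed.

Lemma vector_indepU1 (x : E) (I : {set E}) : x \notin I ->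
  vector_indep (x |: I) =
  (column x \notin <<[seq column e | e in I]>>%VS) && vector_indep I.
Proof.
move=> xI; rewrite /vector_indep -free_cons; apply: perm_free.
rewrite (_ : _ :: _ = [seq column e | e <- x :: enum I]) //.
apply: perm_map; rewrite -cat1s -(enum_set1 x); apply: perm_enumU.
by rewrite disjoints1.
Qed.

Fact vector_indep0 : vector_indep set0.
Proof. by rewrite /vector_indep /image_mem enum_set0 nil_free. Qed.

Fact vector_indepS (I J : {set E}) :
  I \subset J -> vector_indep J -> vector_indep I.
Proof.
move=> sIJ; rewrite /vector_indep /image_mem.
have dj : [disjoint I & J :\: I].
  by rewrite disjoints_subset; apply/subsetP=> x; rewrite !inE => ->.
have /(perm_map column) := perm_enumU dj.
rewrite -{1}(setIidPr sIJ) setID map_cat => /perm_free ->.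
exact: catl_free.
Qed.

Fact vector_indep_aug (I J : {set E}) :
  vector_indep I -> vector_indep J -> (#|I| < #|J|)%N ->
  exists2 x, x \in J :\: I & vector_indep (x |: I).
Proof.
move=> iI iJ ltIJ; pose U : {vspace _} := <<[seq column e | e in I]>>%VS.
case: (boolP [exists x in J :\: I, column x \notin U]).
  case/existsP=> x /andP[xD xU]; exists x => //.
  by rewrite vector_indepU1 ?xU //; case/setDP: xD.
rewrite negb_exists => /forallP allU.
suff : (#|J| <= #|I|)%N by rewrite leqNgt ltIJ.
have sJU : (<<[seq column e | e in J]>> <= U)%VS.
  apply/span_subvP=> _ /imageP[e eJ ->].
  have [eI|eI] := boolP (e \in I); first by apply/memv_span/image_f.
  by have := allU e; rewrite inE eI eJ /= negbK.
have := dimvS sJU; rewrite (eqP iI) (eqP iJ).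
by rewrite !size_image.
Qed.

Definition vector_matroid : matroid E :=
  Matroid vector_indep0 vector_indepS vector_indep_aug.

Lemma vector_indepP (I : {set E}) :
  reflect (forall e, e \in I ->
             column e \notin <<[seq column x | x in I :\ e]>>%VS)
          (vector_indep I).
Proof.
apply: (iffP idP) => [iI e eI|].
  by move: iI; rewrite -{1}(setD1K eI) vector_indepU1 ?setD11 // => /andP[].
elim: {I}_.+1 {-2}I (ltnSn #|I|) => // n IHn I leI spI.
have [->|[e eI]] := set_0Vmem I; first exact: vector_indep0.
rewrite -(setD1K eI) vector_indepU1 ?setD11 // spI //=.
apply: IHn => [|x /setD1P[xe xI]]; first by rewrite (cardsD1 e) eI in leI.
apply: contra (spI x xI); apply/subvP/sub_span => _ /imageP[y yI ->].
by apply: image_f; move: yI; rewrite !inE => /and3P[-> _ ->].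
Qed.

End VectorMatroid.

Definition binary (T : finType) (M : matroid T) : Prop :=
  exists (B E : finType) (A : binmx B E), iso M (vector_matroid A).

(* Finite graphs, with loops and parallel edges allowed; the order of the two
   ends of an edge is immaterial. *)
Record graph := Graph {
  vertex : finType;
  edge : finType;
  ends : edge -> vertex * vertex
}.

(* A loop contributes [1 + 1 = 0]. *)
Definition incidence (G : graph) : binmx (vertex G) (edge G) :=
  fun v e => (v == (ends e).1)%:R + (v == (ends e).2)%:R.

Section CycleMatroid.
Variable G : graph.

Definition adj (F : {set edge G}) : rel (vertex G) := fun u v =>
  [exists e in F, (ends e == (u, v)) || (ends e == (v, u))].

(* No edge of [F] lies on a cycle contained in [F]: the two ends of [e] are not
   joined by a path of [F :\ e] (in particular [e] is not a loop). *)
Definition forest (F : {set edge G}) : bool :=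
  [forall e in F, ~~ connect (adj (F :\ e)) (ends e).1 (ends e).2].

Let D := @incidence G.

Lemma adj_sym (F : {set edge G}) : symmetric (adj F).
Proof.
by move=> u v; apply: eq_existsb => e; rewrite orbC.
Qed.

Lemma connect_span (F : {set edge G}) (u v : vertex G) :
  connect (adj F) u v =
  ([ffun x => (x == u)%:R + (x == v)%:R] \in <<[seq column D e | e in F]>>%VS).
Proof.
apply/idP/idP => [/connectP[p pP ->]|].
  elim: p u pP => [|w p IHp] u /=.
    move=> _; rewrite (_ : [ffun _ => _] = 0) ?mem0v //.
    by apply/ffunP=> x; rewrite !ffunE; case: (x == u); apply/val_inj.
  case/andP=> /existsP[e /andP[eF uw]] /IHp wp.
  rewrite (_ : [ffun _ => _] =
    column D e + [ffun x => (x == w)%:R + (x == last w p)%:R]).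
    by apply: memvD => //; apply/memv_span/image_f.
  apply/ffunP=> x; rewrite !ffunE /D /incidence.
  case/orP: uw => /eqP-> /=.
    by case: (x == u); case: (x == w); case: (x == _); apply/val_inj.
  by case: (x == u); case: (x == w); case: (x == _); apply/val_inj.
apply: contraLR => nuv; apply/negP.
move=> /coord_span eqs.
pose phi (f : {ffun vertex G -> ('F_2)^o}) : 'F_2 :=
  \sum_(x | connect (adj F) u x) f x.
have phiD : {morph phi : f g / f + g}.
  by move=> f g; rewrite /phi -big_split; apply: eq_bigr => x _; rewrite ffunE.
have phi0 : phi 0 = 0 by rewrite /phi big1 // => x _; rewrite ffunE.
have phiZ a f : phi (a *: f) = a * phi f.
  by rewrite /phi mulr_sumr; apply: eq_bigr => x _; rewrite ffunE.
have sum1 a : \sum_(x | connect (adj F) u x) ((x == a)%:R : 'F_2) =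
    (connect (adj F) u a)%:R.
  rewrite big_mkcond (bigD1 a) //= eqxx big1 => [|x /negPf->].
    by rewrite addr0; case: connect.
  by case: ifP.
have phiE a b : phi [ffun x => (x == a)%:R + (x == b)%:R] =
    (connect (adj F) u a)%:R + (connect (adj F) u b)%:R.
  rewrite /phi; under eq_bigr do rewrite ffunE.
  by rewrite big_split /= !sum1.
have := congr1 phi eqs; rewrite phiE connect0 (negPf nuv) (big_morph phi phiD phi0).
rewrite big1 ?addr0 // => i _; rewrite phiZ.
have /imageP[e eF ->] :
    (image_tuple (column D) F)`_i \in [seq column D e | e in F].
  by apply: mem_nth; rewrite size_image.
have adje : adj F (ends e).1 (ends e).2.
  by apply/existsP; exists e; rewrite eF /= -surjective_pairing eqxx.
have -> : phi (column D e) =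
    phi [ffun x => (x == (ends e).1)%:R + (x == (ends e).2)%:R].
  by congr phi; apply/ffunP=> x; rewrite !ffunE.
rewrite phiE (same_connect1r (sym_connect_sym (@adj_sym F)) adje).
by case: connect; apply/eqP; rewrite mulf_eq0 orbC.
Qed.

Lemma forestE (F : {set edge G}) : forest F = vector_indep D F.
Proof.
have colE e : column D e =
    [ffun x => (x == (ends e).1)%:R + (x == (ends e).2)%:R].
  by apply/ffunP=> x; rewrite !ffunE.
apply/forall_inP/vector_indepP => frF e eF.
  by rewrite colE -connect_span; exact: frF.
by rewrite connect_span -colE; exact: frF.
Qed.

Fact forest0 : forest set0.
Proof. by rewrite forestE vector_indep0. Qed.

Fact forestS (I J : {set edge G}) : I \subset J -> forest J -> forest I.
Proof. by rewrite !forestE; exact: vector_indepS. Qed.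

Fact forest_aug (I J : {set edge G}) : forest I -> forest J ->
  (#|I| < #|J|)%N -> exists2 x, x \in J :\: I & forest (x |: I).
Proof.
rewrite !forestE => iI iJ ltIJ.
by have [x xD ixI] := vector_indep_aug iI iJ ltIJ; exists x; rewrite ?forestE.
Qed.

Definition cycle_matroid : matroid (edge G) :=
  Matroid forest0 forestS forest_aug.

End CycleMatroid.

Definition even_cycle_matrix (G : graph) (W : {set edge G}) :
    binmx (unit + vertex G)%type (edge G) :=
  fun r e => match r with
             | inl _ => (e \in W)%:R
             | inr v => incidence v e
             end.

Definition even_cycle (T : finType) (M : matroid T) : Prop :=
  exists (G : graph) (W : {set edge G}),
    iso M (vector_matroid (even_cycle_matrix W)).

Definition complete_graph (n : nat) : graph :=
  @Graph 'I_n {p : 'I_n * 'I_n | (p.1 < p.2)%N} val.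

Definition graph_delete (G : graph) (F : {set edge G}) : graph :=
  @Graph (vertex G) {e : edge G | e \notin F} (fun e => ends (val e)).

(* The points of PG(3,2) are the lines of GF(2)^4, i.e. its nonzero vectors. *)
Definition PG32_point : finType := {v : {ffun 'I_4 -> 'F_2} | v != 0}.

Definition PG32 : matroid PG32_point :=
  vector_matroid (fun (i : 'I_4) (v : PG32_point) => val v i).

Definition K7_minus : graph :=
  @graph_delete (complete_graph 7)
    [set e | (nat_of_ord (val e).1 == 0%N)
           && (nat_of_ord (val e).2 \in [:: 1; 2]%N)].

Definition L19 : matroid (edge K7_minus) := dual (cycle_matroid K7_minus).

Definition L11_rows : seq (seq nat) :=
  [:: [:: 1; 0; 0; 0; 0; 0; 1; 0; 1; 0; 1];
      [:: 0; 1; 0; 0; 0; 0; 1; 0; 0; 1; 1];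
      [:: 0; 0; 1; 0; 0; 0; 0; 1; 1; 1; 0];
      [:: 0; 0; 0; 1; 0; 0; 0; 1; 1; 0; 1];
      [:: 0; 0; 0; 0; 1; 0; 0; 1; 0; 1; 1];
      [:: 0; 0; 0; 0; 0; 1; 0; 0; 1; 1; 1]]%N.

Definition L11 : matroid 'I_11 :=
  vector_matroid (fun (i : 'I_6) (j : 'I_11) =>
    (nth 0%N (nth [::] L11_rows i) j)%:R).

(* A square matrix that is an identity matrix once its rows and columns are
   matched by a bijection. *)
Definition is_identity (R K : finType) (A : binmx R K) : Prop :=
  exists2 f : R -> K, bijective f & forall r c, A r c = (f r == c)%:R.

(* The disjoint union of [Y0], [Y1] and [C] is the sum type. *)
Definition standard_form (C X Y0 Y1 : finType) (A1 : binmx X (Y0 + Y1 + C)%type) :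
    Prop :=
  exists (C0 C1 : {set C}) (X0 X1 : {set X}),
    [/\ C0 :|: C1 = setT /\ [disjoint C0 & C1],
        X0 :|: X1 = setT /\ [disjoint X0 & X1],
        is_identity (fun (x : {x : X | x \in X0}) (c : {c : C | c \in C0}) =>
                       A1 (val x) (inr (val c)))
      & forall x c, x \in X1 -> A1 x (inr c) = 0].

Record template := Template {
  tC : finType;
  tX : finType;
  tY0 : finType;
  tY1 : finType;
  tA1 : binmx tX (tY0 + tY1 + tC)%type;
  tDelta : {set {ffun (tY0 + tY1 + tC)%type -> 'F_2}};
  tLambda : {set {ffun tX -> 'F_2}};
  tDelta_subgroup : zmod_closed tDelta;
  tLambda_subgroup : zmod_closed tLambda;
  tA1_standard : standard_form tA1
}.

Section Conforming.
Variable Phi : template.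

Definition tY : finType := (tY0 Phi + tY1 Phi + tC Phi)%type.
Definition inY1 (j : tY1 Phi) : tY := inl (inr j).
Definition inC (c : tC Phi) : tY := inr c.

(* [R] is [B - X] and [F] is [E - (C u Y0 u Y1)]. *)
Variables R F : finType.
Implicit Types A : binmx (tX Phi + R)%type (tY + F)%type.

Definition respects A (Z : {set F}) : Prop :=
  [/\ forall x y, A (inl x) (inl y) = tA1 x y,
      (forall x z, z \in Z -> A (inl x) (inr z) = 0) /\
      (forall z, z \in Z -> exists r0, forall r, A (inr r) (inr z) = (r == r0)%:R),
      forall z, z \notin Z -> (#|[set r | A (inr r) (inr z) != 0%R]| <= 2)%N,
      forall z, z \notin Z -> [ffun x => A (inl x) (inr z)] \in tLambda Phi
    & forall r, [ffun y => A (inr r) (inl y)] \in tDelta Phi].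

Definition matrix_conforms A : Prop :=
  exists A' Z, [/\ respects A' Z,
    forall b y, A b (inl y) = A' b (inl y),
    forall b z, z \notin Z -> A b (inr z) = A' b (inr z)
  & forall z, z \in Z -> exists j, forall b,
      A b (inr z) = A' b (inr z) + A' b (inl (inY1 j))].

End Conforming.

(* [conforms Phi M] is membership of [M] in M(Phi). *)
Definition conforms (Phi : template) (T : finType) (M : matroid T) : Prop :=
  exists (R F : finType) (A : binmx (tX Phi + R)%type (tY Phi + F)%type),
    matrix_conforms A /\
    iso M (contract_delete (vector_matroid A)
             [set inl (inC c) | c : tC Phi] [set inl (inY1 j) | j : tY1 Phi]).

Definition matroid_class := forall T : finType, matroid T -> Prop.

(* Closed under isomorphism as well, since [has_minor] is up to isomorphism. *)
Definition minor_closed (K : matroid_class) : Prop :=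
  forall (T U : finType) (M : matroid T) (N : matroid U),
    K T M -> has_minor M N -> K U N.

Definition proper_minor_closed_binary (K : matroid_class) : Prop :=
  [/\ forall (T : finType) (M : matroid T), K T M -> binary M,
      minor_closed K
    & exists (T : finType) (M : matroid T), binary M /\ ~ K T M].

Definition vertical_template_hypothesis : Prop :=
  forall K : matroid_class, proper_minor_closed_binary K ->
  exists (k n s t : nat) (Phi : 'I_s -> template) (Psi : 'I_t -> template),
    [/\ (0 < k)%N /\ (0 < n)%N,
        forall i (T : finType) (M : matroid T), conforms (Phi i) M -> K T M,
        forall j (T : finType) (M : matroid T), conforms (Psi j) M -> K T (dual M),
        forall (T : finType) (M : matroid T),
          K T M -> simple M -> vertically_connected k M ->
          has_minor M (cycle_matroid (complete_graph n)) ->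
          exists i, conforms (Phi i) M
      & forall (T : finType) (M : matroid T),
          K T M -> cosimple M -> cyclically_connected k M ->
          has_minor M (dual (cycle_matroid (complete_graph n))) ->
          exists j, conforms (Psi j) (dual M)].

(* Main.v *)
From HB Require Import structures.
From mathcomp Require Import all_boot all_order all_algebra.
Require Import Defs.

Set Implicit Arguments.
Unset Strict Implicit.
Unset Printing Implicit Defensive.

Import GRing.Theory.

Local Open Scope ring_scope.

(* Applying the hypothesis to the class of binary matroids without the three minors
   gives templates Phi. If M conforms to Phi and is vertically k-connected with k >
   |Y_0| + 1 and of rank more than |Y_0|, then the columns of Y_0 lie in the span of
   Lambda and the columns of Y_1 and C on X. As M(Phi) contains no matroid with a
   PG(3,2)\e-minor, Delta vanishes on every linear relation modulo Lambda between
   columns of A_1, so row operations clear the rows with labels in Delta; and Lambda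
   has rank at most 1 modulo C. Coordinates modulo C with respect to a basis taken
   from Y_1 turn M into a minor of a complete graph together with elements given by
   even vertex sets T. If Lambda is spanned by l <> 0, then |T| <= 2 for all T, and
   the coordinate of l is the extra row of an even-cycle representation. If Lambda =
   0, excluding PG(3,2)\e gives |T| <= 4, and certain configurations of four-sets
   contain PG(3,2)\e or L_11; the remaining families of four-sets have a common pair
   {a, b}. Then every T \ {a, b} has at most two elements, and the row of a serves as
   extra row. Matroids that are not simple reduce to this case by deleting loops and
   parallel elements.

   Conversely, even-cycle matroids are closed under minors. In PG(3,2)\e and L_11
   every choice of vertex rows covers some element three times; L_19 has rank 13,
   whereas the vertex rows of a representation would be cocycles of size at least 3,
   so there are at most 2 * 19 / 3 of them. *)

(** The argument works with cycle spaces throughout: a binary matroid is given by the family of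
    column sets with sum zero, this family is unique, and minors, isomorphisms and representations
    become statements about it. Uniqueness also lets the rows of an assumed even-cycle
    representation be read as functionals on a known one. Forbidden minors of a template come from
    one generic conforming matrix holding every admissible frame column and every [Z] column over
    chosen rows. A linear map to a small space says what is contracted, and additive sections of it
    certify the minor; the rest are finite checks on boolean lists. The vanishing of Delta on
    relations is the consistency condition for functionals that reproduce the Delta labels and kill
    Lambda, hence the row operation. The obstacle is [Y_0], whose columns are arbitrary: the
    partition into [Y_0] and the rest has connectivity at most [|Y_0|], so high connectivity makes
    the rest spanning. *)

(** * Contraction and minors *)

(** Through the two dualities, the bases of the contraction are the sets [L :\: C] for bases [L] of
    [M] that meet [C] in as many elements as possible. Every basis that extends [C0] is of this
    kind, and in any other such basis the trace on [C] can be exchanged for [C0]. *)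
Lemma contract_indep (T : finType) (M : matroid T) (C C0 : {set T})
    (I : {set {x : T | x \notin C}}) :
  C0 \subset C -> indep M C0 ->
  (forall J : {set T}, J \subset C -> indep M J -> (#|J| <= #|C0|)%N) ->
  indep (contract M C) I = indep M (val @: I :|: C0).
Proof.
move=> sC0 iC0 maxC0.
have [B0 bB0 sB0] := exists_basis iC0.
have /basisP[iB0 mB0] := bB0.
pose S := {x : T | x \notin C}.
have dIC (J : {set S}) : [disjoint val @: J & C].
  rewrite disjoints_subset; apply/subsetP => _ /imsetP[x _ ->].
  by rewrite inE (valP x).
have split_card (J : {set T}) : #|J| = (#|J :\: C| + #|J :&: C|)%N.
  by rewrite -(cardsID C J) addnC.
have cardP (J : {set S}) (L : {set T}) : (forall x : S, (x \in J) = (val x \in L)) ->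
    #|L :\: C| = #|J|.
  move=> JL; rewrite -(card_imset _ val_inj); apply: eq_card => x.
  rewrite !inE; apply/andP/imsetP => [[xC xL]|[y yJ ->]].
    by exists (Sub x xC) => //; rewrite JL SubK.
  by rewrite (valP y) -JL.
have capC (L : {set T}) : indep M L -> (#|L :&: C| <= #|C0|)%N.
  move=> iL; apply: maxC0; first exact: subsetIr.
  by apply: indepS iL; exact: subsetIl.
have capB0 (L : {set T}) : indep M L -> C0 \subset L -> #|L :&: C| = #|C0|.
  move=> iL sL; apply/eqP; rewrite eqn_leq capC //.
  by apply/subset_leq_card; rewrite subsetI sL.
pose N := delete (dual M) C.
have NiP (J : {set S}) : reflect (exists2 B, basis M B & val @: J \subset ~: B) (indep N J).
  apply: (iffP existsP) => [[B /andP[? ?]]|[B ? ?]]; exists B => //.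
  by apply/andP.
(* All bases of [M] have the same size and none has more than [#|C0|] elements in [C], so [B0] has
   the fewest elements outside [C]. *)
have ub (J : {set S}) : indep N J -> (#|B0 :\: C| <= #|~: J|)%N.
  case/NiP=> B /basisP[iB mB] sJ.
  have cB : #|B| = #|B0| by apply/eqP; rewrite eqn_leq mB0 ?mB.
  have le1 : (#|B0 :\: C| <= #|B :\: C|)%N.
    rewrite -(leq_add2r #|B0 :&: C|) -split_card -cB (split_card B) leq_add2l.
    by rewrite (capB0 B0) // capC.
  apply: leq_trans le1 _; rewrite -(@cardP (~: J) (~: (val @: J))); last first.
    by move=> x; rewrite !inE mem_imset //; exact: val_inj.
  by apply/subset_leq_card/setSD; rewrite -setCS setCK.
have mk (L : {set T}) : basis M L -> C0 \subset L -> basis N [set x : S | val x \notin L].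
  move=> bL sL; have /basisP[iL mL] := bL.
  apply/basisP; split=> [|J iJ].
    by apply/NiP; exists L => //; apply/subsetP=> _ /imsetP[x + ->]; rewrite !inE.
  have := ub J iJ.
  have cL : #|L| = #|B0| by apply/eqP; rewrite eqn_leq mB0 ?mL.
  have -> : #|B0 :\: C| = #|~: [set x : S | val x \notin L]|.
    rewrite -(@cardP _ L); last by move=> x; rewrite !inE negbK.
    apply/eqP; rewrite -(eqn_add2r #|B0 :&: C|) -split_card -cL (split_card L).
    by rewrite eqn_add2l !capB0.
  move=> le; rewrite -(leq_add2r #|~: [set x : S | val x \notin L]|) cardsC.
  by rewrite -(cardsC J) leq_add2l.
apply/idP/idP => [/existsP[B /andP[bB sI]]|iIC].
  have /basisP[iB mB] := bB.
  case/NiP: (iB) => B1 bB1 sB; have /basisP[iB1 mB1] := bB1.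
  have cB : #|B1| = #|B0| by apply/eqP; rewrite eqn_leq mB0 ?mB1.
  have sX : B1 :\: C \subset val @: (~: B).
    apply/subsetP => x; rewrite inE => /andP[xC xB1].
    apply/imsetP; exists (Sub x xC) => //; rewrite inE.
    apply/negP => xB; have : x \in val @: B by apply/imsetP; exists (Sub x xC).
    by move/(subsetP sB); rewrite inE xB1.
  have le2 : (#|~: B| <= #|B0 :\: C|)%N.
    have := mB _ (basisP _ _ (mk _ bB0 sB0)).1 => le.
    rewrite -(leq_add2l #|B|) cardsC -(cardsC [set x : S | val x \notin B0]).
    apply: leq_add => //; rewrite -(@cardP _ B0) //.
    by move=> x; rewrite !inE negbK.
  have le1 : (#|~: B| <= #|B1 :\: C|)%N.
    apply: leq_trans le2 _.
    rewrite -(leq_add2r #|B0 :&: C|) -split_card -cB (split_card B1) leq_add2l.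
    by rewrite (capB0 B0) // capC.
  have eX : B1 :\: C = val @: (~: B).
    by apply/eqP; rewrite eqEcard sX (card_imset _ val_inj).
  (* Exchange the trace of [B1] on [C] for [C0]; counting then forces [K] to keep all of [B1 :\: C],
     hence all of [val @: I]. *)
  have [|K [iK sC0K sKU cK]] := indep_extend iC0 iB1; first exact: mB1.
  have sXK : B1 :\: C \subset K.
    have : K :\: C \subset B1 :\: C.
      rewrite -[B1 :\: C]set0U; have <- : C0 :\: C = set0 by apply/eqP; rewrite setD_eq0.
      by rewrite -setDUl setSD.
    move/subset_leqif_cards => le; have := le.2.
    suff /eqP-> : #|K :\: C| == #|B1 :\: C|.
      by rewrite eqxx => /esym/eqP <-; exact: subsetDl.
    rewrite eqn_leq le /= -(leq_add2r #|K :&: C|) -split_card cK cB (capB0 K) //.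
    rewrite -(capB0 B0) // (split_card B0) leq_add2r.
    by rewrite eX (card_imset _ val_inj).
  apply: indepS iK; rewrite subUset sC0K andbT.
  by apply: subset_trans sXK; rewrite eX; exact: imsetS.
have [L bL sL] := exists_basis iIC.
have [sIL sC0L] : val @: I \subset L /\ C0 \subset L by move: sL; rewrite subUset => /andP[].
apply/existsP; exists [set x : S | val x \notin L]; rewrite (mk _ bL sC0L) /=.
apply/subsetP => x xI; rewrite !inE negbK; apply: (subsetP sIL); exact: imset_f.
Qed.

Lemma max_indep_sub (T : finType) (M : matroid T) (C : {set T}) :
  exists C0 : {set T}, [/\ C0 \subset C, indep M C0 &
    forall J : {set T}, J \subset C -> indep M J -> (#|J| <= #|C0|)%N].
Proof.
have P0 : indep M set0 && (set0 \subset C) by rewrite indep0 sub0set.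
pose P (J : {set T}) := indep M J && (J \subset C).
case: (@arg_maxnP _ set0 P (fun J : {set T} => #|J|) P0) => C0 /andP[iC0 sC0] mC0.
by exists C0; split=> // J sJ iJ; apply: mC0; rewrite /P iJ sJ.
Qed.

(** A form of minors without subtypes: whatever lies neither in the image of [g] nor in [C] is
    deleted. The case [I = set0] of the last clause makes [C] independent, so that no maximal
    independent subset has to be chosen. *)
Lemma minorP (T U : finType) (M : matroid T) (N : matroid U) :
  has_minor M N <-> exists (g : U -> T) (C : {set T}),
    [/\ injective g, forall x, g x \notin C
      & forall I : {set U}, indep N I = indep M (g @: I :|: C)].
Proof.
split=> [[C [D [_ [f bf fE]]]]|[g [C [injg gC gE]]]].
  have [C0 [sC0 iC0 mC0]] := max_indep_sub M C.
  exists (fun x => val (val (f x))), C0; split.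
  - by move=> x y /val_inj/val_inj/(bij_inj bf).
  - by move=> x; apply: contra (valP (val (f x))); apply: (subsetP sC0).
  move=> I; rewrite -fE.
  transitivity (indep (contract M C) (val @: (f @: I))); first by [].
  rewrite (contract_indep _ sC0 iC0 mC0).
  by congr (indep M (_ :|: _)); rewrite -!imset_comp.
have iC : indep M C by have := gE set0; rewrite imset0 set0U indep0.
pose D := ~: (C :|: g @: setT).
pose f0 x : {x : T | x \notin C} := exist _ (g x) (gC x).
have gD x : f0 x \notin [set x | val x \in D].
  by rewrite !inE negb_or /= gC /= negbK imset_f.
pose f x : {x : {x : T | x \notin C} | x \notin [set x | val x \in D]} :=
  exist _ (f0 x) (gD x).
exists C, D; split.
  by rewrite disjoints_subset /D setCK subsetUl.
exists f.
  apply: inj_card_bij; first by move=> x y /(congr1 (val \o val)) /= /injg.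
  rewrite -(@card_imset _ _ (fun y => val (val y))); last first.
    by move=> x y /val_inj/val_inj.
  rewrite -cardsT -(card_imset _ injg); apply/subset_leq_card/subsetP.
  move=> _ /imsetP[y _ ->]; have := valP y; rewrite !inE negbK.
  by rewrite (negPf (valP (val y))).
move=> I; transitivity (indep (contract M C) (val @: (f @: I))); first by [].
rewrite (@contract_indep _ _ _ C) //; last by move=> J sJ _; exact: subset_leq_card.
by rewrite gE -!imset_comp; congr (indep M (_ :|: _)); apply: eq_imset.
Qed.

Lemma minor_trans (T U W : finType) (M : matroid T) (N : matroid U) (L : matroid W) :
  has_minor M N -> has_minor N L -> has_minor M L.
Proof.
move=> /minorP[g [C [injg gC gE]]] /minorP[h [D [injh hD hE]]].
apply/minorP; exists (g \o h), (g @: D :|: C); split.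
- exact: inj_comp.
- by move=> x; rewrite inE negb_or gC andbT /= mem_imset.
by move=> I; rewrite hE gE imsetU -imset_comp setUA.
Qed.

Lemma iso_minor (T U : finType) (M : matroid T) (N : matroid U) :
  iso M N -> has_minor N M.
Proof.
case=> f bf fE; apply/minorP; exists f, set0; split=> [||I].
- exact: bij_inj.
- by move=> x; rewrite inE.
by rewrite setU0 fE.
Qed.

Lemma iso_sym (T U : finType) (M : matroid T) (N : matroid U) : iso M N -> iso N M.
Proof.
case=> f [h fK hK] fE; exists h; first by exists f.
by move=> I; rewrite -fE -imset_comp (eq_imset _ hK) imset_id.
Qed.

Lemma iso_trans (T U W : finType) (M : matroid T) (N : matroid U) (L : matroid W) :
  iso M N -> iso N L -> iso M L.
Proof.
case=> f bf fE [h bh hE]; exists (h \o f); first exact: bij_comp.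
by move=> I; rewrite imset_comp hE fE.
Qed.

Lemma delete_minor (T : finType) (M : matroid T) (D : {set T}) : has_minor M (delete M D).
Proof.
apply/minorP; exists val, set0; split=> [||I]; first exact: val_inj.
  by move=> x; rewrite inE.
by rewrite setU0.
Qed.

(** * Vectors and symmetric differences over GF(2) *)

Notation vec B := {ffun B -> 'F_2}.

Definition sd (T : finType) (J K : {set T}) : {set T} :=
  [set x | (x \in J) (+) (x \in K)].

Lemma F2P (x : 'F_2) : {x = 0} + {x = 1}.
Proof.
by case: x => [[|[|m]] mP]; [left; apply/val_inj|right; apply/val_inj|exfalso].
Qed.

Lemma F2_neq0 (x : 'F_2) : (x != 0) = (x == 1).
Proof. by case: (F2P x) => ->. Qed.

Lemma addF2 (x : 'F_2) : x + x = 0.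
Proof. by case: (F2P x) => ->; apply/val_inj. Qed.

Lemma addvec (B : finType) (x : vec B) : x + x = 0.
Proof. by apply/ffunP => b; rewrite !ffunE addF2. Qed.

Lemma F2_addb (a b : bool) : ((a (+) b)%:R : 'F_2) = a%:R + b%:R.
Proof. by case: a; case: b; apply/val_inj. Qed.

Section SumSd.
Variables (T : finType) (V : zmodType) (F : T -> V).

Hypothesis char2 : forall x : V, x + x = 0.

Lemma sum_sd (J K : {set T}) :
  \sum_(e in sd J K) F e = \sum_(e in J) F e + \sum_(e in K) F e.
Proof.
rewrite big_mkcond [X in _ = X + _]big_mkcond [X in _ = _ + X]big_mkcond.
rewrite -big_split; apply: eq_bigr => e _ /=; rewrite inE.
by case: (e \in J); case: (e \in K) => /=; rewrite ?char2 ?addr0 ?add0r.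
Qed.

Lemma addr_eq0_char2 (x y : V) : x + y = 0 <-> x = y.
Proof.
split=> [xy|->]; last exact: char2.
by rewrite -[x]addr0 -(char2 y) addrA xy add0r.
Qed.

End SumSd.

Lemma sdK (T : finType) (J K : {set T}) : sd (sd J K) K = J.
Proof. by apply/setP => x; rewrite !inE -addbA addbb addbF. Qed.

Lemma sd0 (T : finType) (J : {set T}) : sd J set0 = J.
Proof. by apply/setP => x; rewrite !inE addbF. Qed.

Lemma sdC (T : finType) (J K : {set T}) : sd J K = sd K J.
Proof. by apply/setP => x; rewrite !inE addbC. Qed.

Lemma sd_subset (T : finType) (J K L : {set T}) :
  J \subset L -> K \subset L -> sd J K \subset L.
Proof.
move=> sJ sK; apply/subsetP => x; rewrite inE.
by case: (boolP (x \in J)) => [/(subsetP sJ)->//|_] /= /(subsetP sK).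
Qed.

Lemma sd_disjoint (T : finType) (J K : {set T}) :
  [disjoint J & K] -> sd J K = J :|: K.
Proof.
rewrite disjoints_subset => /subsetP dJK; apply/setP => x; rewrite !inE.
by case: (boolP (x \in J)) => [/dJK|_] //; rewrite inE => /negPf->.
Qed.

Lemma sum_setU_disj (T : finType) (V : zmodType) (F : T -> V) (J K : {set T}) :
  [disjoint J & K] ->
  \sum_(e in J :|: K) F e = \sum_(e in J) F e + \sum_(e in K) F e.
Proof.
move=> dJK; rewrite -bigU //; apply: eq_bigl => e; by rewrite !inE.
Qed.

(** * Cycle spaces of binary matroids *)

(** [Z] is the family of disjoint unions of circuits, that is, the kernel of a representing matrix
    read as a family of sets. *)
Definition cycle_space (T : finType) (M : matroid T) (Z : pred {set T}) : Prop :=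
  [/\ Z set0, forall J K, Z J -> Z K -> Z (sd J K)
    & forall I, indep M I = [forall J : {set T}, (J \subset I) && Z J ==> (J == set0)]].

Section CycleSpace.
Variables (T : finType) (M : matroid T) (Z : pred {set T}).
Hypothesis cZ : cycle_space M Z.

Lemma cycle0 : Z set0. Proof. by case: cZ. Qed.

Lemma cycle_sd J K : Z J -> Z K -> Z (sd J K).
Proof. by case: cZ => _ H _; exact: H. Qed.

Lemma cycle_indepP (I : {set T}) :
  reflect (forall J : {set T}, J \subset I -> Z J -> J = set0) (indep M I).
Proof.
case: cZ => _ _ ->; apply: (iffP forallP) => H J.
  by move=> sJ ZJ; apply/eqP; have := H J; rewrite sJ ZJ.
by apply/implyP => /andP[sJ ZJ]; apply/eqP; exact: H.
Qed.

Lemma cycle_sub_indep (I J : {set T}) : indep M I -> J \subset I -> Z J -> J = set0.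
Proof. by move/cycle_indepP; apply. Qed.

Lemma cycle_dep (I : {set T}) : ~~ indep M I -> exists J : {set T}, [/\ J \subset I, Z J & J != set0].
Proof.
case: cZ => _ _ ->; rewrite negb_forall => /existsP[J].
by rewrite negb_imply => /andP[/andP[? ?] ?]; exists J.
Qed.

Lemma cycle_ext (I : {set T}) x : indep M I -> ~~ indep M (x |: I) ->
  exists J : {set T}, [/\ J \subset x |: I, Z J & x \in J].
Proof.
move=> iI /cycle_dep[J [sJ ZJ J0]]; exists J; split=> //.
apply: contraNT J0 => xJ; apply/eqP; apply: (cycle_sub_indep iI) => //.
apply/subsetP => y yJ; have := subsetP sJ _ yJ; rewrite !inE.
by case: eqP => // yx; rewrite -yx yJ in xJ.
Qed.

(** Fundamental circuits over [C0] remove the elements of [K] outside [C0] one at a time. *)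
Lemma cycle_reduce (C C0 : {set T}) : C0 \subset C -> indep M C0 ->
  (forall J : {set T}, J \subset C -> indep M J -> (#|J| <= #|C0|)%N) ->
  forall K : {set T}, K \subset C -> exists2 K0 : {set T}, K0 \subset C0 & Z (sd K K0).
Proof.
move=> sC0 iC0 mC0 K; have [n] := ubnP #|K :\: C0|.
elim: n K => // n IHn K /ltnSE leK sK.
have [/eqP|[x]] := set_0Vmem (K :\: C0).
  rewrite setD_eq0 => sKC; exists K => //.
  suff -> : sd K K = set0 by exact: cycle0.
  by apply/setP => x; rewrite !inE addbb.
rewrite inE => /andP[xC0 xK].
have nI : ~~ indep M (x |: C0).
  apply/negP => iX; have sX : x |: C0 \subset C by rewrite subUset sub1set (subsetP sK).
  by have := mC0 _ sX iX; rewrite cardsU1 xC0 ltnn.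
have [J [sJ ZJ xJ]] := cycle_ext iC0 nI.
have [||K0 sK0 ZK] := IHn (sd K J).
- apply: leq_trans leK; apply: proper_card; apply/properP; split.
    apply/subsetP => y; rewrite !inE => /andP[yC0 +]; rewrite yC0 /=.
    case: (boolP (y \in J)) => [yJ|]; last by rewrite addbF.
    have := subsetP sJ _ yJ; rewrite !inE (negPf yC0) orbF => /eqP->.
    by rewrite xK.
  by exists x; rewrite !inE xC0 xK ?xJ.
- apply: sd_subset => //; apply: subset_trans sJ _.
  by rewrite subUset sub1set (subsetP sK).
exists K0 => //.
have -> : sd K K0 = sd (sd (sd K J) K0) J.
  by apply/setP => y; rewrite !inE; case: (y \in K); case: (y \in J); case: (y \in K0).
exact: cycle_sd.
Qed.

End CycleSpace.

(** A minimal dependent set belongs to every cycle space of [M], because a nonempty member inside it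
    must be all of it. Removing such a circuit from [J] starts an induction on the size of [J]. *)
Lemma cycle_space_unique (T : finType) (M : matroid T) (Z Z' : pred {set T}) :
  cycle_space M Z -> cycle_space M Z' -> Z =1 Z'.
Proof.
suff imp (Y Y' : pred {set T}) : cycle_space M Y -> cycle_space M Y' -> forall J, Y J -> Y' J.
  by move=> cZ cZ' J; apply/idP/idP; exact: imp.
move=> cY cY' J.
have [n] := ubnP #|J|; elim: n J => // n IHn J /ltnSE leJ YJ.
have [->//|JN0] := eqVneq J set0; first exact: cycle0 cY'.
have nJ : ~~ indep M J.
  apply/negP => /(cycle_indepP cY)/(_ _ (subxx _) YJ) J0.
  by rewrite J0 eqxx in JN0.
have [C /minsetP[nC minC] sCJ] := @minset_exists _ (fun J => ~~ indep M J) _ nJ.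
have key (X : pred {set T}) : cycle_space M X -> X C.
  move=> cX; have [K [sK XK K0]] := cycle_dep cX nC.
  suff <- : K = C by [].
  apply: minC => //; apply/negP => /(cycle_indepP cX)/(_ _ (subxx _) XK) E.
  by rewrite E eqxx in K0.
have C0 : C != set0 by apply: contraNneq nC => ->; exact: indep0.
rewrite -(sdK J C); apply: (cycle_sd cY'); last exact: key.
apply: IHn; last by apply: (cycle_sd cY) => //; exact: key.
have -> : sd J C = J :\: C.
  apply/setP => x; rewrite !inE; case: (boolP (x \in C)) => [/(subsetP sCJ)->//|_].
  by rewrite addbF.
by apply: leq_trans leJ; rewrite cardsD (setIidPr sCJ) ltn_subrL !card_gt0 C0 JN0.
Qed.

Lemma cycle_space_ext (T : finType) (M : matroid T) (Z Z' : pred {set T}) :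
  Z =1 Z' -> cycle_space M Z -> cycle_space M Z'.
Proof.
move=> eZ [Z0 Zsd Zi]; split=> [|J K|I]; rewrite -?eZ //; first exact: Zsd.
by rewrite Zi; apply: eq_forallb => J; rewrite eZ.
Qed.

Section MinorCycles.
Variables (T U : finType) (M : matroid T) (N : matroid U) (g : U -> T) (C : {set T}).
Hypotheses (injg : injective g) (gC : forall x, g x \notin C).

Definition minor_cycle (Z : pred {set T}) : pred {set U} := fun J =>
  [exists K : {set T}, (K \subset C) && Z (g @: J :|: K)].

Lemma minor_imset_disjoint (J : {set U}) (K : {set T}) :
  K \subset C -> [disjoint g @: J & K].
Proof.
move=> sK; rewrite disjoints_subset; apply/subsetP => _ /imsetP[x _ ->].
by rewrite inE; apply: contra (gC x) => /(subsetP sK).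
Qed.

Lemma imset_sd (J K : {set U}) : g @: sd J K = sd (g @: J) (g @: K).
Proof.
apply/setP => x; rewrite inE.
have [/imsetP[y _ ->]|nx] := boolP (x \in g @: setT).
  by rewrite !mem_imset // inE.
have nxA (A : {set U}) : (x \in g @: A) = false.
  by apply: contraNF nx; apply/subsetP/imsetS/subsetT.
by rewrite !nxA.
Qed.

Lemma minor_cycle_sd (Z : pred {set T}) : (forall J K : {set T}, Z J -> Z K -> Z (sd J K)) ->
  forall J K : {set U}, minor_cycle Z J -> minor_cycle Z K -> minor_cycle Z (sd J K).
Proof.
move=> Zsd J K /existsP[A /andP[sA ZA]] /existsP[B /andP[sB ZB]].
apply/existsP; exists (sd A B); rewrite sd_subset //=.
have := Zsd _ _ ZA ZB; rewrite imset_sd; congr Z.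
have dE (X : {set U}) (D : {set T}) x : D \subset C -> x \in g @: X -> x \in D = false.
  move=> sD xX; have := minor_imset_disjoint X sD.
  by rewrite disjoints_subset => /subsetP/(_ _ xX); rewrite inE => /negPf.
apply/setP => x; rewrite !inE.
case: (boolP (x \in g @: J)) => xJ; case: (boolP (x \in g @: K)) => xK //=;
  by rewrite ?(dE _ _ _ sA xJ) ?(dE _ _ _ sB xJ) ?(dE _ _ _ sA xK) ?(dE _ _ _ sB xK).
Qed.

Lemma minor_cycle_subset (J I : {set U}) (K L : {set T}) :
  K \subset C -> L \subset C -> g @: J :|: K \subset g @: I :|: L -> J \subset I.
Proof.
move=> sK sL /subsetP sJK; apply/subsetP => x xJ.
have := sJK (g x); rewrite !inE (mem_imset _ _ injg) xJ => /(_ isT).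
rewrite (mem_imset _ _ injg) => /orP[//|xL].
by case/negP: (gC x); apply: (subsetP sL).
Qed.

Lemma minor_cycle_space Z : cycle_space M Z ->
  (forall I : {set U}, indep N I = indep M (g @: I :|: C)) ->
  cycle_space N (minor_cycle Z).
Proof.
move=> cZ gE; split; first by apply/existsP; exists set0; rewrite sub0set imset0 setU0 (cycle0 cZ).
  by apply: minor_cycle_sd; case: cZ.
move=> I; rewrite gE; apply/(cycle_indepP cZ)/forallP => [H J|H J sJ ZJ].
  apply/implyP => /andP[sJ /existsP[K /andP[sK ZK]]].
  have := H _ (setUSS (imsetS g sJ) sK) ZK => /eqP.
  by rewrite setU_eq0 imset_eq0 => /andP[].
pose J1 := g @^-1: J.
have EJ : g @: J1 :|: (J :&: C) = J.
  apply/setP => x; rewrite !inE; apply/orP/idP => [[/imsetP[y + ->]|/andP[]//]|xJ].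
    by rewrite inE.
  have := subsetP sJ _ xJ; rewrite inE => /orP[/imsetP[y yI xE]|xC].
    by left; apply/imsetP; exists y; rewrite // inE -xE.
  by right; rewrite xJ.
have sJ1 : J1 \subset I.
  by apply: (@minor_cycle_subset _ _ (J :&: C) C); rewrite ?subsetIr ?subxx ?EJ.
have := H J1; rewrite sJ1 /=.
have -> /= : minor_cycle Z J1 by apply/existsP; exists (J :&: C); rewrite subsetIr EJ.
move/eqP => J10; move: EJ; rewrite J10 imset0 set0U => EJ.
have iC : indep M C.
  by have := gE set0; rewrite imset0 set0U indep0.
by apply: (cycle_sub_indep cZ iC) => //; rewrite -EJ subsetIr.
Qed.

(** Here [C] may be dependent: a maximal independent [C0] in it is contracted instead, and
    [cycle_reduce] moves the part of a cycle inside [C] into [C0]. *)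
Lemma cycles_minor Z ZN : cycle_space M Z -> cycle_space N ZN ->
  ZN =1 minor_cycle Z -> has_minor M N.
Proof.
move=> cZ cN eZ; have [C0 [sC0 iC0 mC0]] := max_indep_sub M C.
apply/minorP; exists g, C0; split=> // [x|I]; first by apply: contra (gC x); apply/subsetP.
apply/(cycle_indepP cN)/(cycle_indepP cZ) => [H J sJ ZJ|H J sJ].
  pose J1 := g @^-1: J.
  have EJ : g @: J1 :|: (J :&: C0) = J.
    apply/setP => x; rewrite !inE; apply/orP/idP => [[/imsetP[y + ->]|/andP[]//]|xJ].
      by rewrite inE.
    have := subsetP sJ _ xJ; rewrite inE => /orP[/imsetP[y yI xE]|xC].
      by left; apply/imsetP; exists y; rewrite // inE -xE.
    by right; rewrite xJ.
  have sJC : J :&: C0 \subset C by apply: subset_trans sC0; apply: subsetIr.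
  have J10 : J1 = set0.
    apply: H.
      by apply: (@minor_cycle_subset _ _ (J :&: C0) C0) => //; rewrite EJ.
    by rewrite eZ; apply/existsP; exists (J :&: C0); rewrite sJC EJ.
  move: EJ; rewrite J10 imset0 set0U => EJ.
  by apply: (cycle_sub_indep cZ iC0) => //; rewrite -EJ subsetIr.
rewrite eZ => /existsP[K /andP[sK ZK]].
have [K0 sK0 ZKK] := cycle_reduce cZ sC0 iC0 mC0 sK.
have sK0C := subset_trans sK0 sC0.
have := cycle_sd cZ ZK ZKK; rewrite -sd_disjoint ?minor_imset_disjoint //.
have -> : sd (sd (g @: J) K) (sd K K0) = sd (g @: J) K0.
  by apply/setP => y; rewrite !inE; case: (y \in g @: J); case: (y \in K); case: (y \in K0).
rewrite sd_disjoint ?minor_imset_disjoint // => /H /eqP.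
rewrite setUSS ?imsetS // => /(_ isT); rewrite setU_eq0 imset_eq0.
by case/andP => /eqP.
Qed.

End MinorCycles.

Section VectorCycles.
Variables (B E : finType) (A : binmx B E).

Definition sum_cycle : pred {set E} := fun J =>
  [forall b, \sum_(e in J) A b e == 0].

Lemma sum_cycleP (J : {set E}) : reflect (forall b, \sum_(e in J) A b e = 0) (sum_cycle J).
Proof. by apply: (iffP forallP) => H b; apply/eqP; have := H b; rewrite ?H. Qed.

Lemma span_subset (I : {set E}) (v : {ffun B -> ('F_2)^o}) :
  v \in <<[seq column A x | x in I]>>%VS ->
  exists2 J : {set E}, J \subset I & forall b, v b = \sum_(e in J) A b e.
Proof.
rewrite /image_mem => vI.
suff [J sJ vE] : exists2 J : {set E}, J \subset [set:: enum I] &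
    forall b, v b = \sum_(e in J) A b e by exists J; rewrite // -[I]set_enum.
elim: (enum I) v vI => {I} [|x s IHs] v /=.
  rewrite span_nil memv0 => /eqP->; exists set0; first exact: sub0set.
  by move=> b; rewrite big_set0 ffunE.
rewrite span_cons => /memv_addP[_ /vlineP[k ->] [w /IHs[J sJ wE] ->]].
have sJx : J \subset [set:: x :: s].
  by apply: subset_trans sJ _; apply/subsetP => y; rewrite !inE => ->; rewrite orbT.
have [k0|k1] := F2P k.
  by exists J => // b; rewrite k0 scale0r add0r.
exists (sd [set x] J).
  by apply: sd_subset => //; apply/subsetP => y; rewrite !inE => ->.
move=> b; rewrite (sum_sd _ addF2) big_set1 ffunE -wE; congr (_ + _).
by rewrite k1 scale1r ffunE.
Qed.

Lemma sum_cycle_sd (J K : {set E}) : sum_cycle J -> sum_cycle K -> sum_cycle (sd J K).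
Proof.
move=> /sum_cycleP ZJ /sum_cycleP ZK; apply/sum_cycleP => b.
by rewrite (sum_sd _ addF2) ZJ ZK addr0.
Qed.

Lemma vector_cycle_space : cycle_space (vector_matroid A) sum_cycle.
Proof.
split; [by apply/sum_cycleP => b; rewrite big_set0|exact: sum_cycle_sd|move=> I].
apply/vector_indepP/forallP => [H J|H e eI].
  apply/implyP => /andP[sJ /sum_cycleP ZJ]; apply/negPn/negP => /set0Pn[e eJ].
  case/negP: (H e (subsetP sJ _ eJ)).
  have -> : column A e = \sum_(x in J :\ e) column A x.
    apply/ffunP => b; have := ZJ b; rewrite (big_setD1 e) //= => /(addr_eq0_char2 addF2).
    by rewrite sum_ffunE ffunE => ->; apply: eq_bigr => i _; rewrite ffunE.
  apply: memv_suml => x; rewrite !inE => /andP[xe xJ]; apply/memv_span/image_f.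
  by rewrite !inE xe (subsetP sJ).
apply/negP => /span_subset[J sJ vE].
have eJ : e \notin J by apply/negP => /(subsetP sJ); rewrite !inE eqxx.
have := H (e |: J); rewrite subUset sub1set eI (subset_trans sJ) ?subsetDl //=.
have -> /= : sum_cycle (e |: J).
  by apply/sum_cycleP => b; rewrite big_setU1 //= -vE ffunE addF2.
by rewrite setU_eq0 -cards_eq0 cards1.
Qed.

End VectorCycles.

Lemma iso_cycle_space (T U : finType) (M : matroid T) (N : matroid U) (f : T -> U) Z :
  injective f -> (forall I : {set T}, indep N (f @: I) = indep M I) -> cycle_space N Z ->
  cycle_space M (fun J => Z (f @: J)).
Proof.
move=> injf fE cZ.
have nC x : f x \notin set0 by rewrite inE.
have H : forall I : {set T}, indep M I = indep N (f @: I :|: set0) by move=> I; rewrite setU0.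
apply: cycle_space_ext (minor_cycle_space injf nC cZ H) => J.
apply/existsP/idP => [[K]|ZJ]; last by exists set0; rewrite sub0set setU0.
by rewrite subset0 => /andP[/eqP-> ]; rewrite setU0.
Qed.

(** * Linear functionals and representations *)

Definition dot (B : finType) (d x : vec B) : 'F_2 := \sum_b d b * x b.

Lemma dotD (B : finType) (d x y : vec B) : dot d (x + y) = dot d x + dot d y.
Proof. by rewrite -big_split; apply: eq_bigr => b _; rewrite ffunE mulrDr. Qed.

Lemma dot0 (B : finType) (d : vec B) : dot d 0 = 0.
Proof. by rewrite /dot big1 // => b _; rewrite ffunE mulr0. Qed.

Lemma dot_sum (B I : finType) (P : pred I) (d : vec B) (F : I -> vec B) :
  dot d (\sum_(i | P i) F i) = \sum_(i | P i) dot d (F i).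
Proof. exact: (big_morph (dot d) (dotD d) (dot0 d)). Qed.

Lemma sum_set_coef (I : finType) (V : zmodType) (F : I -> V) (x : I -> 'F_2) (G : I -> 'F_2)
    (phi : V -> 'F_2) : phi 0 = 0 -> {morph phi : u v / u + v} ->
  (forall i, phi (F i) = G i) ->
  phi (\sum_(i in [set i | x i == 1]) F i) = \sum_i G i * x i.
Proof.
move=> phi0 phiD phiF; rewrite (big_morph phi phiD phi0) big_mkcond.
apply: eq_bigr => i _; rewrite inE phiF.
by case: (F2P (x i)) => -> /=; rewrite ?mulr0 ?mulr1.
Qed.

(** A row lies in the row space of [Fm] when the cokernel of [Fm] annihilates it, and over GF(2)
    each column of the cokernel is the indicator of a set [J] on which [f] sums to zero. *)
Lemma functional_ext (B I : finType) (f : I -> vec B) (c : I -> 'F_2) :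
  (forall J : {set I}, \sum_(i in J) f i = 0 -> \sum_(i in J) c i = 0) ->
  exists d : vec B, forall i, dot d (f i) = c i.
Proof.
move=> cf.
pose Fm : 'M['F_2]_(#|B|, #|I|) := \matrix_(p, q) f (enum_val q) (enum_val p).
pose cr : 'rV['F_2]_#|I| := \row_q c (enum_val q).
have sum_rank (G : 'I_#|I| -> 'F_2) : \sum_q G q = \sum_i G (enum_rank i).
  rewrite (reindex (@enum_rank I)) //=.
  by exists enum_val => i _; rewrite ?enum_rankK ?enum_valK.
have : (cr <= Fm)%MS.
  rewrite submxE; apply/eqP/rowP => j; rewrite !mxE.
  pose x i := cokermx Fm (enum_rank i) j.
  have := cf [set i | x i == 1] => H.
  transitivity (\sum_i c i * x i).
    by rewrite sum_rank; apply: eq_bigr => i _; rewrite mxE enum_rankK.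
  rewrite -(@sum_set_coef _ _ c x c id) //; apply: H.
  apply/ffunP => b; rewrite [RHS]ffunE.
  rewrite (@sum_set_coef _ _ f x (fun i => f i b) (fun v => v b)) ?ffunE //; last first.
    by move=> u v; rewrite ffunE.
  have /matrixP/(_ (enum_rank b) j) := mulmx_coker Fm.
  rewrite mxE [X in _ = X]mxE sum_rank => E0; apply: etrans E0; apply: eq_bigr => i _.
  by rewrite mxE !enum_rankK.
case/submxP => D DE; exists [ffun b => D 0 (enum_rank b)] => i.
have := congr1 (fun A : 'rV_#|I| => A 0 (enum_rank i)) DE; rewrite !mxE enum_rankK => ->.
rewrite /dot (reindex (@enum_val B predT)) /=; last first.
  by exists enum_rank => b _; rewrite ?enum_rankK ?enum_valK.
by apply: eq_bigr => p _; rewrite ffunE enum_valK !mxE enum_rankK.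
Qed.

(** Prescribe 0 on the columns of [C] and 1 on [x], which gets the extra index [None]. A relation
    through [None] would write [x] as a sum over a subset of [C]. *)
Lemma functional_sep (B I : finType) (f : I -> vec B) (C : {set I}) (x : vec B) :
  (forall K : {set I}, K \subset C -> \sum_(i in K) f i <> x) ->
  exists2 d : vec B, forall i, i \in C -> dot d (f i) = 0 & dot d x = 1.
Proof.
move=> nx.
pose h (o : option I) := if o is Some i then (if i \in C then f i else 0) else x.
have [|d dE] := @functional_ext B _ h (fun o => (o == None)%:R); last first.
  exists d; last by have := dE None.
  by move=> i iC; have := dE (Some i); rewrite /= iC.
move=> J; case: (boolP (None \in J)) => JN.
  rewrite (big_setD1 _ JN) /= => /(addr_eq0_char2 (@addvec _)) xE.
  case: (nx [set i in C | Some i \in J]); first by apply/subsetP => i; rewrite inE => /andP[].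
  rewrite xE; have -> : J :\ None = Some @: [set i | Some i \in J].
    apply/setP => -[i|]; rewrite !inE; first by rewrite mem_imset ?inE //; apply: Some_inj.
    by rewrite eqxx; apply/esym/negbTE/negP => /imsetP[].
  rewrite big_imset /=; last by move=> i k _ _ [].
  rewrite big_mkcond [RHS]big_mkcond /=; apply: eq_bigr => i _; rewrite !inE /=.
  by case: (i \in C); case: (_ \in J).
move=> _; rewrite big1 // => -[i|] //.
by move=> H; rewrite H in JN.
Qed.

Definition colv (B E : finType) (A : binmx B E) (e : E) : vec B := [ffun b => A b e].

Lemma sum_cycle_colv (B E : finType) (A : binmx B E) (J : {set E}) :
  sum_cycle A J = (\sum_(e in J) colv A e == 0).
Proof.
apply/sum_cycleP/eqP => [H|/ffunP H b].
  apply/ffunP => b; rewrite sum_ffunE [RHS]ffunE -[RHS](H b).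
  by apply: eq_bigr => e _; rewrite ffunE.
have := H b; rewrite sum_ffunE [RHS]ffunE => H0; rewrite -[RHS]H0.
by apply: eq_bigr => e _; rewrite ffunE.
Qed.

Lemma same_cycles_iso (T : finType) (M N : matroid T) (Z Z' : pred {set T}) :
  cycle_space M Z -> cycle_space N Z' -> Z =1 Z' -> iso M N.
Proof.
move=> [_ _ iM] [_ _ iN] eZ; exists id; first by exists id.
by move=> I; rewrite imset_id iM iN; apply: eq_forallb => J; rewrite eZ.
Qed.

Lemma binaryP (T : finType) (M : matroid T) :
  binary M <-> exists (B : finType) (A : binmx B T), cycle_space M (sum_cycle A).
Proof.
split=> [[B [E [A [f bf fE]]]]|[B [A cA]]].
  exists B, (fun b x => A b (f x)).
  apply: cycle_space_ext (iso_cycle_space (bij_inj bf) fE (vector_cycle_space A)) => J.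
  apply: eq_forallb => b; rewrite big_imset //=.
  by move=> x y _ _; exact: bij_inj.
exists B, T, A; exact: same_cycles_iso cA (vector_cycle_space A) (frefl _).
Qed.

(** The quotient by the contracted columns is represented by all functionals that vanish on them,
    one row for each; the remaining functionals give zero rows. By [functional_sep] these rows
    detect exactly the span of the contracted columns. *)
Lemma binary_minor (T U : finType) (M : matroid T) (N : matroid U) :
  binary M -> has_minor M N -> binary N.
Proof.
move=> /binaryP[B [A cA]] /minorP[g [C [injg gC gE]]]; apply/binaryP.
pose ok (d : vec B) := [forall c in C, dot d (colv A c) == 0].
exists (vec B), (fun d x => if ok d then dot d (colv A (g x)) else 0).
apply: cycle_space_ext (minor_cycle_space injg gC cA gE) => J.
have sumg (F : T -> vec B) : \sum_(e in g @: J) F e = \sum_(x in J) F (g x).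
  by rewrite big_imset //= => x y _ _; exact: injg.
apply/existsP/sum_cycleP => [[K /andP[sK]]|H].
  rewrite sum_cycle_colv sum_setU_disj ?(minor_imset_disjoint gC) // sumg => /eqP E0 d.
  case: (boolP (ok d)) => [/forall_inP okd|_]; last by rewrite big1.
  have := congr1 (dot d) E0; rewrite dotD dot0 !dot_sum [X in _ + X]big1 ?addr0 //.
  by move=> c cK; apply/eqP/okd/(subsetP sK).
case: (boolP [exists K : {set T}, (K \subset C) && (\sum_(e in K) colv A e == \sum_(x in J) colv A (g x))]).
  case/existsP=> K /andP[sK /eqP KE]; exists K; rewrite sK sum_cycle_colv.
  by rewrite sum_setU_disj ?(minor_imset_disjoint gC) // sumg KE addvec eqxx.
rewrite negb_exists => /forallP nK.
have [|d dC] := @functional_sep _ _ (colv A) C (\sum_(x in J) colv A (g x)).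
  by move=> K sK KE; have := nK K; rewrite sK KE eqxx.
have okd : ok d by apply/forall_inP => c cC; apply/eqP/dC.
by have := H d; rewrite okd dot_sum => ->.
Qed.

(** * Even-cycle matroids *)

Definition ecm (V T : finType) (w : T -> 'F_2) (D : binmx V T) : binmx (unit + V)%type T :=
  fun r e => match r with inl _ => w e | inr v => D v e end.

Lemma ecm_cycleP (V T : finType) (w : T -> 'F_2) (D : binmx V T) (J : {set T}) :
  reflect (\sum_(e in J) w e = 0 /\ forall v, \sum_(e in J) D v e = 0)
          (sum_cycle (ecm w D) J).
Proof.
apply: (iffP (sum_cycleP _ _)) => [H|[Hw HD]].
  by split=> [|v]; [exact: (H (inl tt))|exact: (H (inr v))].
by case=> [[]|v]; [exact: Hw|exact: HD].
Qed.

Definition inc (V T : finType) (en : T -> V * V) : binmx V T :=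
  fun v e => (v == (en e).1)%:R + (v == (en e).2)%:R.

(** The additional vertex [None] is the second end of each column with one nonzero entry and carries
    the loops coming from zero columns. Its row is the sum of the other rows, so it imposes no new
    condition on cycles. *)
Lemma even_cycle_of_frame (T V : finType) (M : matroid T) (w : T -> 'F_2) (D : binmx V T) :
  (forall e, (#|[set v | D v e != 0%R]| <= 2)%N) ->
  cycle_space M (sum_cycle (ecm w D)) -> even_cycle M.
Proof.
move=> le2 cM.
pose en e : option V * option V :=
  match enum [set v | D v e != 0%R] with
  | [::] => (None, None)
  | [:: u] => (Some u, None)
  | u :: v :: _ => (Some u, Some v)
  end.
have incE v e : inc en (Some v) e = D v e.
  have : (size (enum [set v | D v e != 0%R]) <= 2)%N by rewrite -cardE.
  have := mem_enum [set v | D v e != 0%R]; have := enum_uniq [set v | D v e != 0%R].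
  rewrite /inc /en; case: (enum _) => [|a [|b [|]]] //= u /(_ v); rewrite !inE => DE _.
  - by case: (F2P (D v e)) DE => ->; rewrite ?addr0.
  - have -> : (Some v == Some a) = (v == a) by [].
    by rewrite DE addr0; case: (F2P (D v e)) => ->.
  have -> : (Some v == Some a) = (v == a) by [].
  have -> : (Some v == Some b) = (v == b) by [].
  rewrite -F2_addb.
  have -> : (v == a) (+) (v == b) = (v == a) || (v == b).
    by case: (eqVneq v a) => // ->; case: eqP u => // ->; rewrite inE eqxx.
  by rewrite DE; case: (F2P (D v e)) => ->.
exists (@Graph (option V) T en), [set e | w e == 1].
apply: (same_cycles_iso cM (vector_cycle_space _)) => J.
apply/ecm_cycleP/sum_cycleP => [[Hw HD]|H].
  case=> [_|[v|]] /=.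
  - rewrite -[RHS]Hw; apply: eq_bigr => e _; rewrite inE.
    by case: (F2P (w e)) => ->.
  - by rewrite -[RHS](HD v); apply: eq_bigr => e _; rewrite -incE.
  have col0 e : inc en None e = \sum_v D v e.
    under eq_bigr do rewrite -incE /inc; rewrite big_split /=.
    have sum1 (o : option V) : \sum_v ((Some v == o)%:R : 'F_2) = (o != None)%:R.
      case: o => [u|]; last by rewrite big1.
      by rewrite (bigD1 u) //= eqxx big1 ?addr0 // => v /negPf vu; rewrite (_ : _ == _ = false).
    rewrite !sum1 /inc ![None == _]eq_sym.
    by case: ((en e).1 == None); case: ((en e).2 == None); apply/val_inj.
  transitivity (\sum_(e in J) \sum_v D v e).
    by apply: eq_bigr => e _; rewrite -col0.
  by rewrite exchange_big big1.
split; first by rewrite -[RHS](H (inl tt)); apply: eq_bigr => e _; rewrite /= inE; case: (F2P (w e)) => ->.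
by move=> v; rewrite -[RHS](H (inr (Some v))); apply: eq_bigr => e _; rewrite -incE.
Qed.

Lemma inc_card (V T : finType) (en : T -> V * V) e :
  (#|[set v | inc en v e != 0%R]| <= 2)%N.
Proof.
apply: leq_trans (_ : (#|[set (en e).1; (en e).2]| <= 2)%N); last first.
  by rewrite cards2; case: eqP.
apply/subset_leq_card/subsetP => v; rewrite !inE /inc.
by case: (v == (en e).1) => //; case: (v == (en e).2) => //; rewrite addr0 eqxx.
Qed.

Lemma even_cycleP (T : finType) (M : matroid T) :
  even_cycle M <-> exists (V : finType) (w : T -> 'F_2) (en : T -> V * V),
    cycle_space M (sum_cycle (ecm w (inc en))).
Proof.
split=> [[G [W [f bf fE]]]|[V [w [en cM]]]]; last first.
  by apply: even_cycle_of_frame cM; exact: inc_card.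
exists (vertex G), (fun e => (f e \in W)%:R), (fun e => ends (f e)).
apply: cycle_space_ext (iso_cycle_space (bij_inj bf) fE (vector_cycle_space _)) => J.
have sumf (F : edge G -> 'F_2) : \sum_(e in f @: J) F e = \sum_(x in J) F (f x).
  by rewrite big_imset //= => x y _ _; exact: bij_inj.
apply/sum_cycleP/sum_cycleP => H b; rewrite -[RHS](H b) ?sumf; by case: b.
Qed.

(** A graph loop with sign 0 is a matroid loop; one with sign 1 is the unit vector of the sign row,
    so contracting it erases that row. If the ends differ, adding [w c] times the row of [v] to the
    sign row makes the sign of [c] zero, and then [v] is merged into [u]. *)
Lemma ec_contract1 (V T : finType) (w : T -> 'F_2) (en : T -> V * V) (c : T) :
  exists (w' : T -> 'F_2) (en' : T -> V * V), forall J : {set T}, c \notin J ->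
    sum_cycle (ecm w' (inc en')) J =
    sum_cycle (ecm w (inc en)) J || sum_cycle (ecm w (inc en)) (c |: J).
Proof.
case: (eqVneq (en c).1 (en c).2) => [uv|uv].
  have inc0 v : inc en v c = 0 by rewrite /inc uv addF2.
  case: (F2P (w c)) => wc.
    exists w, en => J cJ; rewrite (_ : sum_cycle _ (c |: J) = sum_cycle (ecm w (inc en)) J) ?orbb //.
    apply: eq_forallb => b; rewrite big_setU1 //=.
    by case: b => [_|v] /=; rewrite ?wc ?inc0 add0r.
  exists (fun => 0), en => J cJ.
  apply/ecm_cycleP/orP => [[_ HD]|[] /ecm_cycleP[_ HD]].
  - case: (F2P (\sum_(e in J) w e)) => wJ; [left|right]; apply/ecm_cycleP; split=> //.
      by rewrite big_setU1 //= wc wJ; apply/val_inj.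
    by move=> v; rewrite big_setU1 //= inc0 HD addr0.
  - by split; rewrite ?big1.
  split; first by rewrite big1.
  by move=> v; have := HD v; rewrite big_setU1 //= inc0 add0r.
set u := (en c).1 in uv *; set v := (en c).2 in uv *.
pose h x := if x == v then u else x.
exists (fun e => w e + w c * inc en v e), (fun e => (h (en e).1, h (en e).2)) => J cJ.
pose S x := \sum_(e in J) inc en x e.
have hE x y : ((x == h y)%:R : 'F_2) =
    if x == v then 0 else if x == u then (y == u)%:R + (y == v)%:R else (x == y)%:R.
  rewrite /h; have [yv|yv] := eqVneq y v; have [xv|xv] := eqVneq x v.
  - by rewrite xv eq_sym (negPf uv).
  - have [//|xu] := eqVneq x u; first by rewrite yv eq_sym (negPf uv) add0r.
    by rewrite yv (negPf xv).
  - by rewrite xv eq_sym (negPf yv).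
  have [xu|//] := eqVneq x u.
  by rewrite xu eq_sym addr0.
have S'E x : \sum_(e in J) inc (fun e => (h (en e).1, h (en e).2)) x e =
    if x == v then 0 else if x == u then S u + S v else S x.
  rewrite /inc /= big_split /= (eq_bigr _ (fun e _ => hE x _)).
  rewrite [X in _ + X](eq_bigr _ (fun e _ => hE x _)).
  case: ifP => _; first by rewrite !big1 ?addr0.
  case: ifP => _; last by rewrite /S /inc big_split.
  rewrite /S /inc !big_split /= addrACA.
  by congr (_ + _ + (_ + _)); apply: eq_bigr => e _; rewrite eq_sym.
have w'E : \sum_(e in J) (w e + w c * inc en v e) = \sum_(e in J) w e + w c * S v.
  by rewrite big_split /= mulr_sumr.
have cE x : \sum_(e in c |: J) inc en x e = (x == u)%:R + (x == v)%:R + S x.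
  by rewrite big_setU1.
have vu : v == u = false by rewrite eq_sym (negPf uv).
apply/ecm_cycleP/orP => [[Hw HD]|[] /ecm_cycleP[Hw HD]].
- have Su : S u = S v.
    by have := HD u; rewrite S'E (negPf uv) eqxx => /(addr_eq0_char2 addF2).
  have Sx x : x != u -> x != v -> S x = 0.
    by move=> /negPf xu /negPf xv; have := HD x; rewrite S'E xu xv.
  move: Hw; rewrite w'E; case: (F2P (S v)) => Sv; rewrite Sv ?mulr0 ?mulr1 => Hw.
    left; apply/ecm_cycleP; split; first by rewrite -[RHS]Hw addr0.
    move=> x; rewrite -/(S x).
    have [->|xu] := eqVneq x u; first by rewrite Su.
    by have [->|xv] := eqVneq x v; [rewrite Sv|exact: Sx].
  right; apply/ecm_cycleP; split; first by rewrite big_setU1 //= addrC.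
  move=> x; rewrite cE; have [->|xu] := eqVneq x u.
    by rewrite (negPf uv) Su Sv; apply/val_inj.
  have [->|xv] := eqVneq x v; first by rewrite Sv; apply/val_inj.
  by rewrite Sx // !addr0.
- split; first by rewrite w'E Hw [S v]HD mulr0 addr0.
  by move=> x; rewrite S'E; do 2?case: ifP => // _; rewrite /S !HD ?addr0.
have Sv : S v = 1.
  by have := HD v; rewrite cE eqxx vu add0r => /(addr_eq0_char2 addF2).
have Su : S u = 1.
  by have := HD u; rewrite cE eqxx (negPf uv) addr0 => /(addr_eq0_char2 addF2).
split; first by rewrite w'E Sv mulr1; move: Hw; rewrite big_setU1 //= addrC.
move=> x; rewrite S'E; case: ifP => // xv; case: ifP => xu; first by rewrite Sv Su addF2.
by have := HD x; rewrite cE xu xv !add0r.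
Qed.

Lemma ec_contract (V T : finType) (C : {set T}) (w : T -> 'F_2) (en : T -> V * V) :
  exists (w' : T -> 'F_2) (en' : T -> V * V), forall J : {set T}, [disjoint J & C] ->
    sum_cycle (ecm w' (inc en')) J =
    [exists K : {set T}, (K \subset C) && sum_cycle (ecm w (inc en)) (J :|: K)].
Proof.
have [n] := ubnP #|C|; elim: n C w en => // n IHn C w en /ltnSE leC.
have [->|[c cC]] := set_0Vmem C.
  exists w, en => J _; apply/idP/existsP => [ZJ|[K]].
    by exists set0; rewrite sub0set setU0.
  by rewrite subset0 => /andP[/eqP->]; rewrite setU0.
have [w1 [en1 E1]] := ec_contract1 w en c.
have [|w2 [en2 E2]] := IHn (C :\ c) w1 en1.
  by apply: leq_trans leC; rewrite [X in (_ < X)%N](cardsD1 c) cC.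
exists w2, en2 => J dJC.
have dJ : [disjoint J & C :\ c] by apply: disjointWr dJC; exact: subsetDl.
have cJ : c \notin J by apply/negP => cJ; have := disjointFr dJC cJ; rewrite cC.
rewrite E2 //; apply/existsP/existsP => [[K /andP[sK]]|[K /andP[sK ZK]]].
  have cK : c \notin J :|: K.
    by rewrite inE negb_or cJ; apply/negP => /(subsetP sK); rewrite !inE eqxx.
  rewrite E1 // => /orP[ZK|ZK].
    by exists K; rewrite ZK (subset_trans sK) // subsetDl.
  exists (c |: K); rewrite setUCA ZK andbT subUset sub1set cC.
  by rewrite (subset_trans sK) // subsetDl.
exists (K :\ c); rewrite setSD //= E1; last by rewrite !inE eqxx negb_or cJ.
case: (boolP (c \in K)) => cK.
  by rewrite setUCA setD1K // ZK orbT.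
suff -> : K :\ c = K by rewrite ZK.
by apply/setDidPl; rewrite disjoint_sym disjoints1.
Qed.

Lemma even_cycle_minor (T U : finType) (M : matroid T) (N : matroid U) :
  even_cycle M -> has_minor M N -> even_cycle N.
Proof.
move=> /even_cycleP[V [w [en cM]]] /minorP[g [C [injg gC gE]]].
have [w' [en' E']] := ec_contract C w en.
apply/even_cycleP; exists V, (w' \o g), (en' \o g).
apply: cycle_space_ext (minor_cycle_space injg gC cM gE) => J.
rewrite /minor_cycle -E'; last exact: minor_imset_disjoint (subxx _).
have sumg (F : T -> 'F_2) : \sum_(e in g @: J) F e = \sum_(x in J) F (g x).
  by rewrite big_imset //= => x y _ _; exact: injg.
by apply: eq_forallb => b; rewrite sumg; case: b.
Qed.

(** * The excluded minors are not even-cycle matroids *)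

Definition bdot (a b : seq bool) : bool := foldr addb false [seq p.1 && p.2 | p <- zip a b].

(** Boolean lists stand for vectors in every check that is left to evaluation; [lv] is the inverse
    translation. *)
Definition vl (m : nat) (l : seq bool) : vec 'I_m := [ffun i => (nth false l (nat_of_ord i))%:R].

Definition lv (m : nat) (d : vec 'I_m) : seq bool :=
  mkseq (fun i => oapp (fun j => d j == 1) false (insub i)) m.

Lemma size_lv m (d : vec 'I_m) : size (lv d) = m. Proof. exact: size_mkseq. Qed.

Lemma lvK m (d : vec 'I_m) : vl m (lv d) = d.
Proof.
apply/ffunP => i; rewrite ffunE nth_mkseq // insubT //= => iP.
rewrite (_ : Sub _ _ = i); last exact/val_inj.
by case: (F2P (d i)) => ->.
Qed.

Lemma dot_vl m (a b : seq bool) : size a = m -> size b = m ->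
  dot (vl m a) (vl m b) = (bdot a b)%:R.
Proof.
elim: m a b => [|m IHm] [|x a] [|y b] //= => [_ _|[sa] [sb]].
  by rewrite /dot big_ord0.
rewrite /dot big_ord_recl F2_addb -(IHm a b) //; congr (_ + _).
  by rewrite !ffunE /=; case: x; case: y; apply/val_inj.
by apply: eq_bigr => i _; rewrite !ffunE.
Qed.

Lemma vl_inj m (a b : seq bool) : size a = m -> size b = m -> vl m a = vl m b -> a = b.
Proof.
move=> sa sb /ffunP ab; apply: (@eq_from_nth _ false) => [|i]; first by rewrite sa.
rewrite sa => im; have := ab (Ordinal im); rewrite !ffunE /=.
by case: (nth _ a _); case: (nth _ b _).
Qed.

Lemma vl_neq0 m (l : seq bool) : size l = m -> has id l -> vl m l != 0.
Proof.
move=> sl /hasP[b bl bt]; have im : (index b l < m)%N by rewrite -sl index_mem.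
by apply/eqP => /ffunP/(_ (Ordinal im)); rewrite !ffunE /= nth_index // bt.
Qed.

Fixpoint bools (m : nat) : seq (seq bool) :=
  if m is m'.+1 then [seq b :: l | b <- [:: true; false], l <- bools m'] else [:: [::]].

Lemma mem_bools (l : seq bool) : l \in bools (size l).
Proof. by elim: l => [|b l IHl] //; apply: allpairs_f => //; case: b. Qed.

Lemma bools_size m (l : seq bool) : l \in bools m -> size l = m.
Proof. by elim: m l => [|m IHm] l; [rewrite inE => /eqP->|case/allpairsP => -[b k] /= [_ /IHm <- ->]]. Qed.

Lemma bools_uniq m : uniq (bools m).
Proof.
elim: m => // m IHm; apply: allpairs_uniq => //.
by move=> [b k] [b' k'] _ _ /= [-> ->].
Qed.

Definition add_cover (cov : seq bool) (cnt : seq nat) : seq nat :=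
  [seq (nat_of_bool p.1 + p.2)%N | p <- zip cov cnt].

(* Search for a family of functionals on [GF(2)^m] of rank at least [m - 1] such that
   at most [t] of the given points lie in three of the supports: [zs] lists the vectors
   annihilated by the functionals chosen so far, [cnt] how often they cover each point,
   and [table] the functionals still available, with the points that they cover. A
   family of rank at least [m - 1] does not annihilate both [z1] and [z2]. *)
Fixpoint rank_refute (t : nat) (table : seq (seq bool * seq bool)) (fuel : nat)
    (zs : seq (seq bool)) (cnt : seq nat) : bool :=
  if fuel is n.+1 then
    if zs is z1 :: z2 :: _ then
      let good := [seq p <- table | (count (leq 3) (add_cover p.2 cnt) <= t)%N] in
      all (fun p => if bdot p.1 z1 || bdot p.1 z2 then
          rank_refute t good n [seq z <- zs | ~~ bdot p.1 z] (add_cover p.2 cnt)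
        else true) good
    else false
  else false.

Definition cover_table (m : nat) (cols : seq (seq bool)) : seq (seq bool * seq bool) :=
  [seq (f, [seq bdot f x | x <- cols]) | f <- bools m].

(** Rows of a representation vanish on cycles, hence are functionals on GF(2)^m. The points span, so
    the vertex functionals and the sign functional have no common nonzero zero, and the vertex
    functionals alone have rank at least [m - 1]. The bound [t] allows [cols] to list [t] points
    absent from [E]. *)
Lemma not_even_cycle (E : finType) (M : matroid E) (m t : nat) (u : E -> vec 'I_m)
    (cols : seq (seq bool)) (fuel : nat) :
  cycle_space M (fun J => \sum_(x in J) u x == 0) ->
  (forall z, exists J : {set E}, \sum_(x in J) u x = z) ->
  (forall p, (t < count p cols)%N -> exists x, p (lv (u x))) ->
  rank_refute t (cover_table m cols) fuel [seq z <- bools m | has id z]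
    (nseq (size cols) 0%N) -> ~ even_cycle M.
Proof.
move=> cM spu colsP refP /even_cycleP[V [w [en cM']]].
have eqZ := cycle_space_unique cM cM'.
have [d dE] : exists d : V -> vec 'I_m, forall v x, dot (d v) (u x) = inc en v x.
  apply: (@fin_all_exists V _ (fun v d => forall x, dot d (u x) = inc en v x)) => v.
  apply: functional_ext => J uJ.
  by have /esym := eqZ J; rewrite uJ eqxx => /ecm_cycleP[_ ->].
have [dw dwE] : exists dw : vec 'I_m, forall x, dot dw (u x) = w x.
  apply: functional_ext => J uJ.
  by have /esym := eqZ J; rewrite uJ eqxx => /ecm_cycleP[-> _].
have sep (z : vec 'I_m) : z != 0 -> dot dw z = 0 -> exists v, dot (d v) z = 1.
  move=> z0 dwz; have [J JE] := spu z.
  case: (boolP [exists v, dot (d v) z == 1]) => [/existsP[v /eqP]|]; first by exists v.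
  rewrite negb_exists => /forallP nv; case/negP: z0; rewrite -JE.
  rewrite [_ == _]eqZ; apply/ecm_cycleP; split.
    by rewrite -[RHS]dwz -JE dot_sum; apply: eq_bigr => x _; rewrite dwE.
  move=> v; case: (F2P (dot (d v) z)) (nv v) => [dv _|-> //].
  by rewrite -[RHS]dv -JE dot_sum; apply: eq_bigr => x _; rewrite dE.
(* The sign functional vanishes on one of [z1], [z2], [z1 + z2], and there some vertex functional
   does not. *)
have sep2 (z1 z2 : vec 'I_m) : z1 != 0 -> z2 != 0 -> z1 != z2 ->
    exists v, (dot (d v) z1 == 1) || (dot (d v) z2 == 1).
  move=> z10 z20 z12.
  have [w1|w1] := F2P (dot dw z1); first by have [v dv] := sep _ z10 w1; exists v; rewrite dv.
  have [w2|w2] := F2P (dot dw z2); first by have [v dv] := sep _ z20 w2; exists v; rewrite dv orbT.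
  have z120 : z1 + z2 != 0 by apply: contra z12 => /eqP/(addr_eq0_char2 (@addvec _))->.
  have [|v] := sep _ z120; first by rewrite dotD w1 w2; apply/val_inj.
  rewrite dotD => dv; exists v; move: dv.
  by case: (F2P (dot (d v) z1)) => ->; case: (F2P (dot (d v) z2)) => ->.
have bdotE v l : size l = m -> bdot (lv (d v)) l = (dot (d v) (vl m l) == 1).
  move=> sl; rewrite -{2}[d v]lvK dot_vl ?size_lv //.
  by case: bdot.
pose cov v := [seq bdot (lv (d v)) x | x <- cols].
pose cntv vs := [seq count (fun v => bdot (lv (d v)) x) vs | x <- cols].
have cntE v vs : add_cover (cov v) (cntv vs) = cntv (v :: vs).
  by rewrite /add_cover /cov /cntv; elim: (cols) => //= x s ->.
(* If more than [t] listed points were covered three times, one of them would be an element of [E],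
   that is, an edge with three ends. *)
have good vs : uniq vs -> (count (leq 3) (cntv vs) <= t)%N.
  move=> uvs; rewrite leqNgt count_map; apply/negP => /colsP[x] /=.
  rewrite ltnNge => /negP; apply; apply: leq_trans (inc_card en x).
  rewrite -size_filter cardE; apply: uniq_leq_size; first by rewrite filter_uniq.
  move=> y; rewrite mem_filter => /andP[+ _]; rewrite bdotE ?size_lv // lvK dE => /eqP ye.
  by rewrite mem_enum inE ye.
suff: forall vs table zs, uniq vs ->
    (forall v, v \notin vs -> (lv (d v), cov v) \in table) ->
    uniq zs -> (forall z, z \in zs -> [/\ size z = m, vl m z != 0
      & forall v, v \in vs -> dot (d v) (vl m z) != 1]) ->
    rank_refute t table fuel zs (cntv vs) -> False.
  move/(_ [::] (cover_table m cols) [seq z <- bools m | has id z]); apply=> //.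
  - move=> v _; apply/mapP; exists (lv (d v)) => //.
    by have := mem_bools (lv (d v)); rewrite size_lv.
  - by rewrite filter_uniq ?bools_uniq.
  - move=> z; rewrite mem_filter => /andP[bz /bools_size sz]; split=> //.
    exact: vl_neq0.
  by rewrite (_ : cntv [::] = nseq (size cols) 0%N) // /cntv; elim: (cols) => //= _ s ->.
elim: fuel {refP} => // n IHn vs table [|z1 [|z2 zs]] // uvs tabP uzs zP.
have [s1 n1 o1] := zP z1 (mem_head _ _).
have [|s2 n2 o2] := zP z2; first by rewrite !inE eqxx orbT.
have z12 : vl m z1 != vl m z2.
  apply/eqP => /(vl_inj s1 s2) z12.
  by move: uzs; rewrite z12 /= inE eqxx.
have [v vP] := sep2 _ _ n1 n2 z12.
have vvs : v \notin vs.
  apply/negP => vvs; move: vP.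
  by rewrite (negPf (o1 _ vvs)) (negPf (o2 _ vvs)).
have hv : bdot (lv (d v)) z1 || bdot (lv (d v)) z2 by rewrite !bdotE.
pose tab' := [seq p <- table | (count (leq 3) (add_cover p.2 (cntv vs)) <= t)%N].
have goodP y : y \notin vs -> (lv (d y), cov y) \in tab'.
  by move=> yvs; rewrite mem_filter tabP // andbT /= cntE; apply: good; rewrite /= yvs.
move=> /allP/(_ _ (goodP v vvs)); rewrite hv cntE; apply: (IHn (v :: vs)).
- by rewrite /= vvs.
- by move=> y; rewrite inE negb_or => /andP[_]; exact: goodP.
- exact: filter_uniq.
move=> z; rewrite mem_filter => /andP[bz /zP[sz z0 oz]]; split=> // y.
rewrite inE => /predU1P[->|]; last exact: oz.
by rewrite -bdotE.
Qed.

Lemma PG32_delete_cycles (e : PG32_point) :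
  cycle_space (delete PG32 [set e]) (fun J => \sum_(x in J) val (val x) == 0).
Proof.
have fE (I : {set {x : PG32_point | x \notin [set e]}}) :
    indep PG32 (val @: I) = indep (delete PG32 [set e]) I by [].
apply: cycle_space_ext (iso_cycle_space val_inj fE (vector_cycle_space _)) => J /=.
rewrite sum_cycle_colv big_imset /=; last by move=> x y _ _; exact: val_inj.
by congr (_ == _); apply: eq_bigr => x _; apply/ffunP => b; rewrite ffunE.
Qed.

Definition L11_col (j : 'I_11) : vec 'I_6 :=
  [ffun i => (nth 0%N (nth [::] L11_rows (nat_of_ord i)) j)%:R].

Lemma L11_cycles : cycle_space L11 (fun J => \sum_(x in J) L11_col x == 0).
Proof.
apply: cycle_space_ext (vector_cycle_space _) => J; rewrite sum_cycle_colv.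
by congr (_ == _); apply: eq_bigr => x _; apply/ffunP => b; rewrite !ffunE.
Qed.

Lemma vlK m (l : seq bool) : size l = m -> lv (vl m l) = l.
Proof. by move=> sl; apply: (@vl_inj m); rewrite ?size_lv ?lvK. Qed.

Lemma PG32_delete_point (e : PG32_point) (y : vec 'I_4) : y != 0 -> y != val e ->
  exists x : {x : PG32_point | x \notin [set e]}, val (val x) = y.
Proof.
move=> y0 ye; pose p : PG32_point := exist (fun v : {ffun 'I_4 -> 'F_2} => v != 0) y y0.
have h : p \notin [set e] by rewrite inE; apply: contra ye => /eqP <-.
by exists (exist (fun x => x \notin [set e]) p h).
Qed.

Lemma PG32_not_even_cycle (e : PG32_point) : ~ even_cycle (delete PG32 [set e]).
Proof.
(* All 15 points are listed, and [t = 1] allows for the deleted one, whichever it is. The dimension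
   is enough fuel, since each chosen functional lowers the dimension of the space annihilated so
   far. *)
apply: (@not_even_cycle _ _ 4 1 (fun x => val (val x)) [seq l <- bools 4 | has id l] 4 (PG32_delete_cycles e)).
- move=> z; have [->|z0] := eqVneq z 0; first by exists set0; rewrite big_set0.
  have [ze|ze] := eqVneq z (val e); last first.
    by have [x xE] := PG32_delete_point z0 ze; exists [set x]; rewrite big_set1.
  (* The deleted point is the sum of the two present points [y] and [z + y]. *)
  have [y /andP[y0 yz]] : exists y : vec 'I_4, (y != 0) && (y != z).
    case: (boolP [exists y : vec 'I_4, (y != 0) && (y != z)]) => [/existsP //|].
    rewrite negb_exists => /forallP H.
    have cle : (#|{: vec 'I_4}| <= #|[set (0%R : vec 'I_4); (z : vec 'I_4)]|)%N.
      apply/subset_leq_card/subsetP => y _; rewrite !inE.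
      by have := H y; rewrite negb_and !negbK.
    by move: cle; rewrite card_ffun !card_ord cards2; case: (_ != _).
  have y'0 : z + y != 0 by apply: contra yz => /eqP/(addr_eq0_char2 (@addvec _))->.
  have ye : y != val e by rewrite -ze.
  have y'e : z + y != val e.
    by rewrite -ze; apply: contra y0 => /eqP zy; rewrite -[y]add0r -(addvec z) -addrA zy addvec.
  have [x xE] := PG32_delete_point y0 ye; have [x' x'E] := PG32_delete_point y'0 y'e.
  exists [set x; x']; rewrite big_setU1 ?inE; last first.
    by apply: contra z0 => /eqP xx'; rewrite -(add0r z) -(addvec y) -addrA [y + z]addrC -x'E -xE xx' addvec.
  by rewrite /= big_set1 xE x'E addrCA addvec addr0.
- move=> p; rewrite -size_filter; set s := filter _ _.
  have us : uniq s by rewrite !filter_uniq ?bools_uniq.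
  have sP l : l \in s -> [/\ p l, vl 4 l != 0 & size l = 4].
    by rewrite !mem_filter => /and3P[pl bl /bools_size sl]; split=> //; exact: vl_neq0.
  have pt l : l \in s -> vl 4 l != val e ->
      exists x : {x : PG32_point | x \notin [set e]}, p (lv (val (val x))).
    move=> /sP[pl l0 sl] le; have [x xE] := PG32_delete_point l0 le.
    by exists x; rewrite xE vlK.
  case: s us sP pt => [|a [|b s]] // /andP[/= + _] sP pt _; rewrite inE negb_or => /andP[ab _].
  have [ae|] := eqVneq (vl 4 a) (val e); last by apply: pt; rewrite inE eqxx.
  apply: (pt b); first by rewrite !inE eqxx orbT.
  have [_ _ sa] := sP a (mem_head _ _).
  have [|_ _ sb] := sP b; first by rewrite !inE eqxx orbT.
  by rewrite -ae; apply: contra ab => /eqP/(vl_inj sb sa) ->.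
by vm_compute.
Qed.

Definition L11_list (j : nat) : seq bool :=
  [seq nth 0%N (nth [::] L11_rows i) j == 1%N | i <- iota 0 6].

Lemma L11_listE (j : 'I_11) : vl 6 (L11_list j) = L11_col j.
Proof.
apply/ffunP => i; rewrite !ffunE.
by case: j => -[|[|[|[|[|[|[|[|[|[|[|]]]]]]]]]]] //= _; case: i => -[|[|[|[|[|[|]]]]]].
Qed.

Lemma L11_not_even_cycle : ~ even_cycle L11.
Proof.
apply: (@not_even_cycle _ _ 6 0 L11_col [seq L11_list j | j <- iota 0 11] 6 L11_cycles).
- move=> z; rewrite -(lvK z); set l := lv z.
  exists [set j : 'I_11 | (j < 6)%N && (nth false l j)].
  apply/ffunP => i; rewrite sum_ffunE big_mkcond !big_ord_recl big_ord0 /= !inE /=.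
  by rewrite !ffunE; case: i => -[|[|[|[|[|[|]]]]]] //= _;
    rewrite !if_same !addr0 ?add0r; case: (oapp _ _ _).
- move=> p; rewrite -has_count => /hasP[_ /mapP[j + ->] pj].
  rewrite mem_iota => /andP[_ j11]; exists (Ordinal j11).
  by rewrite -L11_listE vlK // size_map.
by vm_compute.
Qed.

Lemma cycle_matroid_cycles (G : graph) :
  cycle_space (cycle_matroid G) (sum_cycle (@incidence G)).
Proof.
have [Z0 Zsd Zi] := vector_cycle_space (@incidence G).
by split=> // I; rewrite -Zi; exact: forestE.
Qed.

Section SimpleGraph.
Variables (n : nat) (E : finType) (en : E -> 'I_n * 'I_n).
Hypotheses (en_inj : injective en) (en_lt : forall e, ((en e).1 < (en e).2)%N).

Lemma simple_graph_indep2 (e f : E) : indep (cycle_matroid (Graph en)) [set e; f].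
Proof.
apply/(cycle_indepP (cycle_matroid_cycles (Graph en))) => J sJ /sum_cycleP ZJ.
have nl x : inc en (en x).1 x = 1.
  by rewrite /inc eqxx -val_eqE /= ltn_eqF ?en_lt // addr0.
have nr x : inc en (en x).2 x = 1.
  by rewrite /inc eqxx eq_sym -val_eqE /= ltn_eqF ?en_lt // add0r.
have one x : J != [set x].
  by apply/eqP => Jx; have := ZJ (en x).1; rewrite Jx big_set1 [incidence _ _]nl.
have [fe|fe] := eqVneq e f.
  apply/eqP; apply: contraT => J0; case/negP: (one e); rewrite eqEsubset.
  move: sJ; rewrite fe setUid => sJ; rewrite sJ /= sub1set.
  by have /set0Pn[x xJ] := J0; have := subsetP sJ _ xJ; rewrite inE => /eqP <-.
have [eJ|eJ] := boolP (e \in J); have [fJ|fJ] := boolP (f \in J).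
- have JE : J = [set e; f] by apply/eqP; rewrite eqEsubset sJ subUset !sub1set eJ.
  have sumE v : inc en v e = inc en v f.
    have := ZJ v; rewrite JE big_setU1 ?inE // big_set1 => /(addr_eq0_char2 addF2).
    exact.
  have end_f x : inc en x f = 1 -> (x == (en f).1) || (x == (en f).2).
    by rewrite /inc; case: (x == _); case: (x == _).
  have := end_f _ (etrans (esym (sumE _)) (nl e)).
  have := end_f _ (etrans (esym (sumE _)) (nr e)).
  case/orP=> /eqP e2 /orP[]/eqP e1.
  + by have := en_lt e; rewrite e1 e2 ltnn.
  + by have := en_lt e; rewrite e1 e2 ltnNge ltnW // en_lt.
  + by case/negP: fe; apply/eqP/en_inj; rewrite [en e]surjective_pairing [en f]surjective_pairing e1 e2.
  + by have := en_lt e; rewrite e1 e2 ltnn.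
- case/negP: (one e); rewrite eqEsubset sub1set eJ andbT; apply/subsetP => x xJ.
  by have := subsetP sJ _ xJ; rewrite !inE => /orP[//|/eqP xf]; rewrite -xf xJ in fJ.
- case/negP: (one f); rewrite eqEsubset sub1set fJ andbT; apply/subsetP => x xJ.
  by have := subsetP sJ _ xJ; rewrite !inE => /orP[/eqP xf|//]; rewrite -xf xJ in eJ.
apply/eqP/negPn/negP => /set0Pn[x xJ]; have := subsetP sJ _ xJ; rewrite !inE.
by case/orP => /eqP xE; rewrite -xE xJ // in eJ fJ.
Qed.

End SimpleGraph.

Lemma dual_basis (T : finType) (M : matroid T) (B : {set T}) :
  basis M B -> basis (dual M) (~: B).
Proof.
move=> bB; have /basisP[iB mB] := bB; apply/basisP; split.
  by apply/existsP; exists B; rewrite bB subxx.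
move=> J /existsP[B1 /andP[bB1 sJ]]; have /basisP[iB1 mB1] := bB1.
apply: leq_trans (subset_leq_card sJ) _.
by rewrite -(leq_add2l #|B1|) cardsC -(cardsC B) leq_add2r mB1.
Qed.

(** Subsets of [I] are told apart by the rows of [R0] on which they sum to 1, so [2 ^ #|I|] is at
    most [2 ^ #|R0|]. *)
Lemma indep_card_rows (B E : finType) (M : matroid E) (A : binmx B E) (R0 : {set B})
    (I : {set E}) : cycle_space M (sum_cycle A) ->
  (forall J : {set E}, (forall b, b \in R0 -> \sum_(e in J) A b e = 0) -> sum_cycle A J) ->
  indep M I -> (#|I| <= #|R0|)%N.
Proof.
move=> cM R0P iI.
pose h (J : {set E}) := [set b in R0 | \sum_(e in J) A b e == 1].
rewrite -(leq_exp2l (m := 2)) // -!card_powerset.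
rewrite -(@card_in_imset _ _ h (powerset I)); last first.
  move=> J K; rewrite !powersetE => sJ sK hJK.
  suff JK : sd J K = set0 by rewrite -[LHS](sdK J K) JK sdC sd0.
  apply: (cycle_sub_indep cM iI); first exact: sd_subset.
  apply: R0P => b bR; rewrite (sum_sd _ addF2).
  have /setP/(_ b) := hJK; rewrite !inE bR /=.
  by case: (F2P (\sum_(e in J) A b e)) => ->; case: (F2P (\sum_(e in K) A b e)) => ->; rewrite ?addF2.
apply/subset_leq_card/subsetP => _ /imsetP[J _ ->]; rewrite powersetE.
by apply/subsetP => b; rewrite inE => /andP[].
Qed.

Lemma sum_inc (V T : finType) (en : T -> V * V) e : \sum_v inc en v e = 0.
Proof.
rewrite /inc big_split /=.
have sum1 u : \sum_v ((v == u)%:R : 'F_2) = 1.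
  by rewrite (bigD1 u) //= eqxx big1 ?addr0 // => v /negPf ->.
by rewrite !sum1; apply/val_inj.
Qed.

(* The rows of an incidence matrix sum to zero. *)
Lemma inc_row_redundant (V T : finType) (en : T -> V * V) (J : {set T}) (v0 : V) :
  (forall v, v != v0 -> \sum_(e in J) inc en v e = 0) -> \sum_(e in J) inc en v0 e = 0.
Proof.
move=> H; transitivity (\sum_(e in J) \sum_v inc en v e).
  by rewrite exchange_big /= [RHS](bigD1 v0) //= [X in _ + X]big1 ?addr0.
by rewrite big1 // => e _; exact: sum_inc.
Qed.

Lemma card_K7_minus : #|edge K7_minus| = 19%N.
Proof.
pose P (p : 'I_7 * 'I_7) := (p.1 < p.2)%N && ~~ ((p.1 == 0%N :> nat) && (nat_of_ord p.2 \in [:: 1%N; 2%N])).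
have -> : #|edge K7_minus| = #|[set p | P p]|.
  rewrite -(@card_imset _ _ (fun e : edge K7_minus => val (val e))); last first.
    by move=> x y /val_inj/val_inj.
  apply: eq_card => p; rewrite inE; apply/imsetP/idP => [[e _ ->]|/andP[p1 p2]].
    by have := valP e; rewrite inE /P => ->; rewrite (valP (val e)).
  pose e0 : edge (complete_graph 7) := exist (fun p : 'I_7 * 'I_7 => (p.1 < p.2)%N) p p1.
  have e0P : e0 \notin [set e | (nat_of_ord (val e).1 == 0%N) && (nat_of_ord (val e).2 \in [:: 1; 2]%N)].
    by rewrite inE.
  by exists (exist _ e0 e0P).
rewrite -sum1dep_card big_mkcond /=.
rewrite -(pair_big xpredT xpredT (fun i j => if P (i, j) then 1%N else 0%N)) /=.
by rewrite !big_ord_recl !big_ord0.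
Qed.

(** Counting incidences leaves at most 12 nonzero vertex rows. One of them is the sum of the others
    and the sign row adds one, so the rank would be at most 12, whereas the graph has 19 edges and
    rank at most 6. *)
Lemma L19_not_even_cycle : ~ even_cycle L19.
Proof.
move=> /even_cycleP[V [w [en cN]]].
set M := cycle_matroid K7_minus.
have pairM (e f : edge K7_minus) : indep M [set e; f].
  apply: (@simple_graph_indep2 7 _ (fun e : edge K7_minus => val (val e))).
    by move=> x y /val_inj/val_inj.
  by move=> x; exact: (valP (val x)).
pose S v := [set e | inc en v e != 0].
have S3 v : S v != set0 -> (2 < #|S v|)%N.
  case/set0Pn=> e eS; rewrite ltnNge; apply/negP => le2.
  have [f sS] : exists f, S v \subset [set e; f].
    have : (#|S v :\ e| <= 1)%N by move: le2; rewrite (cardsD1 e) eS.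
    have [S0|[f fS]] := set_0Vmem (S v :\ e).
      by move=> _; exists e; rewrite -(setD1K eS) S0 setU0 sub1set !inE eqxx.
    move=> le1; exists f; rewrite -(setD1K eS) setUS //.
    have /eqP -> : S v :\ e == [set f] by rewrite eq_sym eqEcard sub1set fS cards1.
    by [].
  (* A support of at most two edges is independent in the simple graph, so it lies in a basis [B].
     The circuit of [L19] that [e] closes with [~: B] would meet the support in [e] alone,
     contradicting that row [v] sums to zero on it. *)
  have iS : indep M (S v) by apply: indepS sS _; exact: pairM.
  have [B bB sB] := exists_basis iS.
  have /basisP[iB' mB'] := dual_basis bB.
  have eB : e \notin ~: B by rewrite inE negbK (subsetP sB).
  have nB : ~~ indep L19 (e |: ~: B).
    by apply/negP => /mB'; rewrite cardsU1 eB ltnn.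
  have [J [sJ /ecm_cycleP[_ ZJ] eJ]] := cycle_ext cN iB' nB.
  have := ZJ v; rewrite (big_setD1 e) //= big1 ?addr0 => [e0|x].
    by move: eS; rewrite inE e0 eqxx.
  rewrite !inE => /andP[xe xJ]; have := subsetP sJ _ xJ.
  rewrite !inE (negPf xe) /= => xB; apply/eqP; apply: contraNT xB => xS.
  by apply: (subsetP sB); rewrite inE.
pose V0 := [set v | S v != set0].
have V0le : (#|V0| <= 12)%N.
  have : (#|V0| * 3 <= 19 * 2)%N.
    rewrite -sum_nat_const -card_K7_minus -sum_nat_const.
    apply: (@leq_trans (\sum_v #|S v|)).
      by rewrite big_mkcond; apply: leq_sum => v _; rewrite inE; case: ifP => // /S3.
    have -> : (\sum_v #|S v| = \sum_(e : edge K7_minus) #|[set v | inc en v e != 0%R]|)%N.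
      under eq_bigr do rewrite -sum1dep_card big_mkcond /=.
      rewrite exchange_big /=; apply: eq_bigr => e _.
      by rewrite -sum1dep_card [RHS]big_mkcond.
    by apply: leq_sum => e _; exact: inc_card.
  move=> le; rewrite leqNgt; apply/negP => gt.
  by have := leq_trans (leq_mul gt (leqnn 3)) le.
have rkN (I : {set edge K7_minus}) : indep L19 I -> (#|I| <= 12)%N.
  move=> iI; have [V00|[v0 v0V]] := set_0Vmem V0.
    apply: (@leq_trans #|[set (inl tt : unit + V)%type]|); last by rewrite cards1.
    apply: (indep_card_rows cN _ iI) => J H.
    apply/ecm_cycleP; split; first by have := H (inl tt); rewrite inE eqxx; apply.
    move=> v; rewrite big1 // => e _; apply/eqP; apply: contraT => De.
    have : v \in V0 by rewrite inE; apply/set0Pn; exists e; rewrite inE.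
    by rewrite V00 inE.
  (* Dropping the row of [v0], the sum of the other vertex rows, makes room for the sign row. *)
  apply: (@leq_trans #|inl tt |: [set inr v | v in V0 :\ v0]|).
    apply: (indep_card_rows cN _ iI) => J H.
    have H' v : v != v0 -> \sum_(e in J) inc en v e = 0.
      move=> vv0; have [vV|vV] := boolP (v \in V0).
        apply: (H (inr v)); rewrite inE; apply/orP; right.
        by apply: imset_f; rewrite in_setD1 vv0.
      rewrite big1 // => e _; apply/eqP; apply: contraNT vV => De.
      by rewrite inE; apply/set0Pn; exists e; rewrite inE.
    apply/ecm_cycleP; split; first by apply: (H (inl tt)); rewrite !inE eqxx.
    move=> v; have [->|] := eqVneq v v0; last exact: H'.
    exact: inc_row_redundant.
  rewrite cardsU1 card_imset; last by move=> ? ? [].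
  apply: leq_trans V0le; rewrite [X in (_ <= X)%N](cardsD1 v0) v0V leq_add2r.
  by case: (_ \notin _).
have [B bB _] := exists_basis (indep0 M).
have /basisP[iB _] := bB; have /basisP[iB' _] := dual_basis bB.
have leB : (#|B| <= 6)%N.
  apply: (@leq_trans #|[set~ (ord0 : 'I_7)]|); last by rewrite cardsC1 card_ord.
  apply: (indep_card_rows (cycle_matroid_cycles _) _ iB) => J H.
  have H' (v : 'I_7) : v != ord0 -> \sum_(e in J) inc (@ends K7_minus) v e = 0.
    by move=> v0; apply: (H v); rewrite !inE.
  apply/sum_cycleP => v; have [->|v0] := eqVneq v (ord0 : 'I_7); last exact: H'.
  exact: inc_row_redundant H'.
have := leq_add leB (rkN _ iB'); rewrite cardsC.
by rewrite card_K7_minus.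
Qed.

Section Pull.
Variables (T U : finType) (M : matroid T) (f : U -> T).
Hypothesis injf : injective f.

Definition pull_indep (I : {set U}) : bool := indep M (f @: I).

Fact pull_indep0 : pull_indep set0.
Proof. by rewrite /pull_indep imset0 indep0. Qed.

Fact pull_indepS (I J : {set U}) : I \subset J -> pull_indep J -> pull_indep I.
Proof. by move=> sIJ; apply: indepS; exact: imsetS. Qed.

Fact pull_indep_aug (I J : {set U}) : pull_indep I -> pull_indep J -> (#|I| < #|J|)%N ->
  exists2 x, x \in J :\: I & pull_indep (x |: I).
Proof.
move=> iI iJ; rewrite -(card_imset I injf) -(card_imset J injf) => ltIJ.
have [_ /setDP[/imsetP[x xJ ->] xI] ixI] := indep_aug iI iJ ltIJ.
exists x; last by rewrite /pull_indep imsetU1.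
by rewrite inE xJ andbT; apply: contra xI; exact: imset_f.
Qed.

Definition pull_matroid : matroid U := Matroid pull_indep0 pull_indepS pull_indep_aug.

Lemma pull_iso : bijective f -> iso pull_matroid M.
Proof. by exists f. Qed.

End Pull.

Lemma contract_delete_cycles (T : finType) (M : matroid T) (C D : {set T}) (Z : pred {set T}) :
  cycle_space M Z ->
  cycle_space (contract_delete M C D) (minor_cycle (fun x => val (val x)) C Z).
Proof.
move=> cZ; have [C0 [sC0 iC0 mC0]] := max_indep_sub M C.
pose g (x : {x : {x : T | x \notin C} | x \notin [set x | val x \in D]}) := val (val x).
have injg : injective g by move=> x y /val_inj/val_inj.
have gC x : g x \notin C := valP (val x).
have gC0 x : g x \notin C0 by apply: contra (gC x); apply/subsetP.
apply: (cycle_space_ext _ (minor_cycle_space injg gC0 cZ _)) => [J|I].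
  apply/existsP/existsP => -[K /andP[sK ZK]].
    by exists K; rewrite ZK (subset_trans sK).
  have [K0 sK0 ZKK] := cycle_reduce cZ sC0 iC0 mC0 sK.
  exists K0; rewrite sK0 /=; have := cycle_sd cZ ZK ZKK.
  rewrite -sd_disjoint ?(minor_imset_disjoint gC) //.
  have -> : sd (sd (g @: J) K) (sd K K0) = sd (g @: J) K0.
    by apply/setP => y; rewrite !inE; case: (y \in g @: J); case: (y \in K); case: (y \in K0).
  by rewrite sd_disjoint // (minor_imset_disjoint gC) // (subset_trans sK0).
transitivity (indep (contract M C) (val @: I)); first by [].
by rewrite (contract_indep _ sC0 iC0 mC0) -imset_comp.
Qed.

(** * The matroids conforming to a template *)

Section TemplateMatroid.
Variable Phi : template.
Local Notation X := (tX Phi).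
Local Notation Y := (tY Phi).
Local Notation Y0 := (tY0 Phi).
Local Notation Y1 := (tY1 Phi).
Local Notation C := (tC Phi).

Definition inY0 (y : Y0) : Y := inl (inl y).

Section Matrix.
Variables (R F : finType) (A : binmx (X + R)%type (Y + F)%type).

Definition Cset : {set (Y + F)%type} := [set inl (inC c) | c : C].
Definition Y1set : {set (Y + F)%type} := [set inl (inY1 j) | j : Y1].

Definition ground (e : (Y0 + F)%type) : (Y + F)%type :=
  match e with inl y => inl (inY0 y) | inr z => inr z end.

Lemma ground_inj : injective ground.
Proof. by move=> [y|z] [y'|z'] //= [->]. Qed.

Lemma groundC e : ground e \notin Cset.
Proof. by apply/negP => /imsetP[c _]; case: e. Qed.

Lemma groundY1 e :
  (exist (fun x => x \notin Cset) (ground e) (groundC e)) \notin [set x | val x \in Y1set].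
Proof. by rewrite inE /=; apply/negP => /imsetP[j _]; case: e. Qed.

Definition to_minor (e : (Y0 + F)%type) :
    {x : {x : (Y + F)%type | x \notin Cset} | x \notin [set x | val x \in Y1set]} :=
  exist _ (exist _ (ground e) (groundC e)) (groundY1 e).

Lemma to_minor_inj : injective to_minor.
Proof. by move=> e e' /(congr1 (fun x => val (val x))) /ground_inj. Qed.

Lemma to_minor_bij : bijective to_minor.
Proof.
apply: (inj_card_bij to_minor_inj).
rewrite -(@card_imset _ _ (fun y : {x : {x : (Y + F)%type | x \notin Cset} |
  x \notin [set x | val x \in Y1set]} => val (val y))); last by move=> x y /val_inj/val_inj.
rewrite -cardsT -(card_imset _ ground_inj); apply/subset_leq_card/subsetP.
move=> _ /imsetP[y _ ->]; have := valP y; have := valP (val y); rewrite inE.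
case: (val (val y)) => [[[y0|y1]|c]|z] nC nY1.
- by apply/imsetP; exists (inl y0).
- by case/negP: nY1; apply: imset_f.
- by case/negP: nC; apply: imset_f.
by apply/imsetP; exists (inr z).
Qed.

(** Transport along [to_minor] makes [Y0 + F] the ground set in place of two nested subtypes. *)
Definition tmatroid : matroid (Y0 + F)%type :=
  pull_matroid (contract_delete (vector_matroid A) Cset Y1set) to_minor_inj.

Definition tcycle : pred {set (Y0 + F)%type} := fun J =>
  [exists K : {set C}, \sum_(e in J) colv A (ground e) == \sum_(c in K) colv A (inl (inC c))].

Lemma tmatroid_cycles : cycle_space tmatroid tcycle.
Proof.
have H := contract_delete_cycles Cset Y1set (vector_cycle_space A).
have fE (I : {set (Y0 + F)%type}) :
   indep (contract_delete (vector_matroid A) Cset Y1set) (to_minor @: I) = indep tmatroid I by [].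
apply: cycle_space_ext (iso_cycle_space to_minor_inj fE H) => J.
have imJ : [set val (val x) | x in to_minor @: J] = ground @: J by rewrite -imset_comp.
have iC : injective (fun c : C => inl (inC c) : (Y + F)%type) by move=> c c' [].
rewrite /minor_cycle /tcycle imJ; apply/existsP/existsP => -[K].
  case/andP=> sK ZK; exists [set c | inl (inC c) \in K].
  have KE : K = [set inl (inC c) | c in [set c | inl (inC c) \in K]].
    apply/setP => x; apply/idP/imsetP => [xK|[c + ->]]; last by rewrite inE.
    by have /imsetP[c _ xc] := subsetP sK _ xK; exists c; rewrite // inE -xc.
  move: ZK; rewrite sum_cycle_colv sum_setU_disj; last exact: (minor_imset_disjoint groundC).
  move/eqP/(addr_eq0_char2 (@addvec _)) => ZK; apply/eqP.
  rewrite {1}KE !big_imset /= in ZK; [exact: ZK| |] => ? ? _ _; [exact: iC|exact: ground_inj].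
move/eqP => ZK; exists [set inl (inC c) | c in K].
have sK : [set (inl (inC c) : (Y + F)%type) | c in K] \subset Cset.
  by apply/subsetP => _ /imsetP[c _ ->]; apply: imset_f.
rewrite sK sum_cycle_colv sum_setU_disj; last exact: (minor_imset_disjoint groundC).
rewrite !big_imset /= ?ZK ?addvec // => ? ? _ _; [exact: iC|exact: ground_inj].
Qed.

End Matrix.

Lemma conformsP (T : finType) (M : matroid T) :
  conforms Phi M <-> exists (R F : finType) (A : binmx (X + R)%type (Y + F)%type),
    matrix_conforms A /\ iso M (tmatroid A).
Proof.
split=> -[R [F [A [cA iA]]]]; exists R, F, A; split=> //.
  exact: iso_trans iA (iso_sym (pull_iso _ _ (to_minor_bij _))).
exact: iso_trans iA (pull_iso _ _ (to_minor_bij _)).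
Qed.

End TemplateMatroid.

Lemma morph_sum (V W : zmodType) (h : V -> W) (I : finType) (P : pred I) (F : I -> V) :
  {morph h : x y / x + y} -> h (\sum_(i | P i) F i) = \sum_(i | P i) h (F i).
Proof.
move=> hD; have h0 : h 0 = 0 by apply: (addrI (h 0)); rewrite -hD !addr0.
exact: (big_morph h hD h0).
Qed.

(** * Certificates for minors of template matroids *)

Section Certificate.
Variable Phi : template.
Local Notation X := (tX Phi).
Local Notation Y := (tY Phi).
Local Notation Y0 := (tY0 Phi).
Local Notation C := (tC Phi).
Variables (R F : finType) (A : binmx (X + R)%type (Y + F)%type).

Definition colx (e : (Y + F)%type) : vec X := [ffun x => A (inl x) e].
Definition colr (e : (Y + F)%type) : vec R := [ffun r => A (inr r) e].

Lemma colv_split (I I' : finType) (f : I -> (Y + F)%type) (g : I' -> (Y + F)%type)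
    (J : {set I}) (K : {set I'}) :
  (\sum_(e in J) colv A (f e) == \sum_(c in K) colv A (g c)) =
  (\sum_(e in J) colx (f e) == \sum_(c in K) colx (g c)) &&
  (\sum_(e in J) colr (f e) == \sum_(c in K) colr (g c)).
Proof.
have xE (I0 : finType) (h : I0 -> (Y + F)%type) (L : {set I0}) x :
    (\sum_(e in L) colv A (h e)) (inl x) = (\sum_(e in L) colx (h e)) x.
  by rewrite !sum_ffunE; apply: eq_bigr => e _; rewrite !ffunE.
have rE (I0 : finType) (h : I0 -> (Y + F)%type) (L : {set I0}) r :
    (\sum_(e in L) colv A (h e)) (inr r) = (\sum_(e in L) colr (h e)) r.
  by rewrite !sum_ffunE; apply: eq_bigr => e _; rewrite !ffunE.
apply/eqP/andP => [/ffunP H|[/eqP/ffunP Hx /eqP/ffunP Hr]].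
  by split; apply/eqP/ffunP => b; [rewrite -!xE|rewrite -!rE].
by apply/ffunP => -[x|r]; [rewrite !xE|rewrite !rE].
Qed.

Lemma tcycleE (J : {set (Y0 + F)%type}) : tcycle A J =
  [exists K : {set C},
    (\sum_(e in J) colx (ground e) == \sum_(c in K) colx (inl (inC c))) &&
    (\sum_(e in J) colr (ground e) == \sum_(c in K) colr (inl (inC c)))].
Proof. by apply: eq_existsb => K; exact: colv_split. Qed.

Section Map.
Variables (V : zmodType) (p : vec X -> V) (q : vec R -> V).
Variables (sx : V -> vec X) (sr : V -> vec R).
Hypotheses (pD : {morph p : x y / x + y}) (qD : {morph q : x y / x + y}).
Hypotheses (sxD : {morph sx : x y / x + y}) (srD : {morph sr : x y / x + y}).

Definition phi (e : (Y + F)%type) : V := p (colx e) + q (colr e).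

(* The span of the contracted elements: those of [C], and those killed by the map. *)
Definition contracted (x : vec X) (r : vec R) : Prop :=
  exists (J : {set (Y0 + F)%type}) (K : {set C}),
  [/\ forall e, e \in J -> phi (ground e) = 0,
      x = \sum_(e in J) colx (ground e) + \sum_(c in K) colx (inl (inC c))
    & r = \sum_(e in J) colr (ground e) + \sum_(c in K) colr (inl (inC c))].

Lemma contracted0 : contracted 0 0.
Proof. by exists set0, set0; rewrite !big_set0 !addr0; split=> // e; rewrite inE. Qed.

Lemma contractedD x r x' r' : contracted x r -> contracted x' r' -> contracted (x + x') (r + r').
Proof.
move=> [J [K [JP -> ->]]] [J' [K' [J'P -> ->]]]; exists (sd J J'), (sd K K').
rewrite !(sum_sd _ (@addvec _)); split; [move=> e|exact: addrACA|exact: addrACA].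
by rewrite inE; case: (boolP (e \in J)) => [/JP//|_ /J'P].
Qed.

Lemma contracted_sum (I : finType) (J : pred I) (x : I -> vec X) (r : I -> vec R) :
  (forall i, J i -> contracted (x i) (r i)) ->
  contracted (\sum_(i | J i) x i) (\sum_(i | J i) r i).
Proof.
move=> H; elim/big_rec2: _ => [|i x' r' iJ]; first exact: contracted0.
by apply: contractedD; exact: H.
Qed.

Lemma contracted_sum_seq (I : eqType) (K : seq I) (x : I -> vec X) (r : I -> vec R) :
  (forall i, i \in K -> contracted (x i) (r i)) ->
  contracted (\sum_(i <- K) x i) (\sum_(i <- K) r i).
Proof.
elim: K => [|i K IHK] H; first by rewrite !big_nil; exact: contracted0.
rewrite !big_cons; apply: contractedD; first by apply: H; rewrite mem_head.
by apply: IHK => k kK; apply: H; rewrite inE kK orbT.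
Qed.

Lemma contracted_elt e : phi (ground e) = 0 -> contracted (colx (ground e)) (colr (ground e)).
Proof.
move=> e0; exists [set e], set0; rewrite !big_set0 !big_set1 !addr0; split=> // x.
by rewrite inE => /eqP->.
Qed.

Lemma contracted_C c : contracted (colx (inl (inC c))) (colr (inl (inC c))).
Proof.
by exists set0, [set c]; rewrite !big_set0 !big_set1 !add0r; split=> // x; rewrite inE.
Qed.

(** All elements with [phi = 0] are contracted. Applying [phi] to a cycle of the minor gives a
    relation in [V]. Conversely, each chosen element differs from its image under the additive
    sections [sx], [sr] by something contracted, so a relation in [V] lifts to a cycle. *)
Lemma minor_certificate (U : finType) (N : matroid U) (u : U -> V) :
  (forall v : V, v + v = 0) ->
  cycle_space N (fun J => \sum_(x in J) u x == 0) -> injective u -> (forall x, u x != 0) ->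
  (forall c, phi (inl (inC c)) = 0) ->
  (forall x, exists2 e, phi (ground e) = u x &
     contracted (colx (ground e) + sx (u x)) (colr (ground e) + sr (u x))) ->
  has_minor (tmatroid A) N.
Proof.
move=> char2 cN u_inj u0 phiC H.
have [g gP q0] := fin_all_exists2 H.
have sum_phi (J : {set (Y0 + F)%type}) : \sum_(e in J) phi (ground e) =
    p (\sum_(e in J) colx (ground e)) + q (\sum_(e in J) colr (ground e)).
  by rewrite (morph_sum _ _ pD) (morph_sum _ _ qD) -big_split.
have sum_phiC (K : {set C}) :
    p (\sum_(c in K) colx (inl (inC c))) + q (\sum_(c in K) colr (inl (inC c))) = 0.
  by rewrite (morph_sum _ _ pD) (morph_sum _ _ qD) -big_split big1 // => c _; exact: phiC.
pose C0 : {set (Y0 + F)%type} := [set e | phi (ground e) == 0].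
have g_inj : injective g by move=> x y xy; apply: u_inj; rewrite -!gP xy.
have gC x : g x \notin C0 by rewrite inE gP.
apply: (cycles_minor g_inj gC (tmatroid_cycles A) cN) => J.
have sumg (W : zmodType) (G : (Y0 + F)%type -> W) : \sum_(e in g @: J) G e = \sum_(x in J) G (g x).
  by rewrite big_imset //= => x y _ _; exact: g_inj.
apply/eqP/existsP => [uJ|[K /andP[sK]]].
  have [J0 [K0 [J0P xE rE]]] : contracted (\sum_(x in J) colx (ground (g x))) (\sum_(x in J) colr (ground (g x))).
    have := @contracted_sum _ (mem J) _ _ (fun x _ => q0 x).
    rewrite !big_split /= -(morph_sum _ _ sxD) -(morph_sum _ _ srD) uJ.
    have sx0 : sx 0 = 0 by apply: (addrI (sx 0)); rewrite -sxD !addr0.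
    have sr0 : sr 0 = 0 by apply: (addrI (sr 0)); rewrite -srD !addr0.
    by rewrite sx0 sr0 !addr0.
  have sJ0 : J0 \subset C0 by apply/subsetP => e /J0P e0; rewrite inE e0.
  exists J0; rewrite sJ0 tcycleE /=; apply/existsP; exists K0.
  rewrite !(sum_setU_disj _ (minor_imset_disjoint gC J sJ0)) !sumg xE rE.
  by apply/andP; split; rewrite addrAC addvec add0r.
rewrite tcycleE => /existsP[K0 /andP[/eqP xE /eqP rE]].
have := sum_phi (g @: J :|: K); rewrite xE rE sum_phiC.
rewrite (sum_setU_disj _ (minor_imset_disjoint gC J sK)) sumg [X in _ + X]big1 => [|e /(subsetP sK)].
  by rewrite addr0 => H0; apply: etrans H0; apply: eq_bigr => x _; rewrite gP.
by rewrite inE => /eqP.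
Qed.

End Map.
End Certificate.

Definition unitv (B : finType) (b : B) : vec B := [ffun x => (x == b)%:R].
Definition ounit (B : finType) (o : option B) : vec B := if o is Some b then unitv b else 0.

Lemma ounitE (B : finType) (o : option B) b : ounit o b = (o == Some b)%:R.
Proof. by case: o => [a|]; rewrite ffunE // eq_sym. Qed.

Section Generic.
Variable Phi : template.
Local Notation X := (tX Phi).
Local Notation Y := (tY Phi).
Local Notation Y1 := (tY1 Phi).

Definition xcol (y : Y) : vec X := [ffun x => tA1 x y].

Variables (R : finType) (rho : R -> {ffun Y -> 'F_2}).
Hypothesis rhoP : forall r, rho r \in tDelta Phi.

Definition rcol (y : Y) : vec R := [ffun r => rho r y].

(** The default 0 is always admissible, so generic columns can be indexed by all vectors. *)
Definition lam (l : vec X) : vec X := if l \in tLambda Phi then l else 0.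

Lemma lamP l : lam l \in tLambda Phi.
Proof. by rewrite /lam; case: ifP => // _; case: (tLambda_subgroup Phi). Qed.

(* Every frame column [lam l + o1 + o2] and every column [r + j] of [Z]. *)
Definition gen_elt : finType := (vec X * (option R * option R) + R * Y1)%type.

Definition gen_frame (z : gen_elt) : vec X * vec R :=
  match z with
  | inl (l, (o1, o2)) => (lam l, ounit o1 + ounit o2)
  | inr (r, j) => (0, unitv r)
  end.

Definition gen_respecting : binmx (X + R)%type (Y + gen_elt)%type :=
  fun b e => match e with
  | inl y => match b with inl x => tA1 x y | inr r => rho r y end
  | inr z => match b with inl x => (gen_frame z).1 x | inr r => (gen_frame z).2 r end
  end.

Definition gen_matrix : binmx (X + R)%type (Y + gen_elt)%type :=
  fun b e => match e with
  | inr (inr (r, j)) => gen_respecting b e + gen_respecting b (inl (inY1 j))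
  | _ => gen_respecting b e
  end.

Lemma gen_conforms : matrix_conforms gen_matrix.
Proof.
exists gen_respecting, [set inr z | z : R * Y1]; split=> //.
- split=> //.
  + split=> [x z /imsetP[[r j] _ ->]|z /imsetP[[r j] _ ->]] /=; first by rewrite ffunE.
    by exists r => r'; rewrite ffunE.
  + move=> [[l [o1 o2]]|[r j]] zZ /=; last by case/negP: zZ; apply: imset_f.
    clear zZ; have le1 (o : option R) : (#|[set r | o == Some r]| <= 1)%N.
      case: o => [s|]; last by rewrite (_ : [set r | _] = set0) ?cards0 //; apply/setP => r; rewrite !inE.
      rewrite (_ : [set r | _] = [set s]) ?cards1 //; apply/setP => r; rewrite !inE.
      by rewrite eq_sym.
    apply: leq_trans (leq_trans (leq_card_setU _ _) (leq_add (le1 o1) (le1 o2))).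
    apply/subset_leq_card/subsetP => r; rewrite !inE ffunE.
    by rewrite !ounitE; case: (o1 == _); case: (o2 == _).
  + move=> [[l [o1 o2]]|[r j]] zZ /=; last by case/negP: zZ; apply: imset_f.
    rewrite (_ : [ffun x => _] = lam l) ?lamP //.
    by apply/ffunP => x; rewrite ffunE.
  + move=> r /=; rewrite (_ : [ffun y => _] = rho r) //.
    by apply/ffunP => y; rewrite ffunE.
- move=> b [[l o]|[r j]] zZ //=; by case/negP: zZ; apply: imset_f.
by move=> _ /imsetP[[r j] _ ->]; exists j.
Qed.

Lemma gen_tmatroid_conforms : conforms Phi (tmatroid gen_matrix).
Proof.
apply/conformsP; exists R, gen_elt, gen_matrix; split; first exact: gen_conforms.
by exists id => [|I]; [exists id|rewrite imset_id].
Qed.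

Lemma gen_colx_Y y : colx gen_matrix (inl y) = xcol y.
Proof. by apply/ffunP => x; rewrite !ffunE. Qed.

Lemma gen_colr_Y y : colr gen_matrix (inl y) = rcol y.
Proof. by apply/ffunP => r; rewrite !ffunE. Qed.

Lemma gen_colx_frame l o1 o2 : colx gen_matrix (inr (inl (l, (o1, o2)))) = lam l.
Proof. by apply/ffunP => x; rewrite !ffunE. Qed.

Lemma gen_colr_frame l o1 o2 :
  colr gen_matrix (inr (inl (l, (o1, o2)))) = ounit o1 + ounit o2.
Proof. by apply/ffunP => r; rewrite !ffunE /= !ffunE. Qed.

Lemma gen_colx_Z r j : colx gen_matrix (inr (inr (r, j))) = xcol (inY1 j).
Proof. by apply/ffunP => x; rewrite !ffunE /= ffunE add0r. Qed.

Lemma gen_colr_Z r j : colr gen_matrix (inr (inr (r, j))) = unitv r + rcol (inY1 j).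
Proof. by apply/ffunP => r'; rewrite !ffunE /= !ffunE. Qed.

End Generic.

(** * What excluding PG(3,2) minus a point says about Delta and Lambda *)

Definition no_PG32 (Phi : template) : Prop :=
  forall (T : finType) (M : matroid T), conforms Phi M ->
  forall e, ~ has_minor M (delete PG32 [set e]).

Definition no_L11 (Phi : template) : Prop :=
  forall (T : finType) (M : matroid T), conforms Phi M -> ~ has_minor M L11.

Definition scl (B : finType) (a : 'F_2) (v : vec B) : vec B := [ffun x => a * v x].

Lemma scl0 (B : finType) (v : vec B) : scl 0 v = 0.
Proof. by apply/ffunP => x; rewrite !ffunE mul0r. Qed.

Lemma scl1 (B : finType) (v : vec B) : scl 1 v = v.
Proof. by apply/ffunP => x; rewrite !ffunE mul1r. Qed.

Lemma sclr0 (B : finType) a : scl a (0 : vec B) = 0.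
Proof. by apply/ffunP => x; rewrite !ffunE mulr0. Qed.

Lemma sclDl (B : finType) (a b : 'F_2) (v : vec B) : scl (a + b) v = scl a v + scl b v.
Proof. by apply/ffunP => x; rewrite !ffunE mulrDl. Qed.

Lemma sclDr (B : finType) a (v w : vec B) : scl a (v + w) = scl a v + scl a w.
Proof. by apply/ffunP => x; rewrite !ffunE mulrDr. Qed.

Lemma dot_scl (B : finType) (d : vec B) a v : dot d (scl a v) = a * dot d v.
Proof. by rewrite /dot mulr_sumr; apply: eq_bigr => x _; rewrite ffunE mulrCA. Qed.

Lemma functional_rel (B I K : finType) (f : I -> vec B) (w : K -> vec B) (c : I -> 'F_2) :
  (forall (J : {set I}) (L : {set K}),
     \sum_(i in J) f i + \sum_(k in L) w k = 0 -> \sum_(i in J) c i = 0) ->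
  exists2 d : vec B, forall i, dot d (f i) = c i & forall k, dot d (w k) = 0.
Proof.
move=> H; pose h (s : I + K) := match s with inl i => f i | inr k => w k end.
pose c' (s : I + K) := match s with inl i => c i | inr k => 0 end.
have [S|d dE] := @functional_ext B (I + K)%type h c'; last first.
  by exists d => [i|k]; [exact: (dE (inl i))|exact: (dE (inr k))].
have splitS (V : zmodType) (g : I + K -> V) : \sum_(s in S) g s =
    \sum_(i in [set i | inl i \in S]) g (inl i) + \sum_(k in [set k | inr k \in S]) g (inr k).
  rewrite big_mkcond big_sumType /= [X in _ = X + _]big_mkcond [X in _ = _ + X]big_mkcond.
  by congr (_ + _); apply: eq_bigr => i _; rewrite inE.
by rewrite !splitS => /H; rewrite /= => ->; rewrite big1 ?addr0.
Qed.

Lemma vec4_ind (P : vec 'I_4 -> Prop) :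
  (forall a b c d, P (vl 4 [:: a; b; c; d])) -> forall v, P v.
Proof.
move=> H v; rewrite -(lvK v); have := size_lv v.
by case: (lv v) => [|a [|b [|c [|d [|]]]]].
Qed.

Section PGCertificate.
Variables (Phi : template) (R F : finType).
Variable A : binmx (tX Phi + R)%type (tY Phi + F)%type.
Variables (p : vec (tX Phi) -> vec 'I_4) (q : vec R -> vec 'I_4).
Variables (sx : vec 'I_4 -> vec (tX Phi)) (sr : vec 'I_4 -> vec R).
Hypotheses (pD : {morph p : x y / x + y}) (qD : {morph q : x y / x + y}).
Hypotheses (sxD : {morph sx : x y / x + y}) (srD : {morph sr : x y / x + y}).
Hypothesis phiC : forall c, phi A p q (inl (inC c)) = 0.

Lemma PG32_certificate (e0 : PG32_point) :
  (forall v, v != 0 -> v != val e0 -> exists2 e, phi A p q (ground e) = v &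
     contracted A p q (colx A (ground e) + sx v) (colr A (ground e) + sr v)) ->
  has_minor (tmatroid A) (delete PG32 [set e0]).
Proof.
move=> H.
apply: (minor_certificate pD qD sxD srD (@addvec _) (PG32_delete_cycles e0)) => //.
- by move=> x y /val_inj/val_inj.
- by move=> x; exact: (valP (val x)).
move=> x; apply: H; first exact: (valP (val x)).
by have := valP x; rewrite inE; apply: contra => /eqP/val_inj ->.
Qed.

End PGCertificate.

Lemma unitv_neq0 (B : finType) (b : B) : unitv b != 0.
Proof. by apply/eqP => /ffunP/(_ b); rewrite !ffunE eqxx. Qed.

Definition PG32_pt0 : PG32_point := exist (fun v : {ffun 'I_4 -> 'F_2} => v != 0) _ (unitv_neq0 ord0).

Section DeltaLambda.
Variable Phi : template.
Hypothesis noPG : no_PG32 Phi.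
Local Notation X := (tX Phi).
Local Notation Y := (tY Phi).
Local Notation Y1 := (tY1 Phi).
Local Notation C := (tC Phi).

Lemma zero_row : (0 : {ffun Y -> 'F_2}) \in tDelta Phi.
Proof. by case: (tDelta_subgroup Phi). Qed.

Lemma zero_lambda : (0 : vec X) \in tLambda Phi.
Proof. by case: (tLambda_subgroup Phi). Qed.

Lemma lambdaD (l m : vec X) : l \in tLambda Phi -> m \in tLambda Phi -> l + m \in tLambda Phi.
Proof.
case: (tLambda_subgroup Phi) => _ H lL mL.
by have -> : l + m = l - m; [congr (_ + _); apply/(addr_eq0_char2 (@addvec _)); rewrite subrr|exact: H].
Qed.

Definition spanC (x : vec X) : bool := [exists K : {set C}, x == \sum_(c in K) xcol (inC c)].

Lemma spanCP x : reflect (exists K : {set C}, x = \sum_(c in K) xcol (inC c)) (spanC x).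
Proof. by apply: (iffP existsP) => -[K KE]; exists K; apply/eqP. Qed.

Lemma spanC0 : spanC 0.
Proof. by apply/spanCP; exists set0; rewrite big_set0. Qed.

Lemma spanCD x y : spanC x -> spanC y -> spanC (x + y).
Proof.
move=> /spanCP[K ->] /spanCP[L ->]; apply/spanCP; exists (sd K L).
by rewrite (sum_sd _ (@addvec _)).
Qed.

Lemma spanC_col c : spanC (xcol (inC c)).
Proof. by apply/spanCP; exists [set c]; rewrite big_set1. Qed.

(* If [delta] does not vanish on [J], five rows labelled [delta] and the contraction of
   the columns of [J] turn the sum of five vertices into [0], and [K_6] into [PG(3,2)]. *)
Lemma delta_vanish (l : vec X) (J : {set Y}) : l \in tLambda Phi ->
  l + \sum_(y in J) xcol y = 0 ->
  forall delta, delta \in tDelta Phi -> \sum_(y in J) delta y = 0.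
Proof.
move=> lL lJ delta dD; case: (F2P (\sum_(y in J) delta y)) => // d1.
(* The five rows [inr _] carry the label [delta]. The rows [inl j] have label 0; they recover the
   deleted column [j] of [Y1] from an element of [Z] and a frame column with a single entry. *)
pose R : finType := (Y1 + option 'I_4)%type.
pose rho (r : R) : {ffun Y -> 'F_2} := if r is inr _ then delta else 0.
have rhoP r : rho r \in tDelta Phi by case: r => [j|o]; [exact: zero_row|exact: dD].
pose A := gen_matrix rho.
pose p (x : vec X) : vec 'I_4 := 0.
(* Four vertices go to the unit vectors and the fifth to their sum, so the sum of the five goes to
   0. *)
pose q (r : vec R) : vec 'I_4 := [ffun k => r (inr (Some k)) + r (inr None)].
pose sx (v : vec 'I_4) : vec X := 0.
pose sr (v : vec 'I_4) : vec R := [ffun r => if r is inr (Some k) then v k else 0].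
have pD : {morph p : x y / x + y} by move=> x y; rewrite /p addr0.
have qD : {morph q : x y / x + y} by move=> x y; apply/ffunP => k; rewrite !ffunE addrACA.
have sxD : {morph sx : x y / x + y} by move=> x y; rewrite /sx addr0.
have srD : {morph sr : x y / x + y}.
  by move=> x y; apply/ffunP => -[j|[k|]]; rewrite !ffunE ?addr0.
have qrcol y : q (rcol rho y) = 0 by apply/ffunP => k; rewrite !ffunE addF2.
have qinl j : q (unitv (inl j)) = 0 by apply/ffunP => k; rewrite !ffunE addF2.
exfalso; apply: (noPG (gen_tmatroid_conforms rhoP) (e := PG32_pt0)).
apply: (PG32_certificate pD qD sxD srD); first by move=> c; rewrite /phi gen_colx_Y gen_colr_Y qrcol addr0.
have cl : contracted A p q l 0.
  have := @contracted_elt _ _ _ A _ p q (inr (inl (l, (None, None)))).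
  rewrite /phi /= gen_colx_frame gen_colr_frame /lam lL /= !addr0; apply.
  by have -> : q 0 = 0; [apply/ffunP => k; rewrite !ffunE addr0|rewrite addr0].
have cinl j : contracted A p q 0 (unitv (inl j)).
  have := @contracted_elt _ _ _ A _ p q (inr (inl (0, (Some (inl j), None)))).
  rewrite /phi /= gen_colx_frame gen_colr_frame /lam zero_lambda /= !addr0; apply.
  by rewrite qinl addr0.
have cy y : contracted A p q (xcol y) (rcol rho y).
  case: y => [[y|j]|c].
  - have := @contracted_elt _ _ _ A _ p q (inl y).
    by rewrite /phi /= gen_colx_Y gen_colr_Y qrcol addr0; apply.
  - have := @contracted_elt _ _ _ A _ p q (inr (inr (inl j, j))).
    rewrite /phi /= gen_colx_Z gen_colr_Z qD qrcol qinl !addr0 => /(_ erefl) c1.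
    by have := contractedD c1 (cinl j); rewrite addr0 addrAC addvec add0r.
  by have := @contracted_C _ _ _ A _ p q c; rewrite gen_colx_Y gen_colr_Y.
pose T5 : vec R := [ffun r => if r is inr _ then 1 else 0].
(* In the sum of [l] and the columns of [J] the [X]-part cancels, and since [delta] sums to 1 on [J]
   the row part is 1 exactly on the five labelled rows. *)
have cT : contracted A p q 0 T5.
  have := contractedD cl (contracted_sum (J := mem J) (fun y _ => cy y)).
  rewrite lJ add0r; have -> // : \sum_(y in J) rcol rho y = T5.
  apply/ffunP => r; rewrite sum_ffunE [RHS]ffunE.
  case: r => [j|o]; first by rewrite big1 // => y _; rewrite !ffunE.
  by rewrite -[RHS]d1; apply: eq_bigr => y _; rewrite ffunE.
have oE (o : option (option 'I_4)) r : ounit (omap inr o : option R) r =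
    if r is inr o' then (o == Some o')%:R else 0.
  by rewrite ounitE; case: o => [o|]; case: r.
have key v : v != 0 -> exists o1 o2 : option (option 'I_4),
    q (ounit (omap inr o1) + ounit (omap inr o2)) = v /\
    (ounit (omap inr o1) + ounit (omap inr o2) + sr v = 0 \/
     ounit (omap inr o1) + ounit (omap inr o2) + sr v = T5).
  elim/vec4_ind: v => a b c d v0.
  pose i (k : nat) (kP : (k < 4)%N) : option (option 'I_4) := Some (Some (Ordinal kP)).
  pose i0 := i 0%N isT; pose i1 := i 1%N isT; pose i2 := i 2%N isT; pose i3 := i 3%N isT.
  pose i4 : option (option 'I_4) := Some None.
  have fin (o1 o2 : option (option 'I_4)) : (forall k : 'I_4, (o1 == Some (Some k)) (+) (o2 == Some (Some k)) (+)
       (o1 == Some None) (+) (o2 == Some None) = nth false [:: a; b; c; d] k) ->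
    q (ounit (omap inr o1) + ounit (omap inr o2)) = vl 4 [:: a; b; c; d] /\
    (ounit (omap inr o1) + ounit (omap inr o2) + sr (vl 4 [:: a; b; c; d]) = 0 \/
     ounit (omap inr o1) + ounit (omap inr o2) + sr (vl 4 [:: a; b; c; d]) = T5).
    move=> H; split.
      apply/ffunP => k; rewrite [q _ _]ffunE 2![(_ + _ : vec R) _]ffunE !oE [RHS]ffunE -H !F2_addb.
      by rewrite !addrA.
    have E r : (ounit (omap inr o1) + ounit (omap inr o2) + sr (vl 4 [:: a; b; c; d])) r =
        if r is inr _ then ((o1 == Some None) (+) (o2 == Some None))%:R else 0.
      rewrite 2!ffunE !oE [sr _ _]ffunE; case: r => [j|[k|]]; rewrite ?addr0 ?F2_addb //.
      rewrite [vl _ _ _]ffunE -H !F2_addb -!addrA; set x := _%:R; set y := _%:R.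
      by rewrite (addrCA y x) addrA !addrA addF2 add0r addF2 add0r.
    case E2 : ((o1 == Some None) (+) (o2 == Some None)); [right|left]; apply/ffunP => r;
      by rewrite E E2 ffunE; case: r.
  (* The 15 edges of [K_6], on the five vertices and a ground vertex (written [None] as an end),
     match the 15 nonzero vectors. *)
  case: a v0 fin; case: b; case: c; case: d => v0 fin;
    [exists i4, None|exists i3, i4|exists i2, i4|exists i0, i1|exists i1, i4|exists i0, i2
    |exists i0, i3|exists i0, None|exists i0, i4|exists i1, i2|exists i1, i3|exists i1, None
    |exists i2, i3|exists i2, None|exists i3, None|].
  1-15: by apply: fin => -[[|[|[|[|]]]]].
  case/eqP: v0; apply/ffunP => -[[|[|[|[|]]]]] //= kP; by rewrite !ffunE.
move=> v v0 _; have [o1 [o2 [qv cv]]] := key v v0.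
exists (inr (inl (0, (omap inr o1, omap inr o2)))).
  by rewrite /phi /= gen_colr_frame /p add0r.
rewrite /= gen_colx_frame gen_colr_frame /lam zero_lambda /sx addr0.
by case: cv => ->; [exact: contracted0|exact: cT].
Qed.

Lemma contracted_spanC (R F : finType) (A : binmx (X + R)%type (Y + F)%type)
    (V : zmodType) (p : vec X -> V) (q : vec R -> V) x :
  (forall c, colx A (inl (inC c)) = xcol (inC c)) -> (forall c, colr A (inl (inC c)) = 0) ->
  spanC x -> contracted A p q x 0.
Proof.
move=> Ax Ar /spanCP[K ->].
have -> : \sum_(c in K) xcol (inC c) = \sum_(c in K) colx A (inl (inC c)).
  by apply: eq_bigr => c _; rewrite Ax.
have -> : (0 : vec R) = \sum_(c in K) colr A (inl (inC c)) by rewrite big1.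
by apply: (contracted_sum (J := mem K)) => c _; exact: contracted_C.
Qed.

(** Otherwise [l1] and [l2] are independent modulo [C]. A frame column may carry any combination of
    them above any subset of two unlabelled rows, and these sixteen columns are GF(2)^4 modulo
    [C]. *)
Lemma lambda_rank (l1 l2 : vec X) : l1 \in tLambda Phi -> l2 \in tLambda Phi ->
  [\/ spanC l1, spanC l2 | spanC (l1 + l2)].
Proof.
move=> l1L l2L.
have [s1|s1] := boolP (spanC l1); first by constructor 1.
have [s2|s2] := boolP (spanC l2); first by constructor 2.
have [s3|s3] := boolP (spanC (l1 + l2)); first by constructor 3.
exfalso.
pose f (b : bool) := if b then l1 else l2.
have indep_f (J : {set bool}) (L : {set C}) :
    \sum_(b in J) f b + \sum_(c in L) xcol (inC c) = 0 -> forall b, b \notin J.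
  move=> /(addr_eq0_char2 (@addvec _)) fJ.
  have : spanC (\sum_(b in J) f b) by apply/spanCP; exists L.
  rewrite big_mkcond big_bool /=.
  case: (boolP (true \in J)) => tJ; case: (boolP (false \in J)) => fJ' //=;
    rewrite ?addr0 ?add0r ?(negPf s1) ?(negPf s2) ?(negPf s3) // => _.
  by case.
have dual_f (b : bool) : exists2 d : vec X, forall b', dot d (f b') = (b == b')%:R
    & forall c, dot d (xcol (inC c)) = 0.
  by apply: functional_rel => J L fJ; rewrite big1 // => b' b'J; have := indep_f J L fJ b'; rewrite b'J.
have [d1 d1f d1C] := dual_f true; have [d2 d2f d2C] := dual_f false.
pose rho (r : bool) : {ffun Y -> 'F_2} := 0.
have rhoP r : rho r \in tDelta Phi by exact: zero_row.
have rcol0 y : rcol rho y = 0 by apply/ffunP => r; rewrite !ffunE.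
pose A := gen_matrix rho.
pose p (x : vec X) : vec 'I_4 := scl (dot d1 x) (unitv ord0) + scl (dot d2 x) (unitv (inord 1)).
pose q (r : vec bool) : vec 'I_4 := scl (r true) (unitv (inord 2)) + scl (r false) (unitv (inord 3)).
pose sx (v : vec 'I_4) : vec X := scl (v ord0) l1 + scl (v (inord 1)) l2.
pose sr (v : vec 'I_4) : vec bool := [ffun b : bool => if b then v (inord 2) else v (inord 3)].
have pD : {morph p : x y / x + y} by move=> x y; rewrite /p !dotD !sclDl addrACA.
have qD : {morph q : x y / x + y} by move=> x y; rewrite /q !ffunE !sclDl addrACA.
have sxD : {morph sx : x y / x + y} by move=> x y; rewrite /sx !ffunE !sclDl addrACA.
have srD : {morph sr : x y / x + y} by move=> x y; apply/ffunP => -[]; rewrite !ffunE.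
have q0 : q 0 = 0 by rewrite /q !ffunE !scl0 addr0.
apply: (noPG (gen_tmatroid_conforms rhoP) (e := PG32_pt0)).
apply: (PG32_certificate pD qD sxD srD).
  by move=> c; rewrite /phi gen_colx_Y gen_colr_Y rcol0 q0 addr0 /p d1C d2C !scl0 addr0.
move=> v _ _.
pose o (k : 'I_4) (b : bool) := if v k == 1 then Some b else None.
have oE k b : ounit (o k b) = scl (v k) (unitv b).
  by rewrite /o; case: (F2P (v k)) => ->; rewrite ?scl0 ?scl1.
have sxL : sx v \in tLambda Phi.
  by rewrite /sx; apply: lambdaD; [case: (F2P (v ord0))|case: (F2P (v (inord 1)))] => ->;
    rewrite ?scl0 ?scl1 ?zero_lambda.
exists (inr (inl (sx v, (o (inord 2) true, o (inord 3) false)))).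
  rewrite /phi /= gen_colx_frame gen_colr_frame /lam sxL !oE.
  rewrite /p /q /sx !dotD !dot_scl -/(f true) -/(f false) !d1f !d2f !ffunE /=.
  rewrite !mulr1 !mulr0 !addr0 !add0r.
  have inordE k : (k < 4)%N -> nat_of_ord (inord k : 'I_4) = k by move=> kP; rewrite inordK.
  apply/ffunP => k; rewrite !ffunE -!val_eqE /= !inordE //.
  case: k => -[|[|[|[|]]]] //= kP; rewrite ?mulr1 ?mulr0 ?addr0 ?add0r;
    congr (v _); apply/val_inj; rewrite /= ?inordE //.
rewrite /= gen_colx_frame gen_colr_frame /lam sxL addvec.
rewrite (_ : _ + sr v = 0); first exact: contracted0.
rewrite !oE; apply/ffunP => -[]; rewrite !ffunE /= ?mulr1 ?mulr0 ?addr0 ?add0r addF2 //.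
Qed.

End DeltaLambda.

(** * Coordinates *)

Section Coordinates.
Variable Phi : template.
Local Notation X := (tX Phi).
Local Notation Y1 := (tY1 Phi).
Local Notation C := (tC Phi).

Definition ycol (j : Y1) : vec X := xcol (inY1 j).

(* Coordinates with respect to a maximal set [base] of columns of [Y1] that is independent
   modulo [C] and the vector [l0] (which spans [Lambda] modulo [C]). *)
Record coordinates (l0 : vec X) := Coordinates {
  base : {set Y1};
  chi : Y1 -> vec X;
  chil : vec X;
  chi_out : forall j x, j \notin base -> dot (chi j) x = 0;
  chi_base : forall j j', j \in base -> j' \in base -> dot (chi j) (ycol j') = (j == j')%:R;
  chi_C : forall j c, dot (chi j) (xcol (inC c)) = 0;
  chi_l0 : forall j, dot (chi j) l0 = 0;
  chil_C : forall c, dot chil (xcol (inC c)) = 0;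
  chil_base : forall j, j \in base -> dot chil (ycol j) = 0;
  chil_l0 : dot chil l0 = (l0 != 0)%:R;
  chi_expand : forall j, spanC (ycol j + \sum_i scl (dot (chi i) (ycol j)) (ycol i)
                                + scl (dot chil (ycol j)) l0)
}.

Definition lcol (l0 : vec X) (o : option C) : vec X :=
  if o is Some c then xcol (inC c) else l0.

Lemma spanC_lcol l0 (L : {set option C}) : exists b : bool,
  spanC (\sum_(o in L) lcol l0 o + scl b%:R l0).
Proof.
exists (None \in L).
have -> : \sum_(o in L) lcol l0 o =
    scl (None \in L)%:R l0 + \sum_(c in [set c | Some c \in L]) xcol (inC c).
  have sumS (J : {set option C}) : None \notin J ->
      \sum_(o in J) lcol l0 o = \sum_(c in [set c | Some c \in J]) xcol (inC c).
    move=> nJ; have -> : J = Some @: [set c | Some c \in J].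
      apply/setP => -[c|]; first by rewrite mem_imset ?inE //; exact: Some_inj.
      by rewrite (negPf nJ); apply/esym/negbTE/negP => /imsetP[].
    rewrite big_imset /=; last by move=> ? ? _ _ [].
    by apply: eq_bigl => c; rewrite !inE mem_imset ?inE //; exact: Some_inj.
  have [NL|NL] := boolP (None \in L); last by rewrite scl0 add0r sumS.
  rewrite scl1 (big_setD1 _ NL) /= sumS ?setD11 //; congr (_ + _).
  by apply: eq_bigl => c; rewrite !inE.
rewrite addrAC addvec add0r; apply/spanCP; by exists [set c | Some c \in L].
Qed.

(** [base] is maximal among the sets of [Y1]-columns independent modulo [C] and [l0]; the
    functionals come from [functional_rel], and maximality expands the other columns of [Y1]. The
    hypothesis leaves [l0] either zero or outside the span of [C], which makes the value required of
    [chil] consistent. *)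
Lemma coordinates_exist (l0 : vec X) : (spanC l0 -> l0 = 0) -> inhabited (coordinates l0).
Proof.
move=> l0C.
pose ind (B : {set Y1}) := [forall J : {set Y1}, forall L : {set option C},
  (J \subset B) && (\sum_(j in J) ycol j == \sum_(o in L) lcol l0 o) ==> (J == set0)].
have ind0 : ind set0.
  by apply/forallP => J; apply/forallP => L; rewrite subset0; apply/implyP => /andP[].
have [B /maxsetP[iB maxB] _] := maxset_exists ind0.
have indB (J : {set Y1}) (L : {set option C}) : J \subset B ->
    \sum_(j in J) ycol j = \sum_(o in L) lcol l0 o -> J = set0.
  move=> sJ JL; have /forallP/(_ J)/forallP/(_ L) := iB.
  by rewrite sJ JL eqxx => /eqP.
have sumB (J : {set Y1}) : \sum_(j in J) (if j \in B then ycol j else 0) = \sum_(j in J :&: B) ycol j.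
  rewrite -big_mkcondr; apply: eq_bigl => j; by rewrite inE.
have [chi chiP] : exists chi : Y1 -> vec X, forall j,
    [/\ forall x, j \notin B -> dot (chi j) x = 0,
        forall j', j \in B -> j' \in B -> dot (chi j) (ycol j') = (j == j')%:R
      & forall o, dot (chi j) (lcol l0 o) = 0].
  apply: (@fin_all_exists _ _ (fun j chij => [/\ forall x, j \notin B -> dot chij x = 0,
    forall j', j \in B -> j' \in B -> dot chij (ycol j') = (j == j')%:R
    & forall o, dot chij (lcol l0 o) = 0])) => j.
  have [jB|jB] := boolP (j \in B); last first.
    exists 0; split=> // [x _|o]; by rewrite /dot big1 // => b _; rewrite ffunE mul0r.
  have [|d df dw] := @functional_rel _ _ _ (fun j' => if j' \in B then ycol j' else 0)
      (lcol l0) (fun j' => (j' \in B)%:R * (j == j')%:R).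
    move=> J L; rewrite sumB => /(addr_eq0_char2 (@addvec _))/indB-/(_ (subsetIr _ _)) J0.
    rewrite big1 // => j' j'J; case: (boolP (j' \in B)) => j'B; last by rewrite mul0r.
    by have : j' \in J :&: B by [rewrite inE j'J]; rewrite J0 inE.
  by exists d; split=> // j' _ j'B; have := df j'; rewrite j'B mul1r.
have [|chil chilf chilw] := @functional_rel _ _ _ (fun _ : unit => l0)
   (fun s : Y1 + C => match s with inl j => if j \in B then ycol j else 0 | inr c => xcol (inC c) end)
   (fun _ => (l0 != 0)%:R).
  move=> J L /(addr_eq0_char2 (@addvec _)) JL.
  have [J0|[[] tJ]] := set_0Vmem J; first by rewrite J0 big_set0.
  have JT : J = [set tt] by apply/setP => -[]; rewrite tJ inE eqxx.
  rewrite JT big_set1; case: eqP => // l0n; case: l0n; move: JL; rewrite JT big_set1.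
  rewrite big_mkcond big_sumType /= -!big_mkcond /=.
  pose J1 := [set j | inl j \in L]; pose K1 := [set c | inr c \in L].
  have -> : \sum_(i | inl i \in L) (if i \in B then ycol i else 0) = \sum_(i in J1 :&: B) ycol i.
    by rewrite -sumB; apply: eq_bigl => i; rewrite inE.
  have -> : \sum_(i | inr i \in L) xcol (inC i) = \sum_(i in K1) xcol (inC i).
    by apply: eq_bigl => i; rewrite inE.
  move=> l0E.
  have J10 : J1 :&: B = set0.
    apply: (indB _ (None |: [set Some c | c in K1])); first exact: subsetIr.
    rewrite big_setU1 /=; last by apply/negP => /imsetP[].
    rewrite big_imset /=; last by move=> ? ? _ _ [].
    by rewrite {1}l0E -addrA addvec addr0.
  move: l0E; rewrite J10 big_set0 add0r => l0E.
  by apply: l0C; apply/spanCP; exists K1.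
have [chio chib chiw] : [/\ forall j x, j \notin B -> dot (chi j) x = 0,
    forall j j', j \in B -> j' \in B -> dot (chi j) (ycol j') = (j == j')%:R
  & forall j o, dot (chi j) (lcol l0 o) = 0].
  by split=> j *; have [? ? ?] := chiP j; auto.
constructor; apply: (@Coordinates l0 B chi chil) => //.
- by move=> j c; exact: (chiw j (Some c)).
- by move=> j; exact: (chiw j None).
- by move=> c; exact: (chilw (inr c)).
- by move=> j jB; have := chilw (inl j); rewrite jB.
- exact: (chilf tt).
move=> j.
have [J [L [sJ jE]]] : exists (J : {set Y1}) (L : {set option C}), J \subset B /\
    ycol j = \sum_(i in J) ycol i + \sum_(o in L) lcol l0 o.
  have [jB|jB] := boolP (j \in B).
    by exists [set j], set0; rewrite sub1set jB big_set1 big_set0 addr0.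
  have : ~~ ind (j |: B).
    apply/negP => /maxB-/(_ (subsetUr _ _)) jBB.
    by move: jB; rewrite -jBB setU11.
  rewrite negb_forall => /existsP[J]; rewrite negb_forall => /existsP[L].
  rewrite negb_imply => /andP[/andP[sJ /eqP JL] J0].
  have jJ : j \in J.
    apply: contraNT J0 => jJ; apply/eqP/(indB J L) => //.
    apply/subsetP => i iJ; have := subsetP sJ _ iJ; rewrite !inE => /orP[/eqP ij|//].
    by rewrite -ij iJ in jJ.
  exists (J :\ j), L; split; first by rewrite subDset.
  by rewrite -JL (big_setD1 j jJ) /= addrCA addvec addr0.
have chiE i : dot (chi i) (ycol j) = (i \in J)%:R.
  rewrite jE dotD !dot_sum [X in _ + X]big1 ?addr0; last by move=> o _; exact: chiw.
  have [iBB|iBB] := boolP (i \in B); last first.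
    rewrite big1 => [|k _]; last exact: chio.
    by case: (boolP (i \in J)) => // /(subsetP sJ); rewrite (negPf iBB).
  rewrite (eq_bigr (fun k => (i == k)%:R)); last by move=> k kJ; rewrite chib // (subsetP sJ).
  have [iJ|iJ] := boolP (i \in J).
    rewrite (big_setD1 i) //= eqxx big1 ?addr0 // => k; rewrite !inE => /andP[/negPf ki _].
    by rewrite eq_sym ki.
  by rewrite big1 // => k kJ; case: eqP => // ik; rewrite ik kJ in iJ.
have [b bE] := spanC_lcol l0 L.
have chilE : dot chil (ycol j) = b%:R * (l0 != 0)%:R.
  have chilC x : spanC x -> dot chil x = 0.
    by move/spanCP => [K ->]; rewrite dot_sum big1 // => c _; exact: (chilw (inr c)).
  have := chilC _ bE; rewrite dotD dot_scl (chilf tt) => /(addr_eq0_char2 addF2) <-.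
  rewrite jE dotD dot_sum big1 ?add0r // => i iJ.
  by have := chilw (inl i); rewrite (subsetP sJ).
have -> : \sum_i scl (dot (chi i) (ycol j)) (ycol i) = \sum_(i in J) ycol i.
  rewrite [RHS]big_mkcond; apply: eq_bigr => i _; rewrite chiE.
  by case: (i \in J); rewrite ?scl1 ?scl0.
have -> : scl (dot chil (ycol j)) l0 = scl b%:R l0.
  by rewrite chilE; case: (eqVneq l0 0) => [->|_]; rewrite ?sclr0 ?mulr1.
by rewrite jE [_ + _ + \sum_(i in J) _]addrAC addvec add0r.
Qed.

End Coordinates.

Lemma addvKl (B : finType) (x y : vec B) : x + (x + y) = y.
Proof. by rewrite addrA addvec add0r. Qed.

Section Push.
Variables (V : finType) (n : nat) (f : V -> 'I_n).

(** The effect of identifying vertices along [f]. *)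
Definition push (t : vec V) : vec 'I_n := [ffun i => \sum_(v | f v == i) t v].

Lemma pushD (s t : vec V) : push (s + t) = push s + push t.
Proof. by apply/ffunP => i; rewrite !ffunE -big_split; apply: eq_bigr => v _; rewrite ffunE. Qed.

Lemma push_unitv v : push (unitv v) = unitv (f v).
Proof.
apply/ffunP => i; rewrite !ffunE big_mkcond (bigD1 v) //= ffunE eqxx big1 ?addr0 => [|w /negPf wv].
  by rewrite eq_sym; case: (_ == _).
by rewrite ffunE wv if_same.
Qed.

Lemma push_scl a t : push (scl a t) = scl a (push t).
Proof. by apply/ffunP => i; rewrite !ffunE mulr_sumr; apply: eq_bigr => v _; rewrite ffunE. Qed.

Lemma push_total (t : vec V) : \sum_i push t i = \sum_v t v.
Proof.
under eq_bigr do rewrite ffunE.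
rewrite (exchange_big_dep xpredT) //=; apply: eq_bigr => v _.
by rewrite (eq_bigl (pred1 (f v))) ?big_pred1_eq // => i; rewrite /= eq_sym.
Qed.

End Push.

Section Comb.
Variables (n m : nat) (tau : 'I_n -> vec 'I_m).

Definition comb (w : vec 'I_n) : vec 'I_m := \sum_i scl (w i) (tau i).

Lemma combD w w' : comb (w + w') = comb w + comb w'.
Proof. by rewrite -big_split; apply: eq_bigr => i _; rewrite ffunE sclDl. Qed.

Lemma comb_unitv i : comb (unitv i) = tau i.
Proof.
rewrite /comb (bigD1 i) //= ffunE eqxx scl1 big1 ?addr0 // => j /negPf ji.
by rewrite ffunE ji scl0.
Qed.

End Comb.

Lemma vec_sum_unitv (n : nat) (w : vec 'I_n) : w = \sum_i scl (w i) (unitv i).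
Proof.
apply/ffunP => k; rewrite sum_ffunE (bigD1 k) //= !ffunE eqxx mulr1 big1 ?addr0 // => i /negPf ik.
by rewrite !ffunE eq_sym ik mulr0.
Qed.

Section GenericMinor.
Variable Phi : template.
Local Notation X := (tX Phi).
Local Notation Y := (tY Phi).
Local Notation Y0 := (tY0 Phi).
Local Notation Y1 := (tY1 Phi).
Variable l0 : vec X.
Hypothesis l0L : l0 \in tLambda Phi.
Variable co : coordinates l0.

(** The residue of [x] after its coordinates are removed: [spanC (expand x)] says that the
    coordinates describe [x] modulo [C]. *)
Definition expand (x : vec X) : vec X :=
  x + \sum_i scl (dot (chi co i) x) (ycol i) + scl (dot (chil co) x) l0.

Lemma expandD : {morph expand : x y / x + y}.
Proof.
move=> x y; rewrite /expand dotD sclDl.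
under eq_bigr do rewrite dotD sclDl.
by rewrite big_split /= [x + y + _]addrACA [LHS]addrACA.
Qed.

(* Vertices: the root [None], the members of the base, and three extra vertices. *)
Definition vtx : finType := (option Y1 + 'I_3)%type.
Definition root : vtx := inl None.

(** The entry at the root makes the weight even, so coordinates become an even vertex set with the
    root as ground vertex. *)
Definition suppv (x : vec X) : vec vtx :=
  [ffun v => match v with
             | inl (Some j) => dot (chi co j) x
             | inl None => \sum_j dot (chi co j) x
             | inr _ => 0
             end].

(* An element of [Y0], or an element [r + s] of [Z] for a vertex [r] and [s] in [Y1]. *)
Definition tidx : finType := (Y0 + Y1 * vtx)%type.

Definition tx (k : tidx) : vec X :=
  match k with inl y => xcol (inY0 y) | inr (s, _) => ycol s end.

Definition tvalid (k : tidx) : bool := if k is inl y then spanC (expand (tx k)) else true.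

(** The unit entry of an element of [Z] in row [r] counts as the edge from [r] to the root. *)
Definition tset (k : tidx) : vec vtx :=
  suppv (tx k) + (if k is inr (_, r) then unitv r + unitv root else 0).

Lemma tvalid_expand k : tvalid k -> spanC (expand (tx k)).
Proof. by case: k => [y //|[s r] _]; exact: chi_expand. Qed.

Lemma suppv_unitv x :
  suppv x = \sum_j scl (dot (chi co j) x) (unitv (inl (Some j)) + unitv root).
Proof.
apply/ffunP => v; rewrite sum_ffunE ffunE; case: v => [[j|]|r].
- rewrite (bigD1 j) //= !ffunE eqxx addr0 mulr1 big1 ?addr0 // => i ij.
  by rewrite !ffunE (_ : (_ == _) = (j == i)) // eq_sym (negPf ij) addr0 mulr0.
- by apply: eq_bigr => j _; rewrite !ffunE add0r mulr1.
by rewrite big1 // => j _; rewrite !ffunE addr0 mulr0.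
Qed.

(** Vertices, identified by [f], are placed at the points [tau], and [l0] is sent to [ell]; row [i]
    goes to [tau i + tau (f root)]. The pair [sig], [sigl] is a section. By [lift_vertex], vertex
    [i] agrees with [i0] plus the section of its label up to contracted sets, so that nothing more
    than the labels survives the contraction. *)
Section Labelling.
Variables (n m : nat) (f : vtx -> 'I_n) (tau : 'I_n -> vec 'I_m) (ell : vec 'I_m).
Variables (sig : vec 'I_m -> vec 'I_n) (sigl : vec 'I_m -> 'F_2) (i0 : 'I_n).
Hypotheses (sigD : {morph sig : x y / x + y}) (siglD : {morph sigl : x y / x + y}).

Definition tval (k : tidx) : vec 'I_m :=
  comb tau (push f (tset k)) + scl (dot (chil co) (tx k)) ell.

Variable D : seq tidx.
Hypothesis Dvalid : forall k, k \in D -> tvalid k.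
Hypothesis Dval : forall k, k \in D -> tval k = 0.
Hypothesis lift_vertex : forall i, exists2 K : seq tidx, {subset K <= D} &
  \sum_(k <- K) push f (tset k) = unitv i + unitv i0 + sig (tau i) /\
  scl (\sum_(k <- K) dot (chil co) (tx k)) l0 = scl (sigl (tau i)) l0.
Hypothesis lift_ell : if l0 == 0 then ell = 0 else sig ell = 0 /\ sigl ell = 1.

Let rho (r : 'I_n) : {ffun Y -> 'F_2} := 0.
Let A := gen_matrix rho.
Let p (x : vec X) : vec 'I_m :=
  comb tau (push f (suppv x)) + scl (dot (chil co) x) ell.
Let q (r : vec 'I_n) : vec 'I_m := \sum_i scl (r i) (tau i + tau (f root)).
Let sx (v : vec 'I_m) : vec X := scl (sigl v) l0.

Lemma suppvD x y : suppv (x + y) = suppv x + suppv y.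
Proof.
apply/ffunP => -[[j|]|r]; rewrite !ffunE ?dotD ?addr0 //.
by rewrite -big_split; apply: eq_bigr => j _; rewrite dotD.
Qed.

Let pD : {morph p : x y / x + y}.
Proof. by move=> x y; rewrite /p suppvD pushD combD dotD sclDl addrACA. Qed.

Let qD : {morph q : x y / x + y}.
Proof. by move=> x y; rewrite -big_split; apply: eq_bigr => i _; rewrite ffunE sclDl. Qed.

Let sxD : {morph sx : x y / x + y}.
Proof. by move=> x y; rewrite /sx siglD sclDl. Qed.

Let q_unitv i : q (unitv i) = tau i + tau (f root).
Proof.
rewrite /q (bigD1 i) //= ffunE eqxx scl1 big1 ?addr0 // => j /negPf ji.
by rewrite ffunE ji scl0.
Qed.

Let rcol0 y : rcol rho y = 0. Proof. by apply/ffunP => r; rewrite !ffunE. Qed.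

Let q0 : q 0 = 0. Proof. by rewrite /q big1 // => i _; rewrite ffunE scl0. Qed.

Let suppv_C c : suppv (xcol (inC c)) = 0.
Proof. by apply/ffunP => -[[j|]|r]; rewrite !ffunE ?chi_C // big1 // => j _; rewrite chi_C. Qed.

Let suppv_l0 : suppv l0 = 0.
Proof. by apply/ffunP => -[[j|]|r]; rewrite !ffunE ?chi_l0 // big1 // => j _; rewrite chi_l0. Qed.

Let push0 : push f 0 = 0.
Proof. by apply/ffunP => i; rewrite !ffunE big1 // => v _; rewrite ffunE. Qed.

Let comb0 : comb tau 0 = 0.
Proof. by rewrite /comb big1 // => i _; rewrite ffunE scl0. Qed.

Let phiC c : phi A p q (inl (inC c)) = 0.
Proof.
by rewrite /phi gen_colx_Y gen_colr_Y rcol0 q0 /p suppv_C push0 comb0 chil_C scl0 !addr0.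
Qed.

Let ctd := contracted A p q.

Let ctd_spanC x : spanC x -> ctd x 0.
Proof.
apply: contracted_spanC => c; first by rewrite gen_colx_Y.
by rewrite gen_colr_Y rcol0.
Qed.

Let ctd_scl a x r : ctd x r -> ctd (scl a x) (scl a r).
Proof. by move=> H; case: (F2P a) => ->; rewrite ?scl0 ?scl1 //; exact: contracted0. Qed.

(** A frame column whose single entry is in the row of the root is contracted, which grounds the
    root. *)
Let ctd_root : ctd 0 (unitv (f root)).
Proof.
have := @contracted_elt _ _ _ A _ p q (inr (inl (0, (Some (f root), None)))).
rewrite /phi /= gen_colx_frame gen_colr_frame /lam zero_lambda /= !addr0; apply.
rewrite q_unitv addvec addr0 /p.
have -> : suppv 0 = 0 by rewrite -(addvec l0) suppvD addvec.
by rewrite push0 comb0 dot0 scl0 addr0.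
Qed.

(** Contracting the element of [Z] with column [j] in the row of vertex [j] identifies the
    coordinate [j] with that vertex. *)
Let ctd_base j : j \in base co -> ctd (ycol j) (unitv (f (inl (Some j)))).
Proof.
move=> jB; have := @contracted_elt _ _ _ A _ p q (inr (inr (f (inl (Some j)), j))).
rewrite /phi /= gen_colx_Z gen_colr_Z rcol0 addr0; apply.
rewrite q_unitv /p chil_base // scl0 addr0 suppv_unitv (bigD1 j) //= chi_base // eqxx scl1.
rewrite big1 ?addr0; first by rewrite pushD !push_unitv combD !comb_unitv addvec.
move=> i /negPf ij; have [iB|iB] := boolP (i \in base co); last by rewrite chi_out ?scl0.
by rewrite chi_base // ij scl0.
Qed.

Let ctd_expand x : spanC (expand x) -> ctd (x + scl (dot (chil co) x) l0) (push f (suppv x)).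
Proof.
move/ctd_spanC => cx.
have cs : ctd (\sum_i scl (dot (chi co i) x) (ycol i))
   (\sum_i scl (dot (chi co i) x) (unitv (f (inl (Some i))) + unitv (f root))).
  apply: (contracted_sum (J := xpredT)) => i _.
  have [iB|iB] := boolP (i \in base co); last first.
    by rewrite chi_out // !scl0; exact: contracted0.
  by apply: ctd_scl; have := contractedD (ctd_base iB) ctd_root; rewrite addr0.
have := contractedD cx cs; rewrite add0r /expand.
rewrite [X in contracted _ _ _ (X + _)]addrAC -[X in contracted _ _ _ X]addrA addvec addr0.
rewrite suppv_unitv (_ : push f _ = \sum_i scl (dot (chi co i) x)
  (unitv (f (inl (Some i))) + unitv (f root))) //.
rewrite (morph_sum _ _ (pushD f)); apply: eq_bigr => i _.
by rewrite push_scl pushD !push_unitv.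
Qed.

Let telt (k : tidx) : (Y0 + gen_elt Phi 'I_n)%type :=
  match k with inl y => inl y | inr (s, r) => inr (inr (f r, s)) end.

Let trow (k : tidx) : vec 'I_n := if k is inr (_, r) then unitv (f r) else 0.

Let colx_telt k : colx A (ground (telt k)) = tx k.
Proof. by case: k => [y|[s r]]; rewrite ?gen_colx_Y ?gen_colx_Z. Qed.

Let colr_telt k : colr A (ground (telt k)) = trow k.
Proof. by case: k => [y|[s r]]; rewrite ?gen_colr_Y ?gen_colr_Z ?rcol0 ?addr0. Qed.

Let phi_telt k : phi A p q (ground (telt k)) = tval k.
Proof.
rewrite /phi colx_telt colr_telt /p /tval /tset pushD combD addrAC; congr (_ + _ + _).
case: k => [y|[s r]] /=; first by rewrite q0 push0 comb0.
by rewrite q_unitv pushD !push_unitv combD !comb_unitv.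
Qed.

Let ctd_telt k : tvalid k ->
  ctd (tx k + scl (dot (chil co) (tx k)) l0) (trow k + push f (tset k)).
Proof.
move/tvalid_expand/ctd_expand => ck.
case: k ck => [y|[s r]] /=; first by rewrite /tset !addr0 add0r.
move=> ck; have := contractedD ck ctd_root; rewrite addr0 /tset !pushD !push_unitv /=.
set S := push f _; have -> // : unitv (f r) + (S + (unitv (f r) + unitv (f root))) = S + unitv (f root).
by rewrite [S + _]addrCA addvKl.
Qed.

Let ctd_tset k : k \in D -> ctd (scl (dot (chil co) (tx k)) l0) (push f (tset k)).
Proof.
move=> kD; have := @contracted_elt _ _ _ A _ p q (telt k).
rewrite phi_telt Dval // colx_telt colr_telt => /(_ erefl) ck.
have := contractedD ck (ctd_telt (Dvalid kD)).
by rewrite !addvKl.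
Qed.

Let ctd_vertex i : ctd (sx (tau i)) (unitv i + unitv i0 + sig (tau i)).
Proof.
have [K sK [<- Kl]] := lift_vertex i; rewrite /sx -Kl.
have -> : scl (\sum_(k <- K) dot (chil co) (tx k)) l0 = \sum_(k <- K) scl (dot (chil co) (tx k)) l0.
  by elim: {sK Kl} K => [|k K IHK]; rewrite ?big_nil ?scl0 // !big_cons sclDl IHK.
by apply: contracted_sum_seq => k /sK; exact: ctd_tset.
Qed.

Let sig0 : sig 0 = 0. Proof. by apply: (addrI (sig 0)); rewrite -sigD !addr0. Qed.
Let sx0 : sx 0 = 0. Proof. by apply: (addrI (sx 0)); rewrite -sxD !addr0. Qed.

Let sx_scl a v : sx (scl a v) = scl a (sx v).
Proof. by case: (F2P a) => ->; rewrite ?scl0 ?scl1 ?sx0. Qed.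
Let sig_scl a v : sig (scl a v) = scl a (sig v).
Proof. by case: (F2P a) => ->; rewrite ?scl0 ?scl1 ?sig0. Qed.

(** For even [w] the terms [unitv i0] cancel. *)
Let ctd_comb (w : vec 'I_n) : \sum_i w i = 0 -> ctd (sx (comb tau w)) (w + sig (comb tau w)).
Proof.
move=> w0; have : ctd (\sum_i scl (w i) (sx (tau i)))
    (\sum_i scl (w i) (unitv i + unitv i0 + sig (tau i))).
  by apply: (contracted_sum (J := xpredT)) => i _; apply: ctd_scl; exact: ctd_vertex.
have -> : \sum_i scl (w i) (sx (tau i)) = sx (comb tau w).
  by rewrite (morph_sum _ _ sxD); apply: eq_bigr => i _; rewrite sx_scl.
have -> // : \sum_i scl (w i) (unitv i + unitv i0 + sig (tau i)) = w + sig (comb tau w).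
rewrite (eq_bigr (fun i => scl (w i) (unitv i) + scl (w i) (unitv i0) + sig (scl (w i) (tau i)))).
  rewrite !big_split /= -vec_sum_unitv -(morph_sum (h := fun a => scl a (unitv i0))).
    by rewrite w0 scl0 addr0 (morph_sum _ _ sigD).
  by move=> a b; exact: sclDl.
by move=> i _; rewrite !sclDr sig_scl.
Qed.

Let ctd_ell : ctd (l0 + sx ell) (sig ell).
Proof.
move: lift_ell; case: eqP => [l00 ->|_ [-> s1]].
  by rewrite sx0 sig0 l00 addr0; exact: contracted0.
by rewrite /sx s1 scl1 addvec; exact: contracted0.
Qed.

Let p_l0 : p l0 = ell.
Proof.
rewrite /p suppv_l0 push0 comb0 add0r chil_l0; move: lift_ell.
by case: eqP => [_ ->|_ _]; rewrite ?sclr0 ?scl1.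
Qed.

Let p_scl a x : p (scl a x) = scl a (p x).
Proof.
case: (F2P a) => ->; rewrite ?scl0 ?scl1 //.
by apply: (addrI (p 0)); rewrite -pD !addr0.
Qed.

Lemma sum_unitv (B : finType) (b : B) : \sum_x unitv b x = 1.
Proof.
by rewrite (bigD1 b) //= ffunE eqxx big1 ?addr0 // => x /negPf xb; rewrite ffunE xb.
Qed.

Lemma tset_even k : \sum_v tset k v = 0.
Proof.
rewrite /tset; under eq_bigr do rewrite ffunE; rewrite big_split /= suppv_unitv.
have E u v : \sum_x (unitv u + unitv v : vec vtx) x = 0.
  by under eq_bigr do rewrite ffunE; rewrite big_split /= !sum_unitv; apply/val_inj.
rewrite [X in X + _](_ : _ = 0) ?add0r; last first.
  under eq_bigr do rewrite sum_ffunE; rewrite exchange_big big1 //= => j _.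
  rewrite (eq_bigr (fun x => dot (chi co j) (tx k) * (unitv (inl (Some j)) + unitv root : vec vtx) x)).
    by rewrite -mulr_sumr E mulr0.
  by move=> x _; rewrite ffunE.
by case: k => [y|[s r]]; [rewrite big1 // => v _; rewrite ffunE|exact: E].
Qed.

(** Frame columns supply the edges [tau i + tau j], doubled by [ell]; elements of [Y0] and [Z]
    supply the values of even vertex sets. *)
Lemma labelled_minor (U : finType) (N : matroid U) (u : U -> vec 'I_m) :
  cycle_space N (fun J => \sum_(x in J) u x == 0) -> injective u -> (forall x, u x != 0) ->
  (forall x, (exists i j b, u x = tau i + tau j + scl b ell) \/
             (exists2 k, tvalid k & u x = tval k)) ->
  has_minor (tmatroid A) N.
Proof.
move=> cN u_inj u0 H.
apply: (minor_certificate pD qD sxD sigD (@addvec _) cN u_inj u0 phiC) => x.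
case: (H x) => [[i [j [b ->]]]|[k kv ->]].
  have lamL : lam (scl b l0) = scl b l0.
    by rewrite /lam; case: (F2P b) => ->; rewrite ?scl0 ?scl1 ?l0L ?if_same.
  exists (inr (inl (scl b l0, (Some i, Some j)))).
    rewrite /phi /= gen_colx_frame gen_colr_frame /= lamL p_scl p_l0 qD !q_unitv.
    by rewrite addrACA addvec addr0 [RHS]addrC.
  rewrite /= gen_colx_frame gen_colr_frame lamL /= sxD sigD.
  have w0 : \sum_x (unitv i + unitv j : vec 'I_n) x = 0.
    by under eq_bigr do rewrite ffunE; rewrite big_split /= !sum_unitv; apply/val_inj.
  have := contractedD (ctd_comb w0) (ctd_scl b ctd_ell).
  rewrite combD !comb_unitv !sclDr -sx_scl -sig_scl !sxD !sigD.
  set c := sx _ + sx _; set d := sx _; set b' := scl b l0.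
  rewrite [b' + (c + d)]addrCA; set c' := sig _ + sig _; set d' := sig _.
  by rewrite -[_ + c' + d']addrA.
exists (telt k); first exact: phi_telt.
rewrite colx_telt colr_telt /tval sxD sigD.
have w0 : \sum_i push f (tset k) i = 0 by rewrite push_total tset_even.
have := contractedD (contractedD (ctd_telt kv) (ctd_comb w0))
  (ctd_scl (dot (chil co) (tx k)) ctd_ell).
rewrite !sclDr -sx_scl -sig_scl.
set a := tx k; set b := scl _ l0; set c := sx _; set d := sx _.
set a' := trow k; set b' := push _ _; set c' := sig _; set d' := sig _.
have -> : a + b + c + (b + d) = a + (c + d) by rewrite -!addrA; congr (_ + _); rewrite addrCA [b + (b + d)]addvKl.
by have -> : a' + b' + (b' + c') + d' = a' + (c' + d') by rewrite -!addrA addvKl.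
Qed.

Lemma labelled_conforms : conforms Phi (tmatroid A).
Proof. by apply: gen_tmatroid_conforms => r; exact: zero_row. Qed.

End Labelling.
End GenericMinor.

(** * Forbidden configurations *)

Definition bxor (a b : seq bool) : seq bool := [seq p.1 (+) p.2 | p <- zip a b].

Fixpoint blin (m : nat) (s : seq (seq bool)) (w : seq bool) : seq bool :=
  match w, s with
  | b :: w', r :: s' => if b then bxor r (blin m s' w') else blin m s' w'
  | _, _ => nseq m false
  end.

Lemma size_bxor m a b : size a = m -> size b = m -> size (bxor a b) = m.
Proof. by move=> sa sb; rewrite size_map size_zip sa sb minnn. Qed.

Lemma vl_bxor m (a b : seq bool) : size a = m -> size b = m -> vl m (bxor a b) = vl m a + vl m b.
Proof.
move=> sa sb; apply/ffunP => i; rewrite !ffunE -F2_addb (nth_map (false, false)).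
  by rewrite nth_zip ?sa ?sb.
by rewrite size_zip sa sb minnn.
Qed.

Definition vls (n m : nat) (s : seq (seq bool)) : 'I_n -> vec 'I_m :=
  fun i => vl m (nth [::] s (nat_of_ord i)).
Arguments vls n m s : clear implicits.

Lemma vl_nseq m : vl m (nseq m false) = 0.
Proof. by apply/ffunP => i; rewrite !ffunE nth_nseq if_same. Qed.

Lemma size_blin m s w : all (fun r => size r == m) s -> size (blin m s w) = m.
Proof.
elim: w s => [|b w IHw] [|r s] /=; rewrite ?size_nseq // => /andP[/eqP sr ss].
by case: b; rewrite ?IHw // (@size_bxor m) // IHw.
Qed.

Lemma comb_blin n m (s : seq (seq bool)) (w : seq bool) : size w = n -> size s = n ->
  all (fun r => size r == m) s -> comb (vls n m s) (vl n w) = vl m (blin m s w).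
Proof.
elim: n s w => [|n IHn] [|r s] [|b w] //=.
  by rewrite /comb big_ord0 vl_nseq.
move=> [sw] [ss] /andP[/eqP sr srs]; rewrite /comb big_ord_recl ffunE /= {1}/vls /=.
have -> : \sum_i scl (vl n.+1 (b :: w) (lift ord0 i)) (vls n.+1 m (r :: s) (lift ord0 i)) =
    comb (vls n m s) (vl n w).
  by apply: eq_bigr => i _; rewrite !ffunE.
rewrite IHn //; case: b; first by rewrite scl1 vl_bxor ?size_blin.
by rewrite scl0 add0r.
Qed.

Lemma vl_unitv n (i : 'I_n) : vl n [seq j == i :> nat | j <- iota 0 n] = unitv i.
Proof.
apply/ffunP => j; rewrite !ffunE (nth_map 0%N) ?size_iota // nth_iota //.
Qed.

Section Config.
Variable Phi : template.
Variables (l0 : vec (tX Phi)) (co : coordinates l0).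
Hypothesis l00 : l0 = 0.
Variables (n m : nat) (f : vtx Phi -> 'I_n).
Variables (taus s ts : seq (seq bool)) (i0 : 'I_n).
Variable ks : seq (tidx Phi).

(* The vertices are labelled by the points [taus] of [GF(2)^m], and [ts] are vertex sets.
   Contracting the members of [ts] whose labels sum to [0] leaves the other ones, and the
   edges of the complete graph, as the elements with the induced labels, provided that
   [e_i + e_i0 + s (tau_i)] is a sum of contracted sets for some linear section [s]. *)
Definition usable (t : seq bool) : bool :=
  has (fun i => has (fun j => bxor (nth [::] taus i) (nth [::] taus j) == t) (iota 0 n)) (iota 0 n)
  || has (fun t' => blin m taus t' == t) ts.

Definition lifts (i : nat) : bool :=
  has (fun mk => let Ts := mask mk ts in
     all (fun t => blin m taus t == nseq m false) Ts &&
     (blin n Ts (nseq (size Ts) true) ==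
      bxor (bxor [seq j == i | j <- iota 0 n] [seq j == i0 :> nat | j <- iota 0 n])
           (blin n s (nth [::] taus i))))
    (bools (size ts)).

Definition config_ok (us : seq (seq bool)) : bool :=
  [&& size taus == n, all (fun r => size r == m) taus,
      size s == m, all (fun r => size r == n) s, all (fun t => size t == n) ts,
      all lifts (iota 0 n) & all usable us].

Hypothesis ks_valid : forall k, k \in ks -> tvalid co k.
Hypothesis ks_push : [seq push f (tset co k) | k <- ks] = [seq vl n t | t <- ts].

Lemma config_minor (U : finType) (N : matroid U) (u : U -> seq bool) (us : seq (seq bool)) :
  config_ok us -> (forall x, u x \in us) ->
  cycle_space N (fun J => \sum_(x in J) vl m (u x) == 0) ->
  injective (fun x => vl m (u x)) -> (forall x, vl m (u x) != 0) ->
  exists (T : finType) (M : matroid T), conforms Phi M /\ has_minor M N.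
Proof.
case/and5P=> /eqP staus taus_m /eqP ss s_n /and3P[ts_n lifts_ok us_ok] u_us cN u_inj u0.
pose tau := vls n m taus; pose sig := comb (vls m n s).
have l0L : l0 \in tLambda Phi by rewrite l00; exact: zero_lambda.
have sigD : {morph sig : x y / x + y} by move=> x y; exact: combD.
have siglD : {morph (fun _ : vec 'I_m => 0 : 'F_2) : x y / x + y} by move=> x y; rewrite addr0.
have scll (a : 'F_2) : scl a l0 = 0 by rewrite l00 sclr0.
pose D := [seq k <- ks | tval co f tau 0 k == 0].
have tvalE k t : push f (tset co k) = vl n t -> size t = n -> tval co f tau 0 k = vl m (blin m taus t).
  by move=> kt st; rewrite /tval kt sclr0 addr0 comb_blin.
have Dval k : k \in D -> tval co f tau 0 k = 0 by rewrite mem_filter => /andP[/eqP].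
have Dvalid k : k \in D -> tvalid co k by rewrite mem_filter => /andP[_ /ks_valid].
have tauE (i : 'I_n) : tau i = vl m (nth [::] taus i) by [].
have size_tau i : (i < n)%N -> size (nth [::] taus i) = m.
  by move=> iP; apply/eqP/(allP taus_m)/mem_nth; rewrite staus.
have lift_v i : exists2 K : seq (tidx Phi), {subset K <= D} &
    \sum_(k <- K) push f (tset co k) = unitv i + unitv i0 + sig (tau i) /\
    scl (\sum_(k <- K) dot (chil co) (tx k)) l0 = scl 0 l0.
  have /allP/(_ (nat_of_ord i)) := lifts_ok; rewrite mem_iota ltn_ord => /(_ isT).
  case/hasP=> mk _ /andP[/allP tz /eqP tE].
  exists (mask mk ks); last first.
    split; last by rewrite !scll.
    have s1 (k : 'I_n) : size [seq j == k :> nat | j <- iota 0 n] = n by rewrite size_map size_iota.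
    have s2 : size (blin n s (nth [::] taus i)) = n by apply: size_blin.
    rewrite -!vl_unitv /sig tauE comb_blin ?size_tau //.
    rewrite -(vl_bxor (s1 i) (s1 i0)) -(vl_bxor (size_bxor (s1 i) (s1 i0)) s2).
    rewrite -tE -(big_map (fun k => push f (tset co k)) xpredT id) /= map_mask ks_push -map_mask.
    have : all (fun t => size t == n) (mask mk ts).
      by apply/allP => t /mem_mask /(allP ts_n).
    elim: (mask mk ts) => [|t Ts IHt] /=; first by rewrite big_nil vl_nseq.
    case/andP=> /eqP st sTs; rewrite big_cons IHt // vl_bxor // size_blin //.
  have kst (l : seq (tidx Phi)) (lt : seq (seq bool)) k :
      [seq push f (tset co k) | k <- l] = [seq vl n t | t <- lt] -> k \in l ->
      exists2 t, t \in lt & push f (tset co k) = vl n t.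
    move=> E kl; have : push f (tset co k) \in [seq vl n t | t <- lt] by rewrite -E; apply/mapP; exists k.
    by case/mapP=> t; exists t.
  move=> k kK; rewrite mem_filter (mem_mask kK) andbT.
  have [||t tT kt] := kst (mask mk ks) (mask mk ts) k => //; first by rewrite !map_mask ks_push.
  rewrite (tvalE _ _ kt); last by apply/eqP/(allP ts_n)/(mem_mask tT).
  by rewrite (eqP (tz _ tT)) vl_nseq.
have lift_ell : if l0 == 0 then (0 : vec 'I_m) = 0 else sig 0 = 0 /\ 0 = 1 :> 'F_2 by rewrite l00 eqxx.
exists _, (tmatroid (gen_matrix (fun _ : 'I_n => 0 : {ffun tY Phi -> 'F_2}))).
split; first exact: labelled_conforms.
apply: (labelled_minor l0L sigD siglD Dvalid Dval lift_v lift_ell cN u_inj u0) => x.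
have /(allP us_ok) := u_us x; case/orP.
  case/hasP=> i; rewrite mem_iota => iP /hasP[j]; rewrite mem_iota => jP /eqP <-.
  left; exists (Ordinal iP), (Ordinal jP), 0; rewrite scl0 addr0 vl_bxor // size_tau //.
case/hasP=> t tT /eqP <-; right.
have : vl n t \in [seq vl n t | t <- ts] by apply/mapP; exists t.
rewrite -ks_push => /mapP[k kK kt]; exists k; first exact: ks_valid.
by rewrite (tvalE _ t) //; apply/eqP/(allP ts_n).
Qed.

End Config.

Definition bb (l : seq nat) : seq bool := [seq x == 1%N | x <- l].

Lemma config_PG32 (Phi : template) (l0 : vec (tX Phi)) (co : coordinates l0) n
    (f : vtx Phi -> 'I_n) taus s ts (i0 : 'I_n) ks (e : seq bool) :
  no_PG32 Phi -> l0 = 0 -> size e = 4%N -> has id e ->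
  config_ok 4 taus s ts i0 [seq l <- bools 4 | has id l && (l != e)] ->
  (forall k, k \in ks -> tvalid co k) ->
  [seq push f (tset co k) | k <- ks] = [seq vl n t | t <- ts] -> False.
Proof.
move=> noPG l00 se e0 ok kv kp.
have e0' : vl 4 e != 0 by exact: vl_neq0.
pose e1 : PG32_point := exist (fun v : {ffun 'I_4 -> 'F_2} => v != 0) _ e0'.
pose u (x : {x : PG32_point | x \notin [set e1]}) := lv (val (val x)).
have uE x : vl 4 (u x) = val (val x) by rewrite lvK.
have [||||T [M [cM]]] := config_minor l00 kv kp (N := delete PG32 [set e1]) (u := u) ok.
- move=> x; rewrite mem_filter; apply/andP; split; last by have := mem_bools (u x); rewrite size_lv.
  apply/andP; split; last first.
    apply/eqP => ue; have := valP x; rewrite inE => /eqP; apply; apply/val_inj.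
    by rewrite -uE ue.
  apply: contraT => /hasPn nu; have := valP (val x); case/eqP; rewrite -uE.
  apply/ffunP => i; rewrite !ffunE; have := nu (nth false (u x) i).
  rewrite mem_nth ?size_lv // => /(_ isT); by case: (nth _ _ _).
- apply: cycle_space_ext (PG32_delete_cycles e1) => J /=.
  by congr (_ == _); apply: eq_bigr => x _; rewrite uE.
- by move=> x y; rewrite !uE => /val_inj/val_inj.
- by move=> x; rewrite uE; exact: (valP (val x)).
exact: noPG.
Qed.

Lemma config_L11 (Phi : template) (l0 : vec (tX Phi)) (co : coordinates l0) n
    (f : vtx Phi -> 'I_n) taus s ts (i0 : 'I_n) ks :
  no_L11 Phi -> l0 = 0 ->
  config_ok 6 taus s ts i0 [seq L11_list j | j <- iota 0 11] ->
  (forall k, k \in ks -> tvalid co k) ->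
  [seq push f (tset co k) | k <- ks] = [seq vl n t | t <- ts] -> False.
Proof.
move=> noL l00 ok kv kp.
have ul : uniq [seq L11_list j | j <- iota 0 11] by vm_compute.
have nz : nseq 6 false \notin [seq L11_list j | j <- iota 0 11] by vm_compute.
have sl j : size (L11_list j) = 6%N by rewrite size_map.
have linj (i j : 'I_11) : L11_list i = L11_list j -> i = j.
  move=> ij; have := @nth_uniq _ [::] _ i j _ _ ul; rewrite size_map size_iota !ltn_ord => /(_ isT isT).
  rewrite !(nth_map 0%N) ?size_iota ?ltn_ord // !nth_iota ?ltn_ord // ij eqxx => /esym/eqP.
  exact: val_inj.
have [||||T [M [cM]]] := config_minor l00 kv kp (N := L11) (u := fun j : 'I_11 => L11_list j) ok.
- by move=> j; apply: map_f; rewrite mem_iota ltn_ord.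
- apply: cycle_space_ext L11_cycles => J /=.
  by congr (_ == _); apply: eq_bigr => j _; rewrite L11_listE.
- by move=> i j /(vl_inj (sl i) (sl j)) /linj.
- move=> j; apply/eqP; rewrite -vl_nseq => /(vl_inj (sl j) (size_nseq _ _)) j0.
  case/negP: nz; rewrite -j0; apply: map_f.
  by rewrite mem_iota ltn_ord.
exact: noL.
Qed.

(** * Families of four-sets *)

Ltac split_neq :=
  repeat match goal with
  | H : is_true (uniq _) |- _ => move: H; rewrite /= ?inE ?negb_or
  | H : is_true (_ \notin _) |- _ => move: H; rewrite ?inE ?negb_or
  end;
  repeat match goal with |- is_true (_ && _) -> _ => case/andP | |- is_true _ -> _ => move=> ? end.

Ltac solve_neq :=
  split_neq; rewrite /= ?inE ?negb_or; repeat (apply/andP; split); first [done | by rewrite eq_sym].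

Section FourSets.
Variable V : finType.
Variable fam : pred {set V}.

Definition lset (l : seq V) : {set V} := [set x in l].

Hypothesis fam_even : forall T, fam T -> ~~ odd #|T|.
Hypothesis no_large : forall T, fam T -> (#|T| <= 5)%N.
Hypothesis no_far : forall a b t1 t2 t3 u1 u2 u3,
  uniq [:: t1; t2; t3; u1; u2; u3] -> a \notin [:: t1; t2; t3; u1; u2; u3] ->
  b \notin [:: t1; t2; t3; u1; u2; u3] ->
  fam (lset [:: a; t1; t2; t3]) -> fam (lset [:: b; u1; u2; u3]) -> False.
Hypothesis no_triangle : forall a b c d e f, uniq [:: a; b; c; d; e; f] ->
  fam (lset [:: a; b; c; d]) -> fam (lset [:: a; b; e; f]) -> fam (lset [:: c; d; e; f]) -> False.
Hypothesis no_fano : forall a b c d e f g, uniq [:: a; b; c; d; e; f; g] ->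
  fam (lset [:: a; b; c; d]) -> fam (lset [:: a; b; e; f]) -> fam (lset [:: a; c; e; g]) -> False.
Hypothesis no_third : forall a b c d e f, uniq [:: a; b; c; d; e; f] ->
  fam (lset [:: a; b; c; d]) -> fam (lset [:: a; b; c; e]) -> fam (lset [:: a; d; e; f]) -> False.
Hypothesis no_four : forall a b c d e, uniq [:: a; b; c; d; e] ->
  fam (lset [:: b; c; d; e]) -> fam (lset [:: a; c; d; e]) ->
  fam (lset [:: a; b; d; e]) -> fam (lset [:: a; b; c; e]) -> False.

Lemma lset_enum (A : {set V}) n : #|A| = n ->
  exists l, [/\ uniq l, size l = n & A = lset l].
Proof.
move=> cA; exists (enum A); rewrite enum_uniq -cardE; split=> //.
by apply/setP => x; rewrite inE mem_enum.
Qed.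

Lemma card_lset l : uniq l -> #|lset l| = size l.
Proof. by move=> ul; rewrite -(card_uniqP ul); apply: eq_card => x; rewrite inE. Qed.

Lemma lset_cat (A B : {set V}) l k : A :&: B = lset l -> A :\: B = lset k -> A = lset (l ++ k).
Proof.
by move=> Al Ak; rewrite -(setID A B) Al Ak; apply/setP => x; rewrite !inE mem_cat.
Qed.

Definition fam4 (T : {set V}) : bool := fam T && (#|T| == 4)%N.

Lemma split_meet (S T : {set V}) n : #|S| = 4%N -> #|T| = 4%N -> #|S :&: T| = n ->
  exists l t u, [/\ uniq (l ++ t ++ u), size l = n, size t = (4 - n)%N, size u = (4 - n)%N
      & S = lset (l ++ t) /\ T = lset (l ++ u)].
Proof.
move=> S4 T4 En; have [l [ul sl lE]] := lset_enum En.
have cST : #|S :\: T| = (4 - n)%N by rewrite cardsD S4 En.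
have cTS : #|T :\: S| = (4 - n)%N by rewrite cardsD T4 setIC En.
have [t [ut st tE]] := lset_enum cST; have [u [uu su uE]] := lset_enum cTS.
exists l, t, u; split=> //; last first.
  by split; [apply: lset_cat lE tE|apply: lset_cat uE; rewrite setIC].
have inl x : (x \in l) = (x \in S) && (x \in T) by have /setP/(_ x) := lE; rewrite !inE => <-.
have int x : (x \in t) = (x \notin T) && (x \in S) by have /setP/(_ x) := tE; rewrite !inE => <-.
have inu x : (x \in u) = (x \notin S) && (x \in T) by have /setP/(_ x) := uE; rewrite !inE => <-.
rewrite !cat_uniq ul ut uu /= andbT; apply/andP; split; apply/hasPn => x.
  rewrite mem_cat inl int inu; by case: (x \in S); case: (x \in T).
by rewrite inu int; case: (x \in S); case: (x \in T).
Qed.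

(** Both cases violate [no_far], whose points [a] and [b] may coincide: they are distinct when the
    sets are disjoint and equal when the sets share one point. *)
Lemma fam4_meet (S T : {set V}) : fam4 S -> fam4 T -> (2 <= #|S :&: T|)%N.
Proof.
move=> /andP[fS /eqP S4] /andP[fT /eqP T4]; rewrite leqNgt ltnS; apply/negP => le1.
move: le1; rewrite leq_eqVlt ltnS leqn0 => /orP[]/eqP/(split_meet S4 T4)[l [t [u []]]].
  case: l => [|a []] //; case: t => [|t1 [|t2 [|t3 []]]] //; case: u => [|u1 [|u2 [|u3 []]]] //.
  move=> ul _ _ _ [SE TE]; rewrite SE in fS; rewrite TE in fT.
  by apply: (no_far _ _ _ fS fT); solve_neq.
case: l => //; case: t => [|a [|t1 [|t2 [|t3 []]]]] //; case: u => [|b [|u1 [|u2 [|u3 []]]]] //.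
move=> ul _ _ _ [SE TE]; rewrite SE in fS; rewrite TE in fT.
by apply: (no_far _ _ _ fS fT); solve_neq.
Qed.

Ltac lset_perm :=
  let z := fresh "z" in apply/setP; intro z; rewrite !inE;
  repeat match goal with |- context [z == ?w] => case: (z == w) => //= end.

Lemma cardI_lset (T : {set V}) l : uniq l -> #|T :&: lset l| = count (mem T) l.
Proof.
move=> ul; rewrite -size_filter -(card_uniqP (filter_uniq (mem T) ul)).
by apply: eq_card => x; rewrite !inE mem_filter.
Qed.

Lemma fam4_eq (T : {set V}) l : #|T| = 4%N -> uniq l -> size l = 4%N -> all (mem T) l -> T = lset l.
Proof.
move=> T4 ul sl /allP lT; apply/esym/eqP; rewrite eqEcard card_lset // T4 sl leqnn andbT.
by apply/subsetP => x; rewrite inE => /lT.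
Qed.

Lemma fam4_extra (T : {set V}) l : #|T| = 4%N -> uniq l -> size l = 3%N -> all (mem T) l ->
  exists2 g, g \notin l & T = lset (rcons l g).
Proof.
move=> T4 ul sl /allP lT.
have : #|T :\: lset l| = 1%N.
  rewrite cardsD T4 (setIidPr _) ?card_lset ?sl //.
  by apply/subsetP => x; rewrite inE => /lT.
move/eqP/cards1P => [g gE]; have : g \in T :\: lset l by rewrite gE inE.
rewrite !inE => /andP[gl gT]; exists g => //; apply: fam4_eq => //.
- by rewrite rcons_uniq gl.
- by rewrite size_rcons sl.
by rewrite all_rcons /= gT; apply/allP.
Qed.

(* Two members meeting in exactly two points determine the pair. *)
Lemma pair_meet a b c d e f (T : {set V}) : uniq [:: a; b; c; d; e; f] ->
  fam (lset [:: a; b; c; d]) -> fam (lset [:: a; b; e; f]) -> fam4 T -> b \in T.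
Proof.
move=> ul f1 f2 f4T; have /andP[fT /eqP T4] := f4T; apply: contraT => bT; exfalso.
have u1 : uniq [:: a; b; c; d] by solve_neq.
have u2 : uniq [:: a; b; e; f] by solve_neq.
have m1 : (2 <= #|T :&: lset [:: a; b; c; d]|)%N.
  by apply: fam4_meet => //; rewrite /fam4 f1 card_lset.
have m2 : (2 <= #|T :&: lset [:: a; b; e; f]|)%N.
  by apply: fam4_meet => //; rewrite /fam4 f2 card_lset.
have le4 : (#|T :&: lset [:: a; b; c; d; e; f]| <= 4)%N.
  by rewrite -T4 subset_leq_card // subsetIl.
move: m1 m2 le4; rewrite !cardI_lset //= (negPf bT).
(* Since [T] avoids [b] and meets both sets twice, it consists of [a] and three of [c], [d], [e],
   [f], or of [a], one point from each of the pairs [c], [d] and [e], [f], and a new point, or of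
   [c], [d], [e], [f]. The claims [third], [fano] and [triangle] exclude these. *)
have third c' d' e' f' : uniq [:: a; b; c'; d'; e'; f'] ->
    fam (lset [:: a; b; c'; d']) -> fam (lset [:: a; b; e'; f']) ->
    a \in T -> c' \in T -> d' \in T -> e' \in T -> False.
  move=> u' g1 g2 aT cT dT eT.
  have u3 : uniq [:: a; c'; d'; e'] by solve_neq.
  have TE : T = lset [:: a; c'; d'; e'] by apply: fam4_eq; rewrite //= aT cT dT eT.
  rewrite TE in fT; apply: (@no_third a c' d' b e' f') => //; first by solve_neq.
  by congr fam: g1; lset_perm.
have fano c' d' e' f' : uniq [:: a; b; c'; d'; e'; f'] ->
    fam (lset [:: a; b; c'; d']) -> fam (lset [:: a; b; e'; f']) ->
    a \in T -> c' \in T -> d' \notin T -> e' \in T -> f' \notin T -> False.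
  move=> u' g1 g2 aT cT dT eT fT'.
  have u3 : uniq [:: a; c'; e'] by solve_neq.
  have h3 : all (mem T) [:: a; c'; e'] by rewrite /= aT cT eT.
  have [g gl TE] := fam4_extra T4 u3 erefl h3.
  have gT : g \in T by rewrite TE !inE eqxx !orbT.
  have gn x : x \notin T -> x != g by apply: contraNneq => ->.
  have gb := gn _ bT; have gd := gn _ dT; have gf := gn _ fT'.
  by rewrite TE in fT; apply: (@no_fano a b c' d' e' f' g) => //; solve_neq.
have swap x y : fam (lset [:: a; b; x; y]) -> fam (lset [:: a; b; y; x]).
  by congr fam; lset_perm.
have triangle : c \in T -> d \in T -> e \in T -> f \in T -> False.
  move=> cT dT eT fT'.
  have u3 : uniq [:: c; d; e; f] by solve_neq.
  have TE : T = lset [:: c; d; e; f] by apply: fam4_eq; rewrite //= cT dT eT fT'.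
  by rewrite TE in fT; apply: (no_triangle ul).
case: (boolP (a \in T)) => aT; case: (boolP (c \in T)) => cT; case: (boolP (d \in T)) => dT;
  case: (boolP (e \in T)) => eT; case: (boolP (f \in T)) => fT' //= _ _ _; try (by apply: triangle).
- by apply: (third c d e f).
- by apply: (third c d f e); first [assumption | exact: swap | solve_neq].
- by apply: (third e f c d); first [assumption | exact: swap | solve_neq].
- by apply: (fano c d e f).
- by apply: (fano c d f e); first [assumption | exact: swap | solve_neq].
- by apply: (third e f d c); first [assumption | exact: swap | solve_neq].
- by apply: (fano d c e f); first [assumption | exact: swap | solve_neq].
- by apply: (fano d c f e); first [assumption | exact: swap | solve_neq].
Qed.

(** Two four-sets meeting in exactly two points determine the pair by [pair_meet]. Otherwise
    distinct four-sets meet in three points. Let two of them share [a], [b], [c]. Unless [a], [b] is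
    a common pair, a third one misses one of these and lies in the union of the first two; the other
    two shared points then form the pair, as a member missing one would be a fourth four-subset of
    the same five points. *)
Theorem common_pair (r : V) : exists a b, forall T, fam T -> (#|T :\: [set a; b]| <= 2)%N.
Proof.
have small T : fam T -> ~~ (#|T| == 4)%N -> (#|T| <= 2)%N.
  by move=> fT; have := fam_even fT; have := no_large fT; case: #|T| => [|[|[|[|[|[|]]]]]].
suff [a [b H]] : exists a b, forall T, fam4 T -> a \in T /\ b \in T /\ a != b.
  exists a, b => T fT; have [T4|T4] := boolP (#|T| == 4)%N; last first.
    by apply: leq_trans (small _ fT T4); apply/subset_leq_card/subsetDl.
  have [|aT [bT ab]] := H T; first by rewrite /fam4 fT.
  rewrite cardsD (setIidPr _) ?cards2 ?ab ?(eqP T4) //.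
  by rewrite subUset !sub1set aT.
have [/existsP[S fS]|] := boolP [exists S, fam4 S]; last first.
  by rewrite negb_exists => /forallP nf; exists r, r => T fT; have := nf T; rewrite fT.
have [/existsP[S1 /andP[f1 /existsP[S2 /andP[f2 /eqP S12]]]]|] := boolP [exists S1, fam4 S1 &&
    [exists S2, fam4 S2 && (#|S1 :&: S2| == 2)%N]].
  have /andP[g1 /eqP c1] := f1; have /andP[g2 /eqP c2] := f2.
  have [l [t [u []]]] := split_meet c1 c2 S12.
  case: l => [|a [|b []]] //; case: t => [|c [|d []]] //; case: u => [|e [|f []]] //.
  rewrite !cat_cons cat0s => ul _ _ _ [E1 E2]; rewrite E1 in g1; rewrite E2 in g2.
  exists a, b => T fT; split; last first.
    by split; [apply: (pair_meet ul g1 g2)|solve_neq].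
  have swap x y : fam (lset [:: a; b; x; y]) -> fam (lset [:: b; a; x; y]).
    by congr fam; lset_perm.
  apply: (@pair_meet b a c d e f T) => //; [solve_neq|exact: swap|exact: swap].
rewrite negb_exists => /forallP n2.
have meet3 S1 S2 : fam4 S1 -> fam4 S2 -> S1 != S2 -> #|S1 :&: S2| = 3%N.
  move=> f1 f2 n12; have := n2 S1; rewrite f1 /= negb_exists => /forallP/(_ S2); rewrite f2 /=.
  have := fam4_meet f1 f2; have /andP[_ /eqP c1] := f1; have /andP[_ /eqP c2] := f2.
  have : (#|S1 :&: S2| <= 3)%N.
    rewrite -ltnS -c1; apply: proper_card; rewrite properE subsetIl /=.
    apply: contra n12 => sS; rewrite eqEcard c1 c2 leqnn andbT.
    by apply: subset_trans sS _; exact: subsetIr.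
  by case: #|S1 :&: S2| => [|[|[|[|]]]].
have /andP[gS /eqP cS] := fS.
have [/existsP[S2 /andP[f2 nS]]|] := boolP [exists S2, fam4 S2 && (S2 != S)]; last first.
  rewrite negb_exists => /forallP all_S.
  have [l [ul sl SE]] := lset_enum cS.
  case: l ul sl SE => [|a [|b [|c [|d []]]]] // ul _ SE; exists a, b => T fT.
  have := all_S T; rewrite fT /= negbK => /eqP->; rewrite SE !inE !eqxx orbT; split=> //.
  by split=> //; solve_neq.
have /andP[g2 /eqP c2] := f2.
have nS' : S != S2 by rewrite eq_sym.
have [l [t [u []]]] := split_meet cS c2 (meet3 _ _ fS f2 nS').
case: l => [|a [|b [|c []]]] //; case: t => [|d []] //; case: u => [|e []] //.
rewrite !cat_cons cat0s => ul _ _ _ [SE S2E].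
have u1 : uniq [:: a; b; c; d] by solve_neq.
have u2 : uniq [:: a; b; c; e] by solve_neq.
(* A member missing one of the three common points is the complement of that point. *)
have miss T x y z : fam4 T -> x \notin T -> uniq [:: x; y; z; d; e] ->
    S = lset [:: x; y; z; d] -> S2 = lset [:: x; y; z; e] -> T = lset [:: y; z; d; e].
  move=> fT xT ux Ex E2; have /andP[_ /eqP T4] := fT.
  have nT : T != S /\ T != S2.
    by split; apply: contraNneq xT => ->; rewrite ?Ex ?E2 inE mem_head.
  have ux1 : uniq [:: x; y; z; d] by solve_neq.
  have ux2 : uniq [:: x; y; z; e] by solve_neq.
  have := meet3 _ _ fT fS nT.1; have := meet3 _ _ fT f2 nT.2.
  rewrite Ex E2 !cardI_lset //= (negPf xT) => m2 m1.
  apply: fam4_eq => //; first by solve_neq.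
  move: m1 m2; rewrite /=; case: (y \in T); case: (z \in T); case: (d \in T); by case: (e \in T).
rewrite SE in gS; rewrite S2E in g2.
have [H|] := boolP [forall T, fam4 T ==> (a \in T) && (b \in T)].
  exists a, b => T fT; have /forallP/(_ T) := H; rewrite fT /= => /andP[aT bT].
  by split=> //; split=> //; solve_neq.
rewrite negb_forall => /existsP[T3]; rewrite negb_imply negb_and => /andP[f3 n3].
have main x y : uniq [:: x; y; c; d; e] -> S = lset [:: x; y; c; d] -> S2 = lset [:: x; y; c; e] ->
    x \notin T3 -> exists a b, forall T, fam4 T -> a \in T /\ b \in T /\ a != b.
  move=> ux Ex E2 xT3; exists y, c => T fT.
  have T3E := miss T3 x y c f3 xT3 ux Ex E2.
  have /andP[g3 _] := f3; rewrite T3E in g3.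
  have gS' : fam (lset [:: x; y; c; d]) by rewrite -Ex SE.
  have g2' : fam (lset [:: x; y; c; e]) by rewrite -E2 S2E.
  have /andP[gT _] := fT.
  split; last split; last by solve_neq.
  - apply: contraT => yT; exfalso.
    have TE : T = lset [:: x; c; d; e].
      by apply: (miss T y x c) => //; [solve_neq|rewrite Ex; lset_perm|rewrite E2; lset_perm].
    rewrite TE in gT; apply: (@no_four x y e d c) => //; [solve_neq|..].
    + by congr fam: g3; lset_perm.
    + by congr fam: gT; lset_perm.
    + by congr fam: gS'; lset_perm.
    by congr fam: g2'; lset_perm.
  apply: contraT => cT; exfalso.
  have TE : T = lset [:: x; y; d; e].
    by apply: (miss T c x y) => //; [solve_neq|rewrite Ex; lset_perm|rewrite E2; lset_perm].
  rewrite TE in gT; apply: (@no_four x c e d y) => //; [solve_neq|..].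
  + by congr fam: g3; lset_perm.
  + by congr fam: gT; lset_perm.
  + by congr fam: gS'; lset_perm.
  by congr fam: g2'; lset_perm.
case/orP: n3 => n3; first exact: (main a b).
apply: (main b a) => //; [solve_neq|rewrite SE; lset_perm|rewrite S2E; lset_perm].
Qed.

End FourSets.

Section Configurations.
Variable Phi : template.
Hypotheses (noPG : no_PG32 Phi) (noL : no_L11 Phi).
Variables (l0 : vec (tX Phi)) (co : coordinates l0).
Hypothesis l00 : l0 = 0.
Local Notation V := (vtx Phi).

Definition tsupp (k : tidx Phi) : {set V} := [set v | tset co k v == 1].

Definition tfam : pred {set V} := fun T => [exists k, tvalid co k && (tsupp k == T)].

(** Multiplicities count modulo 2, because identified vertices cancel in pairs. *)
Definition labels (n : nat) (js : seq nat) : seq bool := [seq odd (count_mem j js) | j <- iota 0 n].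

Lemma F2_odd (n : nat) : (n%:R : 'F_2) = (odd n)%:R.
Proof. by elim: n => // n IHn; rewrite -natr1 IHn /=; case: (odd n); apply/val_inj. Qed.

Lemma push_tsupp n (f : V -> 'I_n) k l : uniq l -> tsupp k = lset l ->
  push f (tset co k) = vl n (labels n [seq nat_of_ord (f v) | v <- l]).
Proof.
move=> ul kl; apply/ffunP => i; rewrite !ffunE (nth_map 0%N) ?size_iota // nth_iota //.
rewrite -F2_odd count_map add0n -sum1_count natr_sum big_mkcond [RHS]big_mkcond (big_uniq _ ul) /=.
rewrite [RHS]big_mkcond; apply: eq_bigr => v _; rewrite -val_eqE.
have /setP/(_ v) := kl; rewrite !inE => <-.
by case: (F2P (tset co k v)) => ->; case: ifP.
Qed.

Lemma tsupp_even k : ~~ odd #|tsupp k|.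
Proof.
have := tset_even co k; rewrite (eq_bigr (fun v => (v \in tsupp k)%:R : 'F_2)); last first.
  by move=> v _; rewrite inE; case: (F2P (tset co k v)) => ->.
rewrite -natr_sum -big_mkcond /= sum1_card F2_odd.
by case: odd.
Qed.

Lemma tfamP T : reflect (exists2 k, tvalid co k & tsupp k = T) (tfam T).
Proof.
apply: (iffP existsP) => [[k /andP[kv /eqP kT]]|[k kv kT]]; exists k => //.
by rewrite kv kT eqxx.
Qed.

Lemma label_config n (f : V -> 'I_n) (ls : seq (seq V)) (jss : seq (seq nat)) :
  all uniq ls -> all (fun l => tfam (lset l)) ls ->
  [seq [seq nat_of_ord (f v) | v <- l] | l <- ls] = jss ->
  exists2 ks, forall k, k \in ks -> tvalid co k &
    [seq push f (tset co k) | k <- ks] = [seq vl n t | t <- [seq labels n js | js <- jss]].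
Proof.
move=> + + <-; elim: ls => [|l ls IHls] /=; first by exists [::].
case/andP=> ul uls /andP[/tfamP[k kv kT] fls]; have [ks ksv ksE] := IHls uls fls.
exists (k :: ks) => [k'|]; first by rewrite inE => /predU1P[->|/ksv].
by rewrite /= ksE (push_tsupp f ul kT).
Qed.

Definition index_label n (pts : seq V) (v : V) : 'I_n.+1 := inord (index v pts).

Lemma index_label_nth n v0 (pts : seq V) (js : seq nat) : uniq pts -> (size pts <= n.+1)%N ->
  all (fun j => (j < size pts)%N) js ->
  [seq nat_of_ord (index_label n pts v) | v <- [seq nth v0 pts j | j <- js]] = js.
Proof.
move=> up sp /allP js_lt; rewrite -map_comp -[RHS]map_id; apply/eq_in_map => j /js_lt jP /=.
by rewrite inordK ?index_uniq // (leq_trans jP).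
Qed.

Lemma points_config n v0 (pts : seq V) (jss : seq (seq nat)) : uniq pts ->
  (size pts <= n.+1)%N -> all (all (fun j => (j < size pts)%N)) jss -> all uniq jss ->
  all (fun js => tfam (lset [seq nth v0 pts j | j <- js])) jss ->
  exists2 ks, forall k, k \in ks -> tvalid co k &
    [seq push (index_label n pts) (tset co k) | k <- ks] =
    [seq vl n.+1 t | t <- [seq labels n.+1 js | js <- jss]].
Proof.
move=> up sp jlt uj fj; apply: (@label_config _ _ [seq [seq nth v0 pts j | j <- js] | js <- jss]).
- rewrite all_map; apply/allP => js jsj /=; rewrite map_inj_in_uniq ?(allP uj) //.
  move=> i j /(allP (allP jlt _ jsj)) iP /(allP (allP jlt _ jsj)) jP /eqP.
  by rewrite nth_uniq // => /eqP.
- by rewrite all_map.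
rewrite -map_comp -[RHS]map_id; apply/eq_in_map => js /(allP jlt) jsP /=.
exact: index_label_nth.
Qed.

(* [PG(3,2)] from [K_6]: five vertices at the unit vectors and their sum, the sixth at 0. *)
Definition K6_points : seq (seq bool) :=
  map bb [:: [:: 1; 0; 0; 0]; [:: 0; 1; 0; 0]; [:: 0; 0; 1; 0]; [:: 0; 0; 0; 1]; [:: 1; 1; 1; 1];
             [:: 0; 0; 0; 0]]%N.

(** Five points of [T] stay separate and the others, odd in number, are identified to a sixth.
    Contracting [T] makes the sum of all six vertices of [K_6] zero, as for [K6_points]. *)
Lemma tfam_large T : tfam T -> (#|T| <= 5)%N.
Proof.
move=> fT; rewrite leqNgt; apply/negP => gt.
have [[|p0 [|p1 [|p2 [|p3 [|p4 rest]]]]] [ul sl TE]] := lset_enum (erefl #|T|);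
  rewrite -sl // in gt.
pose pts := [:: p0; p1; p2; p3; p4]; pose f := index_label 5 pts.
have := ul; rewrite -[_ :: _]/(pts ++ rest) cat_uniq => /and3P[up /hasPn nrest ur].
have f_pts : [seq nat_of_ord (f v) | v <- pts] = [:: 0; 1; 2; 3; 4]%N.
  exact: (@index_label_nth 5 p0 pts [:: 0; 1; 2; 3; 4]%N).
have f_rest : [seq nat_of_ord (f v) | v <- rest] = nseq (size rest) 5%N.
  rewrite -(size_map (fun v => nat_of_ord (f v))); apply/all_pred1P.
  rewrite all_map; apply/allP => v /nrest vp.
  by rewrite /= /f /index_label memNindex ?inordK.
have odd_rest : odd (size rest).
  have [k kv kT] := tfamP _ fT; have := tsupp_even k.
  by rewrite kT -sl /= !negbK.
have [ks ksv ksE] : exists2 ks, forall k, k \in ks -> tvalid co k &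
    [seq push f (tset co k) | k <- ks] =
    [seq vl 6 t | t <- [seq labels 6 js | js <- [:: [:: 0; 1; 2; 3; 4]%N ++ nseq (size rest) 5%N]]].
  apply: (@label_config _ _ [:: pts ++ rest]); rewrite ?all_seq1 //; first by rewrite -TE.
  transitivity [:: [seq nat_of_ord (f v) | v <- pts ++ rest]]; first by [].
  by rewrite map_cat f_rest f_pts.
have lE : labels 6 ([:: 0; 1; 2; 3; 4]%N ++ nseq (size rest) 5%N) = nseq 6 true.
  by rewrite /labels /= !count_nseq /= !add0n mul1n odd_rest.
rewrite /= lE in ksE.
have sg : config_ok 4 K6_points (map bb [:: [:: 1; 0; 0; 0; 0; 1]; [:: 0; 1; 0; 0; 0; 1];
   [:: 0; 0; 1; 0; 0; 1]; [:: 0; 0; 0; 1; 0; 1]]%N) [:: nseq 6 true] (ord_max : 'I_6)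
   [seq l <- bools 4 | has id l && (l != nseq 4 true)] by vm_compute.
exact: config_PG32 noPG l00 _ _ sg ksv ksE.
Qed.

(** Identify [b] with [a] and give it the label 1110. Both sets then have label sum 0, and
    contracting both makes the sum of the other six vertices zero, which is the situation of
    [K6_points]. *)
Lemma tfam_far a b t1 t2 t3 u1 u2 u3 :
  uniq [:: t1; t2; t3; u1; u2; u3] -> a \notin [:: t1; t2; t3; u1; u2; u3] ->
  b \notin [:: t1; t2; t3; u1; u2; u3] ->
  tfam (lset [:: a; t1; t2; t3]) -> tfam (lset [:: b; u1; u2; u3]) -> False.
Proof.
move=> ul al bl fT fU.
pose pts := [:: t1; t2; t3; u1; u2; u3; a].
have up : uniq pts by rewrite -[pts]/(rcons [:: t1; t2; t3; u1; u2; u3] a) rcons_uniq al.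
pose f (v : V) : 'I_7 := index_label 6 pts (if v == b then a else v).
have lab i : (i < 7)%N -> nat_of_ord (index_label 6 pts (nth a pts i)) = i.
  by move=> i7; rewrite /index_label index_uniq ?inordK.
have fa : nat_of_ord (f a) = 6%N by rewrite /f if_same; exact: (lab 6%N).
have fb : nat_of_ord (f b) = 6%N by rewrite /f eqxx; exact: (lab 6%N).
have ft i : (i < 6)%N -> nat_of_ord (f (nth a pts i)) = i.
  move=> i6; rewrite /f; case: eqP => [E|_]; last by apply: lab; rewrite ltnW.
  case/negP: bl; rewrite -E (_ : nth a pts i = nth a [:: t1; t2; t3; u1; u2; u3] i) ?mem_nth //.
  by move: i6; case: (i) => [|[|[|[|[|[|]]]]]].
have [ks ksv ksE] : exists2 ks, forall k, k \in ks -> tvalid co k &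
    [seq push f (tset co k) | k <- ks] =
    [seq vl 7 t | t <- [seq labels 7 js | js <- [:: [:: 6; 0; 1; 2]; [:: 6; 3; 4; 5]]%N]].
  apply: (@label_config _ _ [:: [:: a; t1; t2; t3]; [:: b; u1; u2; u3]]) => /=.
  - apply/and3P; split=> //.
      by change (is_true (uniq [:: a; t1; t2; t3])); solve_neq.
    by change (is_true (uniq [:: b; u1; u2; u3])); solve_neq.
  - by rewrite fT fU.
  by rewrite fa fb (ft 0%N) // (ft 1%N) // (ft 2%N) // (ft 3%N) // (ft 4%N) // (ft 5%N).
have sg : config_ok 4 (rcons K6_points (bb [:: 1; 1; 1; 0]%N))
   (map bb [:: [:: 1; 0; 0; 0; 0; 1; 0]; [:: 0; 1; 0; 0; 0; 1; 0];
   [:: 0; 0; 1; 0; 0; 1; 0]; [:: 0; 0; 0; 1; 0; 1; 0]]%N)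
   [seq labels 7 js | js <- [:: [:: 6; 0; 1; 2]; [:: 6; 3; 4; 5]]%N]
   (inord 5 : 'I_7)
   [seq l <- bools 4 | has id l && (l != nseq 4 true)].
  by rewrite /config_ok /lifts inordK //; vm_compute.
exact: config_PG32 noPG l00 _ _ sg ksv ksE.
Qed.

(** [K_5] on the unit vectors and 0 yields the ten nonzero vectors of weight at most two, and the
    four sets yield those of weight three; only 1111 is missing. *)
Lemma tfam_four a b c d e : uniq [:: a; b; c; d; e] ->
  tfam (lset [:: b; c; d; e]) -> tfam (lset [:: a; c; d; e]) ->
  tfam (lset [:: a; b; d; e]) -> tfam (lset [:: a; b; c; e]) -> False.
Proof.
move=> up f1 f2 f3 f4.
have [||||| ks ksv ksE] := @points_config 4 a [:: a; b; c; d; e]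
  [:: [:: 1; 2; 3; 4]; [:: 0; 2; 3; 4]; [:: 0; 1; 3; 4]; [:: 0; 1; 2; 4]]%N => //=.
  by rewrite f1 f2 f3 f4.
have sg : config_ok 4 (map bb [:: [:: 1; 0; 0; 0]; [:: 0; 1; 0; 0]; [:: 0; 0; 1; 0]; [:: 0; 0; 0; 1];
             [:: 0; 0; 0; 0]]%N) (map bb [:: [:: 1; 0; 0; 0; 1]; [:: 0; 1; 0; 0; 1];
   [:: 0; 0; 1; 0; 1]; [:: 0; 0; 0; 1; 1]]%N)
   [seq labels 5 js | js <- [:: [:: 1; 2; 3; 4]; [:: 0; 2; 3; 4]; [:: 0; 1; 3; 4]; [:: 0; 1; 2; 4]]%N]
   (ord_max : 'I_5) [seq l <- bools 4 | has id l && (l != nseq 4 true)] by vm_compute.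
exact: config_PG32 noPG l00 _ _ sg ksv ksE.
Qed.

(* In this and the next two configurations the labels represent [L11] as a restriction of
   [K_7] together with the three sets; they were found by a computer search. *)
Lemma tfam_triangle a b c d e f : uniq [:: a; b; c; d; e; f] ->
  tfam (lset [:: a; b; c; d]) -> tfam (lset [:: a; b; e; f]) -> tfam (lset [:: c; d; e; f]) -> False.
Proof.
move=> up f1 f2 f3.
have [||||| ks ksv ksE] := @points_config 6 a [:: a; b; c; d; e; f]
  [:: [:: 0; 1; 2; 3]; [:: 0; 1; 4; 5]; [:: 2; 3; 4; 5]]%N => //=.
  by rewrite f1 f2 f3.
have sg : config_ok 6 (map bb [:: [:: 1; 0; 1; 1; 0; 0]; [:: 0; 0; 0; 1; 1; 0]; [:: 0; 1; 1; 0; 1; 1];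
    [:: 0; 0; 0; 0; 0; 1]; [:: 0; 0; 1; 0; 0; 0]; [:: 0; 0; 0; 0; 1; 0]; [:: 0; 0; 0; 0; 0; 0]]%N)
  (map bb [:: [:: 1; 1; 0; 0; 1; 1; 0]; [:: 0; 0; 1; 1; 1; 1; 0]; [:: 0; 0; 0; 0; 1; 0; 1];
    [:: 0; 1; 0; 0; 0; 1; 0]; [:: 0; 0; 0; 0; 0; 1; 1]; [:: 0; 0; 0; 1; 0; 0; 1]]%N)
   [seq labels 7 js | js <- [:: [:: 0; 1; 2; 3]; [:: 0; 1; 4; 5]; [:: 2; 3; 4; 5]]%N]
   (ord_max : 'I_7) [seq L11_list j | j <- iota 0 11] by vm_compute.
exact: config_L11 noL l00 sg ksv ksE.
Qed.

Lemma tfam_fano a b c d e f g : uniq [:: a; b; c; d; e; f; g] ->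
  tfam (lset [:: a; b; c; d]) -> tfam (lset [:: a; b; e; f]) -> tfam (lset [:: a; c; e; g]) -> False.
Proof.
move=> up f1 f2 f3.
have [||||| ks ksv ksE] := @points_config 6 a [:: a; b; c; d; e; f; g]
  [:: [:: 0; 1; 2; 3]; [:: 0; 1; 4; 5]; [:: 0; 2; 4; 6]]%N => //=.
  by rewrite f1 f2 f3.
have sg : config_ok 6 (map bb [:: [:: 1; 0; 1; 0; 0; 0]; [:: 0; 1; 1; 0; 1; 1]; [:: 0; 0; 1; 1; 1; 0];
    [:: 0; 0; 1; 0; 1; 0]; [:: 0; 0; 1; 0; 1; 1]; [:: 0; 0; 1; 0; 0; 0]; [:: 0; 0; 0; 0; 0; 0]]%N)
  (map bb [:: [:: 1; 0; 0; 0; 0; 1; 0]; [:: 0; 1; 0; 0; 1; 0; 0]; [:: 0; 0; 0; 0; 0; 1; 1];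
    [:: 0; 0; 1; 1; 0; 0; 0]; [:: 0; 0; 0; 1; 0; 1; 0]; [:: 0; 0; 0; 1; 1; 0; 0]]%N)
   [seq labels 7 js | js <- [:: [:: 0; 1; 2; 3]; [:: 0; 1; 4; 5]; [:: 0; 2; 4; 6]]%N]
   (ord_max : 'I_7) [seq L11_list j | j <- iota 0 11] by vm_compute.
exact: config_L11 noL l00 sg ksv ksE.
Qed.

Lemma tfam_third a b c d e f : uniq [:: a; b; c; d; e; f] ->
  tfam (lset [:: a; b; c; d]) -> tfam (lset [:: a; b; c; e]) -> tfam (lset [:: a; d; e; f]) -> False.
Proof.
move=> up f1 f2 f3.
have [||||| ks ksv ksE] := @points_config 6 a [:: a; b; c; d; e; f]
  [:: [:: 0; 1; 2; 3]; [:: 0; 1; 2; 4]; [:: 0; 3; 4; 5]]%N => //=.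
  by rewrite f1 f2 f3.
have sg : config_ok 6 (map bb [:: [:: 0; 0; 0; 0; 1; 1]; [:: 1; 0; 0; 0; 0; 0]; [:: 0; 0; 0; 1; 0; 0];
    [:: 0; 1; 0; 0; 0; 0]; [:: 0; 0; 1; 0; 1; 0]; [:: 0; 0; 0; 0; 1; 0]; [:: 0; 0; 0; 0; 0; 0]]%N)
  (map bb [:: [:: 0; 1; 0; 0; 0; 0; 1]; [:: 0; 0; 0; 1; 0; 0; 1]; [:: 0; 0; 0; 0; 1; 1; 0];
    [:: 0; 0; 1; 0; 0; 0; 1]; [:: 0; 0; 0; 0; 0; 1; 1]; [:: 1; 0; 0; 0; 0; 1; 0]]%N)
   [seq labels 7 js | js <- [:: [:: 0; 1; 2; 3]; [:: 0; 1; 2; 4]; [:: 0; 3; 4; 5]]%N]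
   (ord_max : 'I_7) [seq L11_list j | j <- iota 0 11] by vm_compute.
exact: config_L11 noL l00 sg ksv ksE.
Qed.

Lemma tfam_common_pair : exists a b, forall T, tfam T -> (#|T :\: [set a; b]| <= 2)%N.
Proof.
apply: common_pair (root Phi).
- by move=> T /tfamP[k _ <-]; exact: tsupp_even.
- exact: tfam_large.
- exact: tfam_far.
- exact: tfam_triangle.
- exact: tfam_fano.
- exact: tfam_third.
exact: tfam_four.
Qed.

End Configurations.

Section LambdaConfiguration.
Variable Phi : template.
Hypothesis noPG : no_PG32 Phi.
Variables (l0 : vec (tX Phi)) (co : coordinates l0).
Hypotheses (l0L : l0 \in tLambda Phi) (l0_neq0 : l0 != 0).

(* [PG(3,2)] minus a point from [K_4] with all edges doubled by [l0], and one extra element. *)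
Lemma tfam_lambda T : tfam co T -> (#|T| <= 2)%N.
Proof.
move=> fT; rewrite leqNgt; apply/negP => gt.
have [[|p0 [|p1 [|p2 rest]]] [ul sl TE]] := lset_enum (erefl #|T|);
  rewrite -sl // in gt.
pose pts := [:: p0; p1; p2]; pose f := index_label 3 pts.
have := ul; rewrite -[_ :: _]/(pts ++ rest) cat_uniq => /and3P[up /hasPn nrest ur].
have f_pts : [seq nat_of_ord (f v) | v <- pts] = [:: 0; 1; 2]%N.
  exact: (@index_label_nth _ 3 p0 pts [:: 0; 1; 2]%N).
have f_rest : [seq nat_of_ord (f v) | v <- rest] = nseq (size rest) 3%N.
  rewrite -(size_map (fun v => nat_of_ord (f v))); apply/all_pred1P.
  rewrite all_map; apply/allP => v /nrest vp.
  by rewrite /= /f /index_label memNindex ?inordK.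
have [k kv kT] := tfamP co _ fT.
have odd_rest : odd (size rest).
  by have := tsupp_even co k; rewrite kT -sl /= !negbK.
have kp : push f (tset co k) = vl 4 (nseq 4 true).
  rewrite (push_tsupp f ul); last by rewrite kT TE.
  have -> : [seq nat_of_ord (f v) | v <- [:: p0, p1, p2 & rest]] = [:: 0; 1; 2]%N ++ nseq (size rest) 3%N.
    by rewrite -f_rest -f_pts -map_cat.
  by rewrite /labels /= !count_nseq /= !add0n mul1n odd_rest.
pose taus := map bb [:: [:: 1; 0; 0; 0]; [:: 0; 1; 0; 0]; [:: 0; 0; 1; 0]; [:: 0; 0; 0; 0]]%N.
pose s := map bb [:: [:: 1; 0; 0; 1]; [:: 0; 1; 0; 1]; [:: 0; 0; 1; 1]; [:: 0; 0; 0; 0]]%N.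
pose tau := vls 4 4 taus; pose ell : vec 'I_4 := vl 4 (bb [:: 0; 0; 0; 1]%N).
pose sig := comb (vls 4 4 s); pose sigl (v : vec 'I_4) := v ord_max.
have sigD : {morph sig : x y / x + y} by move=> x y; exact: combD.
have siglD : {morph sigl : x y / x + y} by move=> x y; rewrite /sigl ffunE.
pose eps := dot (chil co) (tx k) == 1.
have tvalE : tval co f tau ell k = vl 4 [:: true; true; true; eps].
  rewrite /tval kp comb_blin // [blin _ _ _]/=.
  have -> : scl (dot (chil co) (tx k)) ell = vl 4 [:: false; false; false; eps].
    rewrite /eps; apply/ffunP => i; rewrite !ffunE.
    by case: (F2P (dot (chil co) (tx k))) => ->; rewrite ?mul0r ?mul1r; case: i => -[|[|[|[|]]]].
  by rewrite -vl_bxor //; case: eps.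
(* The doubled edges of [K_4] and [l0] itself give the 13 nonzero points that do not start with 111.
   Of the two points over 111, [k] realises one and the other is the deleted point. *)
pose e := [:: true; true; true; ~~ eps].
have e0 : vl 4 e != 0 by apply/eqP => /ffunP/(_ ord0); rewrite !ffunE.
pose e1 : PG32_point := exist (fun v : {ffun 'I_4 -> 'F_2} => v != 0) _ e0.
have lift_v i : exists2 K : seq (tidx Phi), {subset K <= [::]} &
    \sum_(k <- K) push f (tset co k) = unitv i + unitv ord_max + sig (tau i) /\
    scl (\sum_(k <- K) dot (chil co) (tx k)) l0 = scl (sigl (tau i)) l0.
  exists [::] => //; rewrite !big_nil; split.
    rewrite -!vl_unitv /sig /tau /vls comb_blin //; last by case: i => -[|[|[|[|]]]].
    rewrite -!vl_bxor ?size_bxor ?size_map ?size_iota //; last first.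
      by case: i => -[|[|[|[|]]]].
    by rewrite -[LHS](vl_nseq 4); congr vl; case: i => -[|[|[|[|]]]].
  by congr scl; rewrite /sigl /tau /vls ffunE; case: i => -[|[|[|[|]]]].
have lift_ell : if l0 == 0 then ell = 0 else sig ell = 0 /\ sigl ell = 1.
  rewrite (negPf l0_neq0); split; last by rewrite /sigl ffunE.
  by rewrite /sig comb_blin // -[RHS](vl_nseq 4).
apply: (noPG (labelled_conforms Phi 4) (e := e1)).
have Dv k' : k' \in [::] -> tvalid co k' by [].
have Dz k' : k' \in [::] -> tval co f tau ell k' = 0 by [].
apply: (labelled_minor l0L sigD siglD Dv Dz lift_v lift_ell (PG32_delete_cycles e1)).
- by move=> x y /val_inj/val_inj.
- by move=> x; exact: (valP (val x)).
move=> x; have : val (val x) != vl 4 e.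
  by have := valP x; rewrite inE; apply: contra => /eqP xe; apply/eqP/val_inj.
elim/vec4_ind: (val (val x)) => a b c d.
have pair i j bd : (i < 4)%N -> (j < 4)%N ->
    bxor (bxor (nth [::] taus i) (nth [::] taus j)) [:: false; false; false; bd] = [:: a; b; c; d] ->
    exists i j b', vl 4 [:: a; b; c; d] = tau i + tau j + scl b' ell.
  move=> i4 j4 <-; exists (Ordinal i4), (Ordinal j4), bd%:R.
  have -> : scl bd%:R ell = vl 4 [:: false; false; false; bd].
    by apply/ffunP => -[[|[|[|[|]]]] l4] //; rewrite !ffunE; case: bd; rewrite ?mul0r ?mul1r.
  have st l : (l < 4)%N -> size (nth [::] taus l) = 4%N by case: l => [|[|[|[|]]]].
  rewrite vl_bxor // ?vl_bxor ?st //.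
  by apply: size_bxor; rewrite st.
case: a pair; case: b; case: c => pair xe.
- right; exists k => //; rewrite tvalE; congr vl; move: xe; rewrite /e.
  by case: d pair => _; case: (eps); rewrite ?eqxx.
- by left; apply: (pair 0%N 1%N d).
- by left; apply: (pair 0%N 2%N d).
- by left; apply: (pair 0%N 3%N d).
- by left; apply: (pair 1%N 2%N d).
- by left; apply: (pair 1%N 3%N d).
- by left; apply: (pair 2%N 3%N d).
- by left; apply: (pair 3%N 3%N d).
Qed.

End LambdaConfiguration.

(** * Conforming matroids are even-cycle matroids *)

Lemma sum_option (I : finType) (V : zmodType) (G : option I -> V) :
  \sum_o G o = G None + \sum_i G (Some i).
Proof.
rewrite (bigD1 None) //= (reindex_omap Some id) /=; last by case.
by congr (_ + _); apply: eq_bigl => i; rewrite ?eqxx.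
Qed.

Section Upper.
Variable Phi : template.
Hypotheses (noPG : no_PG32 Phi) (noL : no_L11 Phi).
Local Notation X := (tX Phi).
Local Notation Y := (tY Phi).
Local Notation Y0 := (tY0 Phi).
Local Notation Y1 := (tY1 Phi).
Local Notation C := (tC Phi).

(** By [lambda_rank], two members of Lambda outside the span of [C] differ by an element of that
    span; if there is no such member, [l0 = 0] serves. *)
Lemma lambda_generator : exists l0 : vec X, [/\ l0 \in tLambda Phi, spanC l0 -> l0 = 0
  & forall l, l \in tLambda Phi -> spanC l \/ spanC (l + l0)].
Proof.
have [/existsP[l0 /andP[l0L l0C]]|] := boolP [exists l : vec X, (l \in tLambda Phi) && ~~ spanC l].
  exists l0; split=> // [H|l lL]; first by rewrite H in l0C.
  by have [|H|] := lambda_rank noPG lL l0L; [left|rewrite H in l0C|right].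
rewrite negb_exists => /forallP H; exists 0; split=> [|//|l lL]; first exact: zero_lambda.
by left; have := H l; rewrite lL negbK.
Qed.

Variable l0 : vec X.
Hypotheses (l0L : l0 \in tLambda Phi)
  (lambda_l0 : forall l, l \in tLambda Phi -> spanC l \/ spanC (l + l0)).
Variable co : coordinates l0.

Lemma expand_spanC x : spanC x -> expand co x = x.
Proof.
case/spanCP=> K ->; rewrite /expand.
have dC d : (forall c, dot d (xcol (inC c)) = 0) -> dot d (\sum_(c in K) xcol (inC c)) = 0.
  by move=> dc; rewrite dot_sum big1.
rewrite [dot (chil co) _]dC ?scl0 ?addr0; last exact: chil_C.
rewrite [X in _ + X]big1 ?addr0 // => i _; by rewrite dC ?scl0 //; exact: chi_C.
Qed.

Lemma spanC_chi x j : spanC x -> dot (chi co j) x = 0.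
Proof. by case/spanCP=> K ->; rewrite dot_sum big1 // => c _; exact: chi_C. Qed.

Lemma lambda_chi l j : l \in tLambda Phi -> dot (chi co j) l = 0.
Proof.
case/lambda_l0=> /(spanC_chi j) //; by rewrite dotD chi_l0 addr0.
Qed.

Lemma expand_lambda l : l \in tLambda Phi -> spanC (expand co l).
Proof.
have e0 : expand co l0 = 0.
  have s0 : \sum_i scl (dot (chi co i) l0) (ycol i) = 0.
    by apply: big1 => i _; rewrite chi_l0 scl0.
  rewrite /expand chil_l0 s0 addr0.
  by have [l00|_] := eqVneq l0 0; rewrite ?scl0 ?addr0 ?scl1 ?addvec.
case/lambda_l0 => lC; first by rewrite expand_spanC.
by have := expand_spanC lC; rewrite expandD e0 addr0 => ->.
Qed.

Definition in_span (x : vec X) : Prop := exists (l : vec X) (J : {set Y1}) (K : {set C}),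
  l \in tLambda Phi /\ x = l + \sum_(j in J) ycol j + \sum_(c in K) xcol (inC c).

Lemma spanC_sum (I : finType) (P : pred I) (x : I -> vec X) :
  (forall i, P i -> spanC (x i)) -> spanC (\sum_(i | P i) x i).
Proof. by move=> H; elim/big_ind: _ => //; [exact: spanC0|exact: spanCD]. Qed.

Lemma expand_in_span x : in_span x -> spanC (expand co x).
Proof.
move=> [l [J [K [lL ->]]]]; rewrite !expandD.
apply: spanCD; first apply: spanCD; first exact: expand_lambda.
  by rewrite (morph_sum _ _ (expandD co)); apply: spanC_sum => j _; exact: chi_expand.
rewrite expand_spanC; apply: spanC_sum => c _; exact: spanC_col.
Qed.

Section Matrix.
Variables (R F : finType) (A : binmx (X + R)%type (Y + F)%type).
Hypothesis cA : matrix_conforms A.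
Hypothesis Y0_span : forall y, in_span (xcol (inY0 y)).

Lemma conforming_column_Y y :
  colx A (inl y) = xcol y /\ forall r, [ffun y => A (inr r) (inl y)] \in tDelta Phi.
Proof.
case: cA => A' [Z [[A'1 _ _ _ A'D] AY _ _]]; split.
  by apply/ffunP => x; rewrite !ffunE AY A'1.
move=> r; have -> : [ffun y => A (inr r) (inl y)] = [ffun y => A' (inr r) (inl y)]; last exact: A'D.
by apply/ffunP => y'; rewrite !ffunE AY.
Qed.

Lemma conforming_column_F z :
  [\/ colx A (inr z) \in tLambda Phi /\ (#|[set r | colr A (inr z) r != 0%R]| <= 2)%N
    | exists j r0, colx A (inr z) = ycol j /\
        colr A (inr z) = unitv r0 + colr A (inl (inY1 j))].
Proof.
case: cA => A' [Z [[A'1 [A'Z0 A'Z1] A'2 A'L A'D] AY AF AZ]].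
have [zZ|zZ] := boolP (z \in Z); [right|left].
  have [j jE] := AZ z zZ; have [r0 r0E] := A'Z1 z zZ; exists j, r0; split.
    by apply/ffunP => x; rewrite !ffunE jE A'Z0 // add0r A'1.
  by apply/ffunP => r; rewrite !ffunE jE r0E AY.
split.
  have -> : colx A (inr z) = [ffun x => A' (inl x) (inr z)]; last exact: A'L.
  by apply/ffunP => x; rewrite !ffunE AF.
apply: leq_trans (A'2 z zZ); apply/subset_leq_card/subsetP => r.
by rewrite !inE ffunE AF.
Qed.

(* A row operation by [h] clears the rows labelled by [Delta]. *)
Lemma delta_functional : exists h : R -> vec X, forall r,
  (forall l, l \in tLambda Phi -> dot (h r) l = 0) /\
  (forall y, dot (h r) (xcol y) = A (inr r) (inl y)).
Proof.
apply: (@fin_all_exists _ _ (fun r (h : vec X) => (forall l, l \in tLambda Phi -> dot h l = 0) /\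
  (forall y, dot h (xcol y) = A (inr r) (inl y)))) => r.
pose f (s : Y + vec X) := match s with inl y => xcol y | inr l => lam l end.
pose c (s : Y + vec X) := match s with inl y => A (inr r) (inl y) | inr l => 0 end.
have [S fS|h hE] := @functional_ext _ _ f c; last first.
  exists h; split=> [l lL|y]; last exact: (hE (inl y)).
  by have := hE (inr l); rewrite /= /lam lL.
have splitS (V : zmodType) (g : Y + vec X -> V) : \sum_(s in S) g s =
    \sum_(i in [set i | inl i \in S]) g (inl i) + \sum_(k in [set k | inr k \in S]) g (inr k).
  rewrite big_mkcond big_sumType /= [X in _ = X + _]big_mkcond [X in _ = _ + X]big_mkcond.
  by congr (_ + _); apply: eq_bigr => i _; rewrite inE.
rewrite splitS /= [X in _ + X]big1 ?addr0 //.
move: fS; rewrite splitS addrC => fS.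
have lL : \sum_(k in [set k | inr k \in S]) f (inr k) \in tLambda Phi.
  elim/big_ind: _ => [||k _]; [exact: zero_lambda|exact: lambdaD|exact: lamP].
have [y0|noY] := pickP (fun y : Y => true); last by rewrite big1 // => y; have := noY y.
(* The relation at hand is one between columns of [A_1] modulo Lambda, so [delta_vanish] is the
   consistency condition of [functional_ext]. *)
move=> _; have := delta_vanish noPG lL fS ((conforming_column_Y y0).2 r).
by move=> H; apply: etrans H; apply: eq_bigr => y _; rewrite ffunE.
Qed.

Let xc (e : (Y0 + F)%type) : vec X := colx A (ground e).

Variable h : R -> vec X.
Hypotheses (hL : forall r l, l \in tLambda Phi -> dot (h r) l = 0)
  (hY : forall r y, dot (h r) (xcol y) = A (inr r) (inl y)).

(** The rows of [R] after the row operation by [h], in which the [Y]-part of the matrix is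
    cleared. *)
Let gr (e : (Y0 + F)%type) : vec R := [ffun r => colr A (ground e) r + dot (h r) (xc e)].

Lemma tcycle_cleared (J : {set (Y0 + F)%type}) :
  tcycle A J = spanC (\sum_(e in J) xc e) && (\sum_(e in J) gr e == 0).
Proof.
have colxC c : colx A (inl (inC c)) = xcol (inC c) := (conforming_column_Y _).1.
have sum_gr r : (\sum_(e in J) gr e) r =
    (\sum_(e in J) colr A (ground e)) r + dot (h r) (\sum_(e in J) xc e).
  rewrite !sum_ffunE dot_sum -big_split; apply: eq_bigr => e _; by rewrite ffunE.
have sum_C r (K : {set C}) : (\sum_(c in K) colr A (inl (inC c))) r =
    dot (h r) (\sum_(c in K) xcol (inC c)).
  by rewrite sum_ffunE dot_sum; apply: eq_bigr => c _; rewrite ffunE hY.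
rewrite tcycleE; apply/existsP/andP => [[K /andP[/eqP Kx /eqP Kr]]|[/spanCP[K KE] /eqP g0]].
  rewrite (eq_bigr _ (fun c _ => colxC c)) in Kx.
  split; first by apply/spanCP; exists K.
  apply/eqP/ffunP => r; rewrite sum_gr Kr sum_C -Kx addF2 ffunE //.
exists K; apply/andP; split; first by rewrite (eq_bigr _ (fun c _ => colxC c)) -KE.
apply/eqP/ffunP => r; rewrite sum_C -KE; apply/(addr_eq0_char2 addF2).
by rewrite -sum_gr g0 ffunE.
Qed.

(** The row [None] of the root is the sum of all other rows, so every column has even support. *)
Let row (v : (option Y1 + R)%type) (e : (Y0 + F)%type) : 'F_2 :=
  match v with
  | inl (Some j) => dot (chi co j) (xc e)
  | inl None => \sum_j dot (chi co j) (xc e) + \sum_r gr e r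
  | inr r => gr e r
  end.

Lemma row_total e : \sum_v row v e = 0.
Proof.
by rewrite big_sumType /= sum_option /= -addrA addF2.
Qed.

(* The three types of elements: a graph edge, a vertex joined to a member of [Y1],
   and an element of [Y0]. *)
Lemma row_types e :
  [\/ xc e \in tLambda Phi /\ (#|[set r | gr e r != 0%R]| <= 2)%N,
      exists j r0, xc e = ycol j /\ gr e = unitv r0
    | exists y, xc e = xcol (inY0 y) /\ gr e = 0].
Proof.
case: e => [y|z].
  constructor 3; exists y; rewrite /xc /= (conforming_column_Y _).1; split=> //.
  apply/ffunP => r; rewrite !ffunE /xc /= (conforming_column_Y _).1 hY addF2.
  by [].
have [[xL r2]|[j [r0 [xj rj]]]] := conforming_column_F z; [constructor 1|constructor 2].
  split=> //; apply: leq_trans r2; apply/subset_leq_card/subsetP => r.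
  by rewrite !inE [gr _ _]ffunE hL // addr0.
exists j, r0; split=> //; apply/ffunP => r; rewrite ffunE /= rj /xc /= xj.
by rewrite ffunE [colr _ _ _]ffunE hY -addrA addF2 addr0.
Qed.

Lemma xc_expand e : spanC (expand co (xc e)).
Proof.
case: (row_types e) => [[xL _]|[j [r0 [-> _]]]|[y [-> _]]].
- exact: expand_lambda.
- exact: chi_expand.
exact: expand_in_span.
Qed.

(** If all coordinates of a sum vanish, the sum is its own residue [expand], and the residues of all
    columns lie in the span of [C]. The coordinate of [l0] is a condition only for [l0 != 0]. *)
Lemma tcycle_rows (J : {set (Y0 + F)%type}) :
  tcycle A J = [forall v, \sum_(e in J) row v e == 0] &&
    ((l0 == 0) || (\sum_(e in J) dot (chil co) (xc e) == 0)).
Proof.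
rewrite tcycle_cleared; set x := \sum_(e in J) xc e.
have chiE j : \sum_(e in J) dot (chi co j) (xc e) = dot (chi co j) x by rewrite dot_sum.
apply/andP/andP => [[xC /eqP g0]|[/forallP H Hl]].
  have g0r r : \sum_(e in J) gr e r = 0 by rewrite -sum_ffunE g0 ffunE.
  split; last first.
    rewrite -dot_sum -/x; case/spanCP: xC => K ->.
    by rewrite dot_sum big1 ?eqxx ?orbT // => c _; exact: chil_C.
  apply/forallP => -[[j|]|r] /=; apply/eqP; [by rewrite chiE spanC_chi| |exact: g0r].
  rewrite big_split /= exchange_big [X in _ + X]exchange_big /=.
  rewrite big1 => [|j _]; last by rewrite chiE spanC_chi.
  by rewrite add0r big1 // => r _; exact: g0r.
split; last first.
  apply/eqP/ffunP => r; rewrite sum_ffunE [RHS]ffunE; exact/eqP/(H (inr r)).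
have : spanC (expand co x).
  rewrite /x (morph_sum _ _ (expandD co)); apply: spanC_sum => e _; exact: xc_expand.
rewrite /expand big1 => [|j _]; last first.
  by rewrite -chiE (eqP (H (inl (Some j)))) scl0.
rewrite addr0; have [l00|l00] := eqVneq l0 0; first by rewrite {2}l00 sclr0 addr0.
by move: Hl; rewrite (negPf l00) /= -dot_sum -/x => /eqP->; rewrite scl0 addr0.
Qed.

Lemma row_card a b e : (forall T, tfam co T -> (#|T :\: [set a; b]| <= 2)%N) ->
  (#|[set v | (row v e != 0%R) && (if v is inl o then (inl o : vtx Phi) \notin [set a; b] else true)]| <= 2)%N.
Proof.
move=> ab.
pose S1 : {set option Y1} := [set o | (row (inl o) e != 0) && ((inl o : vtx Phi) \notin [set a; b])].
pose S2 : {set R} := [set r | gr e r != 0].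
apply: (@leq_trans (#|S1| + #|S2|)).
  have c1 : #|[set (inl o : (option Y1 + R)%type) | o in S1]| = #|S1| by apply: card_imset => ? ? [].
  have c2 : #|[set (inr r : (option Y1 + R)%type) | r in S2]| = #|S2| by apply: card_imset => ? ? [].
  rewrite -c1 -c2; apply: leq_trans (leq_card_setU _ _); apply/subset_leq_card/subsetP => -[o|r];
    rewrite inE => /andP[v0 vab]; rewrite inE; apply/orP; [left|right]; apply: imset_f; rewrite inE //.
  by rewrite v0.
have S1_tset k : tvalid co k -> (forall o, tset co k (inl o) = row (inl o) e) ->
    S1 \subset [set o | (inl o : vtx Phi) \in tsupp co k :\: [set a; b]].
  move=> kv kE; apply/subsetP => o; rewrite !inE kE F2_neq0 => /andP[-> ->].
  by [].
have card_pre (W : {set vtx Phi}) : #|[set (inl o : vtx Phi) | o in [set o | (inl o : vtx Phi) \in W]]| =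
    #|[set o | (inl o : vtx Phi) \in W]| by apply: card_imset => ? ? [].
case: (row_types e) => [[xL S2le]|[j [r0 [xj gj]]]|[y [xy g0]]].
- have S1le : S1 \subset [set None].
    apply/subsetP => -[j|]; rewrite !inE //= lambda_chi // eqxx //.
  have S1le1 : (#|S1| <= 1)%N by rewrite -(cards1 (None : option Y1)) subset_leq_card.
  (* A frame column has no base coordinates; with exactly two entries in [R] its root entry is 0,
     and with fewer the root entry may be the second one. *)
  have [S22|S22] := eqVneq #|S2| 2; last first.
    rewrite -[2%N]/(1 + 1)%N leq_add //.
    by have := S2le; rewrite leq_eqVlt (negPf S22).
  suff -> : S1 = set0 by rewrite cards0 S22.
  apply/setP => -[j|]; rewrite !inE /=; first by rewrite lambda_chi ?eqxx.
  rewrite big1 ?add0r => [|j _]; last exact: lambda_chi.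
  have -> : \sum_r gr e r = 0; last by rewrite eqxx.
  rewrite (eq_bigr (fun r => (r \in S2)%:R : 'F_2)); last first.
    by move=> r _; rewrite inE; case: (F2P (gr e r)) => ->.
  by rewrite -natr_sum -big_mkcond /= sum1_card S22; apply/val_inj.
- have S21 : S2 = [set r0].
    by apply/setP => r; rewrite !inE gj ffunE; case: (r == r0).
  (* Among three extra vertices one avoids both [a] and [b]. Standing in for the row [r0], it uses
     one of the two places that the even set has outside the pair, which leaves at most one for the
     root and base rows. *)
  have [c cab] : exists c : 'I_3, (inr c : vtx Phi) \notin [set a; b].
    apply/existsP; apply: contraT; rewrite negb_exists => /forallP H.
    have : (#|[set (inr c : vtx Phi) | c in 'I_3]| <= #|[set a; b]|)%N.
      by apply/subset_leq_card/subsetP => _ /imsetP[c _ ->]; have := H c; rewrite negbK.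
    rewrite card_imset ?card_ord ?cards2; last by move=> ? ? [].
    by case: (a != b).
  pose k : tidx Phi := inr (j, inr c).
  have kT : tfam co (tsupp co k) by apply/tfamP; exists k.
  have kE o : tset co k (inl o) = row (inl o) e.
    rewrite /tset !ffunE /= xj add0r; case: o => [i|] /=; first by rewrite addr0.
    by congr (_ + _); rewrite gj sum_unitv.
  have := S1_tset k isT kE => sS1; rewrite S21 cards1.
  have : (#|(inr c : vtx Phi) |: [set (inl o : vtx Phi) | o in S1]| <= 2)%N.
    apply: leq_trans (ab _ kT); apply/subset_leq_card; rewrite subUset sub1set; apply/andP; split.
      by rewrite inE cab inE /tset !ffunE eqxx.
    by apply/subsetP => _ /imsetP[o /(subsetP sS1) + ->]; rewrite inE.
  rewrite cardsU1 card_imset; last by move=> ? ? [].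
  have -> : (inr c : vtx Phi) \notin [set (inl o : vtx Phi) | o in S1] by apply/negP => /imsetP[].
  by rewrite addn1 add1n.
have S20 : S2 = set0 by apply/setP => r; rewrite !inE g0 ffunE eqxx.
pose k : tidx Phi := inl y.
have kv : tvalid co k by apply: expand_in_span; exact: Y0_span.
have kT : tfam co (tsupp co k) by apply/tfamP; exists k.
have kE o : tset co k (inl o) = row (inl o) e.
  rewrite /tset addr0 ffunE /= xy; case: o => [i|] //=.
  by rewrite g0 [X in _ + X]big1 ?addr0 // => r _; rewrite ffunE.
rewrite S20 cards0 addn0; apply: leq_trans (subset_leq_card (S1_tset k kv kE)) _.
rewrite -card_pre; apply: leq_trans (ab _ kT); apply/subset_leq_card/subsetP.
by move=> _ /imsetP[o + ->]; rewrite inE.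
Qed.

Let kept a b (v : (option Y1 + R)%type) : bool :=
  if v is inl o then (inl o : vtx Phi) \notin [set a; b] else true.

(** Dropping the rows of [a] and [b] leaves a frame matrix. The sign row [w] has to restore the row
    of [a] and the coordinate of [l0]; the row of [b] then follows since all rows sum to zero. *)
Lemma even_cycle_of_pair (a b : vtx Phi) (w : (Y0 + F)%type -> 'F_2) :
  (forall T, tfam co T -> (#|T :\: [set a; b]| <= 2)%N) ->
  (forall J : {set (Y0 + F)%type}, tcycle A J -> \sum_(e in J) w e = 0) ->
  (forall J : {set (Y0 + F)%type}, (forall v, kept a b v -> \sum_(e in J) row v e = 0) ->
     \sum_(e in J) w e = 0 ->
     (forall o, a = inl o -> \sum_(e in J) row (inl o) e = 0) /\
     (l0 == 0) || (\sum_(e in J) dot (chil co) (xc e) == 0)) ->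
  even_cycle (tmatroid A).
Proof.
move=> ab w0 H.
apply: (@even_cycle_of_frame _ _ _ w (fun v e => if kept a b v then row v e else 0)).
  move=> e; apply: leq_trans (row_card e ab); apply/subset_leq_card/subsetP => v.
  by rewrite !inE; case: ifP => [kv|]; rewrite ?eqxx // => ->.
apply: cycle_space_ext (tmatroid_cycles A) => J.
apply/idP/ecm_cycleP => [ZJ|[wJ DJ]].
  split; first exact: w0.
  move=> v; case: (kept a b v); last by rewrite big1.
  by move: ZJ; rewrite tcycle_rows => /andP[/forallP/(_ v)/eqP].
have keptJ v : kept a b v -> \sum_(e in J) row v e = 0 by move=> kv; have := DJ v; rewrite kv.
have [aJ lJ] := H J keptJ wJ.
rewrite tcycle_rows lJ andbT; apply/forallP => v; apply/eqP.
have [kv|nv] := boolP (kept a b v); first exact: keptJ.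
case: v nv => [o|r] //=; rewrite negbK !inE => /orP[/eqP ao|/eqP bo]; first exact: aJ.
have [ab'|nab] := eqVneq a b; first by apply: aJ; rewrite ab' bo.
have total : \sum_v \sum_(e in J) row v e = 0.
  by rewrite exchange_big big1 //= => e _; exact: row_total.
have others (v : (option Y1 + R)%type) : v != inl o -> \sum_(e in J) row v e = 0.
  move=> vo; have [kv|] := boolP (kept a b v); first exact: keptJ.
  case: v vo => [o'|r] //= oo'; rewrite negbK !inE => /orP[/eqP ao'|/eqP bo']; first exact: aJ.
  by case/eqP: oo'; move: bo'; rewrite -bo => -[->].
by move: total; rewrite (bigD1 (inl o)) //= [X in _ + X]big1 ?addr0 // => v /others.
Qed.

Lemma tmatroid_even_cycle : even_cycle (tmatroid A).
Proof.
have chil0 J : tcycle A J -> (l0 == 0) || (\sum_(e in J) dot (chil co) (xc e) == 0).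
  by rewrite tcycle_rows => /andP[].
have row0 J v : tcycle A J -> \sum_(e in J) row v e = 0.
  by rewrite tcycle_rows => /andP[/forallP/(_ v)/eqP].
have [l00|l0n] := eqVneq l0 0.
  have [a [b ab]] := tfam_common_pair noPG noL co l00.
  (* An extra vertex is not a row of the matrix; if [a] is one, the sign row is zero. *)
  pose w e := if a is inl o then row (inl o) e else 0.
  apply: (even_cycle_of_pair (w := w) ab) => J.
    by move=> ZJ; rewrite /w; case: (a) => [o|r]; [exact: row0|rewrite big1].
  move=> _ wJ; split=> [o ao|]; last by apply/orP; left; apply/eqP.
  by move: wJ; rewrite /w ao.
(* All even sets now have at most two points, so only the root row is dropped, to be recovered from
   the total; the sign row is free for the coordinate of [l0]. *)
pose r0 : vtx Phi := root Phi.
apply: (@even_cycle_of_pair r0 r0 (fun e => dot (chil co) (xc e))).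
- move=> T fT; apply: leq_trans (tfam_lambda noPG l0L l0n fT).
  by apply/subset_leq_card/subsetDl.
- by move=> J /chil0; rewrite (negPf l0n) => /eqP.
move=> J kJ wJ; rewrite wJ eqxx orbT; split=> // o [<-].
have total : \sum_v \sum_(e in J) row v e = 0.
  by rewrite exchange_big big1 //= => e _; exact: row_total.
have others (v : (option Y1 + R)%type) : v != inl None -> \sum_(e in J) row v e = 0.
  move=> vo; apply: kJ; case: v vo => [o'|r] //= oo'; rewrite setUid inE.
  by apply: contra oo' => /eqP[->].
by move: total; rewrite (bigD1 (inl None)) //= [X in _ + X]big1 ?addr0 // => v /others.
Qed.

End Matrix.
End Upper.

Theorem conforming_even_cycle (Phi : template) (R F : finType)
    (A : binmx (tX Phi + R)%type (tY Phi + F)%type) :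
  no_PG32 Phi -> no_L11 Phi -> matrix_conforms A ->
  (forall y, in_span (xcol (inY0 (y : tY0 Phi)))) -> even_cycle (tmatroid A).
Proof.
move=> noPG noL cA sp; have [l0 [l0L l0C Ll0]] := lambda_generator noPG.
have [co] := coordinates_exist l0C.
have [h hP] := delta_functional noPG cA.
apply: (@tmatroid_even_cycle _ noPG noL l0 l0L Ll0 co R F A cA sp h) => r.
  exact: (hP r).1.
exact: (hP r).2.
Qed.

(** * Rank and vertical connectivity *)

Lemma rk_le (T : finType) (M : matroid T) (S : {set T}) n :
  (forall I : {set T}, indep M I -> I \subset S -> (#|I| <= n)%N) -> (rk M S <= n)%N.
Proof. by move=> H; apply/bigmax_leqP => I /andP[iI sI]; exact: H. Qed.

Lemma rk_ge (T : finType) (M : matroid T) (S I : {set T}) :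
  indep M I -> I \subset S -> (#|I| <= rk M S)%N.
Proof.
by move=> iI sI; apply: (@leq_bigmax_cond _ (fun I : {set T} => indep M I && (I \subset S))
  (fun I : {set T} => #|I|)); rewrite iI sI.
Qed.

Lemma rk_witness (T : finType) (M : matroid T) (S : {set T}) :
  exists I : {set T}, [/\ indep M I, I \subset S & #|I| = rk M S].
Proof.
have [I [sI iI mI]] := max_indep_sub M S; exists I; split=> //.
by apply/eqP; rewrite eqn_leq rk_ge //; apply: rk_le => J iJ sJ; exact: mI.
Qed.

Lemma rkS (T : finType) (M : matroid T) (S S' : {set T}) : S \subset S' -> (rk M S <= rk M S')%N.
Proof. by move=> sS; apply: rk_le => I iI sI; apply: rk_ge => //; exact: subset_trans sS. Qed.

Lemma rk_card (T : finType) (M : matroid T) (S : {set T}) : (rk M S <= #|S|)%N.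
Proof. by apply: rk_le => I _; exact: subset_leq_card. Qed.

Lemma rk_image (T U : finType) (M : matroid T) (N : matroid U) (f : T -> U) (S : {set T}) :
  injective f -> (forall I : {set T}, indep N (f @: I) = indep M I) -> rk N (f @: S) = rk M S.
Proof.
move=> injf fE; apply/eqP; rewrite eqn_leq; apply/andP; split; apply: rk_le => I iI sI.
  have IE : I = f @: (f @^-1: I).
    apply/setP => y; apply/idP/imsetP => [yI|[x + ->]]; last by rewrite inE.
    by have /imsetP[x _ yx] := subsetP sI _ yI; exists x; rewrite // inE -yx.
  rewrite IE (card_imset _ injf); apply: rk_ge; first by rewrite -fE -IE.
  apply/subsetP => x; rewrite inE => /(subsetP sI); by rewrite mem_imset.
by rewrite -(card_imset _ injf); apply: rk_ge; rewrite ?fE // imsetS.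
Qed.

Lemma vertically_connected_iso k (T U : finType) (M : matroid T) (N : matroid U) :
  iso M N -> vertically_connected k M -> vertically_connected k N.
Proof.
move=> [f bf fE] vM P Q PQ dPQ; have injf := bij_inj bf; have [g fK gK] := bf.
have fpre (S : {set U}) : f @: (f @^-1: S) = S.
  apply/setP => y; apply/imsetP/idP => [[x + ->]|yS]; first by rewrite inE.
  by exists (g y); rewrite ?inE gK.
have rkE (S : {set U}) : rk N S = rk M (f @^-1: S) by rewrite -{1}(fpre S) (rk_image _ injf fE).
rewrite /spanning !rkE preimsetT => lt; apply: vM => //.
  by rewrite -preimsetU PQ preimsetT.
move: dPQ; rewrite !disjoints_subset => /subsetP sPQ; apply/subsetP => x; rewrite !inE => /sPQ.
by rewrite inE.
Qed.

Lemma vertically_connected_le k k' (T : finType) (M : matroid T) :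
  (k <= k')%N -> vertically_connected k' M -> vertically_connected k M.
Proof.
move=> kk vM P Q PQ dPQ lt; apply: vM => //; apply: leq_trans lt _.
by rewrite leq_sub2r.
Qed.

Section CompleteGraphs.

Lemma complete_graph_indep2 n (e f : edge (complete_graph n)) :
  indep (cycle_matroid (complete_graph n)) [set e; f].
Proof.
apply: (@simple_graph_indep2 n _ (val : edge (complete_graph n) -> _)); first exact: val_inj.
by move=> x; exact: (valP x).
Qed.

Definition star_edge n (i : 'I_n) : edge (complete_graph n.+1) :=
  exist (fun p : 'I_n.+1 * 'I_n.+1 => (p.1 < p.2)%N) (ord0, lift ord0 i) isT.

Lemma star_edge_inj n : injective (@star_edge n).
Proof. by move=> i j /(congr1 (fun e => (val e).2)) /= ij; apply: (@lift_inj _ ord0). Qed.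

Lemma star_indep n : indep (cycle_matroid (complete_graph n.+1)) [set star_edge i | i : 'I_n].
Proof.
apply/(cycle_indepP (cycle_matroid_cycles _)) => J sJ /sum_cycleP ZJ.
apply/eqP; apply: contraT => /set0Pn[e eJ].
have /imsetP[i _ ei] := subsetP sJ _ eJ.
have := ZJ (lift ord0 i); rewrite (big_setD1 e) //= big1 => [|e'].
  by rewrite ei /incidence /= eqxx addr0 add0r.
rewrite !inE => /andP[ne e'J]; have /imsetP[j _ ej] := subsetP sJ _ e'J.
rewrite ej /incidence /= add0r (inj_eq (@lift_inj _ _)).
case: eqP => // ij; by rewrite ej ei ij eqxx in ne.
Qed.

(** The star at one vertex gives [n] edges that are independent in the minor, hence in [M]. *)
Lemma complete_minor_rank n (T : finType) (M : matroid T) :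
  has_minor M (cycle_matroid (complete_graph n.+1)) -> (n <= rk M setT)%N.
Proof.
case/minorP=> g [C [injg gC gE]].
have := star_indep n; rewrite gE => iS.
apply: leq_trans (rk_ge iS (subsetT _)).
rewrite -[X in (X <= _)%N](card_ord n) -(card_imset _ (@star_edge_inj n)).
rewrite -(card_imset _ injg); exact/subset_leq_card/subsetUl.
Qed.

Lemma complete_graph_minor n n' : (n <= n')%N ->
  has_minor (cycle_matroid (complete_graph n')) (cycle_matroid (complete_graph n)).
Proof.
move=> nn.
pose g (e : edge (complete_graph n)) : edge (complete_graph n') :=
  exist (fun p : 'I_n' * 'I_n' => (p.1 < p.2)%N)
    (widen_ord nn (val e).1, widen_ord nn (val e).2) (valP e).
have injg : injective g.
  move=> e f /(congr1 val) [] /= e1 e2; apply/val_inj.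
  rewrite [LHS]surjective_pairing [RHS]surjective_pairing; congr (_, _); exact/val_inj.
have gC x : g x \notin set0 by rewrite inE.
apply: (cycles_minor injg gC (cycle_matroid_cycles _) (cycle_matroid_cycles _)) => J.
have -> : minor_cycle g set0 (sum_cycle (@incidence (complete_graph n'))) J =
    sum_cycle (@incidence (complete_graph n')) (g @: J).
  apply/existsP/idP => [[K]|ZJ]; last by exists set0; rewrite sub0set setU0.
  by rewrite subset0 => /andP[/eqP->]; rewrite setU0.
have incE (v : 'I_n) e : incidence (G := complete_graph n') (widen_ord nn v) (g e) =
    incidence (G := complete_graph n) v e by [].
have sumg v : \sum_(e in g @: J) incidence (G := complete_graph n') v e =
    \sum_(e in J) incidence (G := complete_graph n') v (g e).
  by rewrite big_imset //= => x y _ _; exact: injg.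
apply/sum_cycleP/sum_cycleP => H v; last by rewrite -[RHS](H (widen_ord nn v)) sumg.
rewrite sumg; have [vn|vn] := ltnP v n.
  have -> : v = widen_ord nn (Ordinal vn) by exact/val_inj.
  exact: H.
apply: big1 => e _; rewrite /incidence /= -!val_eqE /=.
by rewrite !gtn_eqF ?addr0 // (leq_trans (ltn_ord _)).
Qed.

End CompleteGraphs.

(** * Deleting loops and parallel elements *)

Section Redundant.
(* The element [e] is a loop ([D = set0]) or parallel to the single element of [D]. *)
Variables (T : finType) (M : matroid T) (B : finType) (A : binmx B T) (e : T) (D : {set T}).
Hypotheses (cA : cycle_space M (sum_cycle A)) (eD : e \notin D) (leD : (#|D| <= 1)%N).
Hypothesis cD : sum_cycle A (e |: D).

Lemma redundant_indep (I : {set T}) : indep M I -> e \in I -> D != set0 /\ [disjoint D & I].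
Proof.
move=> iI eI; have nD : ~~ (D \subset I).
  apply/negP => sD; have := cycle_sub_indep cA iI _ cD.
  rewrite subUset sub1set eI sD => /(_ isT)/setP/(_ e); by rewrite !inE eqxx.
split; first by apply: contraNneq nD => ->; exact: sub0set.
rewrite disjoints_subset; apply/subsetP => x xD; rewrite inE; apply: contra nD => xI.
have -> : D = [set x] by apply/esym/eqP; rewrite eqEcard sub1set xD cards1.
by rewrite sub1set.
Qed.

(** Parallel elements have equal columns, so exchanging [e] with the element of [D] is an
    automorphism; for a loop the identity serves. *)
Lemma redundant_swap : exists2 tau : T -> T, injective tau &
  (forall I : {set T}, indep M (tau @: I) = indep M I) /\
  (forall d, d \in D -> tau e = d /\ tau d = e) /\ (forall x, x != e -> x \notin D -> tau x = x).
Proof.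
have [D0|[d dD]] := set_0Vmem D.
  exists id => //; split; first by move=> I; rewrite imset_id.
  by split=> // d; rewrite D0 inE.
have DE : D = [set d] by apply/esym/eqP; rewrite eqEcard sub1set dD cards1.
have ed : e != d by apply: contraNneq eD => ->.
pose tau x := if x == e then d else if x == d then e else x.
have tauK : involutive tau.
  move=> x; rewrite /tau; have [->|xe] := eqVneq x e; first by rewrite eq_sym (negPf ed) eqxx.
  have [->|xd] := eqVneq x d; first by rewrite eqxx.
  by rewrite (negPf xe) (negPf xd).
have colE b x : A b (tau x) = A b x.
  have Ade : A b e = A b d.
    have /sum_cycleP/(_ b) := cD; rewrite DE big_setU1 ?inE // big_set1.
    by move/(addr_eq0_char2 addF2).
  by rewrite /tau; case: eqP => [->|_]; [rewrite Ade|case: eqP => [->|]].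
exists tau; first exact: inv_inj.
split.
  move=> I; have fE (J : {set T}) : indep (pull_matroid M (inv_inj tauK)) J = indep M (tau @: J) by [].
  have cM' : cycle_space (pull_matroid M (inv_inj tauK)) (sum_cycle A).
    apply: cycle_space_ext (iso_cycle_space (inv_inj tauK) (fun J => esym (fE J)) cA) => J.
    apply: eq_forallb => b; rewrite big_imset /=; last by move=> x y _ _; exact: inv_inj.
    by congr (_ == _); apply: eq_bigr => x _; exact: colE.
  rewrite -fE; apply/(cycle_indepP cM')/(cycle_indepP cA) => H; exact: H.
split=> [d'|x xe]; first by rewrite DE inE => /eqP->; rewrite /tau eqxx eq_sym (negPf ed) eqxx.
by rewrite DE inE /tau (negPf xe) => /negPf->.
Qed.

Lemma redundant_rk (S : {set T}) : D \subset S -> rk M (e |: S) = rk M S.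
Proof.
move=> sD; apply/eqP; rewrite eqn_leq [X in _ && X]rkS ?subsetUr // andbT.
apply: rk_le => I iI sI; have [eI|eI] := boolP (e \in I); last first.
  apply: rk_ge => //; apply/subsetP => x xI; have := subsetP sI _ xI; rewrite !inE.
  by case: eqP => // xe; rewrite -xe xI in eI.
have [tau injt [tI [tD tn]]] := redundant_swap.
have [D0 dDI] := redundant_indep iI eI; have /set0Pn[d dD] := D0.
rewrite -(card_imset I injt); apply: rk_ge; first by rewrite tI.
apply/subsetP => _ /imsetP[x xI ->]; have [->|xe] := eqVneq x e.
  by rewrite (tD d dD).1 (subsetP sD).
have xD : x \notin D by apply/negP => xD; have := disjointFr dDI xD; rewrite xI.
by rewrite tn //; have := subsetP sI _ xI; rewrite !inE (negPf xe).
Qed.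

Local Notation N := (delete M [set e]).

Lemma delete_rk (P : {set {x : T | x \notin [set e]}}) : rk N P = rk M (val @: P).
Proof. by apply/esym/rk_image => //; exact: val_inj. Qed.

(** In a partition of the remaining elements, [e] joins a side that contains [D]; by [redundant_rk]
    no rank changes. *)
Lemma delete_vertically_connected k : vertically_connected k M -> vertically_connected k N.
Proof.
move=> vM P Q PQ dPQ.
have valT : val @: [set: {x : T | x \notin [set e]}] = ~: [set e].
  apply/setP => x; rewrite !inE; apply/imsetP/idP => [[y _ ->]|xe].
    by have := valP y; rewrite inE.
  have h : x \notin [set e] by rewrite inE.
  by exists (exist _ x h).
have sDT : D \subset ~: [set e].
  by apply/subsetP => x xD; rewrite !inE; apply: contraNneq eD => <-.
have rkT : rk N setT = rk M setT.
  rewrite delete_rk valT -(redundant_rk sDT) -setTD setUC; congr (rk M _).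
  by apply/setP => x; rewrite !inE; case: eqP.
have UPQ : val @: P :|: val @: Q = ~: [set e] by rewrite -imsetU PQ valT.
have dV : [disjoint val @: P & val @: Q].
  rewrite disjoints_subset; apply/subsetP => _ /imsetP[x xP ->]; rewrite inE mem_imset //; last exact: val_inj.
  by have := disjointFr dPQ xP => ->.
have eV (S : {set {x : T | x \notin [set e]}}) : e \notin val @: S.
  by apply/negP => /imsetP[x _ xe]; have := valP x; rewrite -xe inE eqxx.
rewrite /spanning rkT !delete_rk.
have [sDP|nDP] := boolP (D \subset val @: P).
  rewrite -(redundant_rk sDP) => lt; apply: vM => //.
    by rewrite -setUA UPQ; apply/setP => x; rewrite !inE; case: eqP.
  by rewrite disjoints_subset subUset sub1set inE eV /= -disjoints_subset.
have sDQ : D \subset val @: Q.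
  apply/subsetP => d dD; have := subsetP sDT _ dD; rewrite -UPQ inE => /orP[dP|//].
  case/negP: nDP; have -> : D = [set d] by apply/esym/eqP; rewrite eqEcard sub1set dD cards1.
  by rewrite sub1set.
rewrite -(redundant_rk sDQ) => lt; apply: vM => //.
  by rewrite setUCA UPQ; apply/setP => x; rewrite !inE; case: eqP.
by rewrite disjoint_sym disjoints_subset subUset sub1set inE eV /= -disjoints_subset disjoint_sym.
Qed.

(** If the minor uses [e], the automorphism of [redundant_swap] trades it for its parallel element
    [d]. The independence of pairs in [L] ensures that [e] is no loop when it represents an element
    of [L], and that [d] is not in use at the same time. *)
Lemma delete_simple_minor (U : finType) (L : matroid U) :
  (forall x y, indep L [set x; y]) -> has_minor M L -> has_minor N L.
Proof.
move=> sL /minorP[g [C [injg gC gE]]].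
suff [g' [C' [injg' gC' gE' eg eC]]] : exists (g' : U -> T) (C' : {set T}),
    [/\ injective g', forall x, g' x \notin C', forall I : {set U}, indep L I = indep M (g' @: I :|: C'),
        forall x, g' x != e & e \notin C'].
  have h x : g' x \notin [set e] by rewrite inE.
  pose f x : {x : T | x \notin [set e]} := exist _ (g' x) (h x).
  apply/minorP; exists f, [set x | val x \in C']; split.
  - by move=> x y /(congr1 val) /injg'.
  - by move=> x; rewrite inE gC'.
  move=> I; rewrite gE'; transitivity (indep M (val @: (f @: I :|: [set x | val x \in C']))); last by [].
  rewrite imsetU -imset_comp; congr (indep M (_ :|: _)); apply/setP => x.
  apply/idP/imsetP => [xC|[y + ->]]; last by rewrite inE.
  have xe : x \notin [set e] by rewrite inE; apply: contraNneq eC => <-.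
  by exists (exist _ x xe); rewrite ?inE.
pose W (I : {set U}) := g @: I :|: C.
have iW x y : indep M (W [set x; y]) by rewrite /W -gE; exact: sL.
have [/forallP H|] := boolP [forall x, g x != e].
  have [eC|eC] := boolP (e \in C); last by exists g, C.
  have iC : indep M C by have := gE set0; rewrite indep0 imset0 set0U.
  have [tau injt [tI [tD tn]]] := redundant_swap.
  have [D0 dDC] := redundant_indep iC eC; have /set0Pn[d dD] := D0.
  have [te td] := tD d dD.
  exists (tau \o g), (tau @: C); split=> //.
  - exact: inj_comp.
  - by move=> x; rewrite /= mem_imset.
  - by move=> I; rewrite gE imset_comp -imsetU tI.
  - move=> x; apply/eqP => /= gx; have : g x = d by apply: injt; rewrite td.
    move=> gxd; have iWx := iW x x.
    have eW : e \in W [set x; x] by rewrite /W inE eC orbT.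
    have [_ dDW] := redundant_indep iWx eW; have := disjointFr dDW dD.
    by rewrite /W inE -gxd imset_f // !inE eqxx.
  rewrite -td mem_imset //; apply/negP => dC.
  by have := disjointFr dDC dD; rewrite dC.
rewrite negb_forall => /existsP[x0]; rewrite negbK => /eqP gx0.
have [tau injt [tI [tD tn]]] := redundant_swap.
have eW y : e \in W [set x0; y] by rewrite /W inE -gx0 imset_f // !inE eqxx.
have [D0 _] := redundant_indep (iW x0 x0) (eW x0); have /set0Pn[d dD] := D0.
have [te td] := tD d dD.
have dW y : d \notin W [set x0; y].
  by have [_ dDW] := redundant_indep (iW x0 y) (eW y); rewrite (disjointFr dDW dD).
exists (tau \o g), (tau @: C); split=> //.
- exact: inj_comp.
- by move=> x; rewrite /= mem_imset.
- by move=> I; rewrite gE imset_comp -imsetU tI.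
- move=> y; apply/eqP => /= gy; have gyd : g y = d by apply: injt; rewrite td.
  by have := dW y; rewrite /W inE -gyd imset_f // !inE eqxx orbT.
rewrite -td mem_imset //; apply: contra (dW x0) => dC.
by rewrite /W inE dC orbT.
Qed.

(** [e] copies sign and ends of its parallel element. If [e] is a loop, it gets sign 0 and both ends
    at the new vertex [None], as [V] could be empty. *)
Lemma delete_even_cycle : even_cycle N -> even_cycle M.
Proof.
move=> /even_cycleP[V [w [en cN]]].
have fE (I : {set {x : T | x \notin [set e]}}) : indep M (val @: I) = indep N I by [].
have cN' := iso_cycle_space val_inj fE cA.
have eqN := cycle_space_unique cN' cN.
pose od : option T := [pick d in D].
pose data (x : T) : option {x : T | x \notin [set e]} :=
  if x == e then obind (fun d => insub d : option {x : T | x \notin [set e]}) od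
  else (insub x : option {x : T | x \notin [set e]}).
pose w' x := if data x is Some y then w y else 0.
pose en' x := if data x is Some y then (Some (en y).1, Some (en y).2) else (None, None).
apply/even_cycleP; exists (option V), w', en'.
have dataV (y : {x : T | x \notin [set e]}) : data (val y) = Some y.
  rewrite /data; have := valP y; rewrite inE => /negPf->.
  by rewrite valK.
have ecm_val (J : {set {x : T | x \notin [set e]}}) :
    sum_cycle (ecm w' (inc en')) (val @: J) = sum_cycle (ecm w (inc en)) J.
  have sumv (G : T -> 'F_2) : \sum_(x in val @: J) G x = \sum_(y in J) G (val y).
    by rewrite big_imset //= => ? ? _ _; exact: val_inj.
  have incE v y : inc en' (Some v) (val y) = inc en v y by rewrite /inc /en' dataV.
  apply/ecm_cycleP/ecm_cycleP => -[Hw HD]; split.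
  - by rewrite -[RHS]Hw sumv; apply: eq_bigr => y _; rewrite /w' dataV.
  - by move=> v; rewrite -[RHS](HD (Some v)) sumv; apply: eq_bigr => y _; rewrite incE.
  - by rewrite -[RHS]Hw sumv; apply: eq_bigr => y _; rewrite /w' dataV.
  case=> [v|]; first by rewrite -[RHS](HD v) sumv; apply: eq_bigr => y _; rewrite incE.
  by rewrite sumv big1 // => y _; rewrite /inc /en' dataV /= addr0.
have ecm_D : sum_cycle (ecm w' (inc en')) (e |: D).
  have [D0|[d dD]] := set_0Vmem D.
    have de : data e = None.
      rewrite /data eqxx /od; case: pickP => // d; by rewrite D0 inE.
    apply/ecm_cycleP; rewrite D0 setU0; split; first by rewrite big_set1 /w' de.
    by move=> v; rewrite big_set1 /inc /en' de addF2.
  have DE : D = [set d] by apply/esym/eqP; rewrite eqEcard sub1set dD cards1.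
  have de : d != e by apply: contraNneq eD => <-.
  have dataE : data e = data d.
    rewrite /data eqxx (negPf de) /od; case: pickP => [d'|/(_ d)]; last by rewrite /= dD.
    by rewrite DE inE => /eqP->.
  have same (G : T -> 'F_2) : G e = G d -> \sum_(x in e |: D) G x = 0.
    by move=> Ged; rewrite big_setU1 //= DE big_set1 Ged addF2.
  apply/ecm_cycleP; split; first by apply: same; rewrite /w' dataE.
  by move=> v; apply: same; rewrite /inc /en' dataE.
have sub_val (J : {set T}) : e \notin J -> exists J' : {set {x : T | x \notin [set e]}}, J = val @: J'.
  move=> eJ; exists [set y | val y \in J]; apply/setP => x; apply/idP/imsetP => [xJ|[y + ->]]; last by rewrite inE.
  have xe : x \notin [set e] by rewrite inE; apply: contraNneq eJ => <-.
  by exists (exist _ x xe); rewrite ?inE.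
have main (J : {set T}) : e \notin J -> sum_cycle A J = sum_cycle (ecm w' (inc en')) J.
  by move=> /sub_val[J' ->]; rewrite ecm_val -eqN.
apply: cycle_space_ext cA => J; have [eJ|eJ] := boolP (e \in J); last exact: main.
have eJD : e \notin sd J (e |: D) by rewrite !inE eJ eqxx.
have shift (B' : finType) (A' : binmx B' T) :
    sum_cycle A' (e |: D) -> sum_cycle A' (sd J (e |: D)) = sum_cycle A' J.
  by move=> ZD; apply/idP/idP => H; [rewrite -(sdK J (e |: D))|]; exact: sum_cycle_sd.
by rewrite -(shift _ A cD) main // shift.
Qed.

End Redundant.

Lemma not_simple_redundant (T : finType) (M : matroid T) (B : finType) (A : binmx B T) :
  cycle_space M (sum_cycle A) -> ~~ simple M ->
  exists e (D : {set T}), [/\ e \notin D, (#|D| <= 1)%N & sum_cycle A (e |: D)].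
Proof.
move=> cA; rewrite negb_forall => /existsP[x]; rewrite negb_forall => /existsP[y].
case/(cycle_dep cA) => J [sJ ZJ /set0Pn[e eJ]].
exists e, (J :\ e); split; [by rewrite setD11| |by rewrite setD1K].
have := subset_leq_card sJ; rewrite (cardsD1 e) eJ => le.
have := leq_trans le (_ : (#|[set x; y]| <= 2)%N); rewrite cards2.
by case: (x != y) => /(_ isT).
Qed.

(** * Application of the template hypothesis *)

Definition excluded_class : matroid_class := fun T M =>
  [/\ binary M, forall e, ~ has_minor M (delete PG32 [set e]), ~ has_minor M L19 & ~ has_minor M L11].

Lemma excluded_class_minor : minor_closed excluded_class.
Proof.
move=> T U M N [bM nPG n19 n11] MN; split.
- exact: binary_minor bM MN.
- by move=> e /(minor_trans MN); exact: nPG.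
- by move/(minor_trans MN).
by move/(minor_trans MN).
Qed.

Lemma excluded_class_proper : proper_minor_closed_binary excluded_class.
Proof.
split; [by move=> T M []|exact: excluded_class_minor|].
exists _, L11; split.
  exists 'I_6, 'I_11, (fun (i : 'I_6) (j : 'I_11) => (nth 0%N (nth [::] L11_rows i) j)%:R).
  by exists id => [|I]; [exists id|rewrite imset_id].
case=> _ _ _; apply; apply: iso_minor.
by exists id => [|I]; [exists id|rewrite imset_id].
Qed.

Lemma in_spanD (Phi : template) (x y : vec (tX Phi)) : in_span x -> in_span y -> in_span (x + y).
Proof.
move=> [l [J [K [lL ->]]]] [l' [J' [K' [l'L ->]]]].
exists (l + l'), (sd J J'), (sd K K'); split; first exact: lambdaD.
by rewrite !(sum_sd _ (@addvec _)) addrACA [l + _ + _]addrACA.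
Qed.

Lemma conforming_vertically_connected_span (Phi : template) (R F : finType)
    (A : binmx (tX Phi + R)%type (tY Phi + F)%type) k :
  matrix_conforms A -> (#|tY0 Phi|.+1 < k)%N -> vertically_connected k (tmatroid A) ->
  (#|tY0 Phi| < rk (tmatroid A) setT)%N -> forall y, in_span (xcol (inY0 (y : tY0 Phi))).
Proof.
move=> cA ltk vM ltr y.
set M := tmatroid A in vM ltr *.
pose P : {set (tY0 Phi + F)%type} := [set inl y | y in tY0 Phi].
pose Q : {set (tY0 Phi + F)%type} := [set inr z | z in F].
have PQ : P :|: Q = setT.
  by apply/setP => -[y'|z]; rewrite !inE; apply/orP; [left|right]; apply: imset_f.
have dPQ : [disjoint P & Q].
  rewrite disjoints_subset; apply/subsetP => _ /imsetP[y' _ ->]; rewrite inE.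
  by apply/negP => /imsetP[].
have leP : (rk M P <= #|tY0 Phi|)%N.
  by apply: leq_trans (rk_card _ _) _; rewrite card_imset //; move=> ? ? [].
(* [Q] has at most the full rank, so the connectivity of the partition is at most [#|Y0|], below
   [k - 1]; [P] is too small to span, hence [Q] spans. *)
have [||] := vM P Q PQ dPQ.
- apply: (@leq_ltn_trans #|tY0 Phi|); last by rewrite ltn_subRL add1n.
  by rewrite leq_subLR addnC leq_add // rkS ?subsetT.
- by move/eqP => rP; move: ltr; rewrite -rP ltnNge leP.
move/eqP => rQ.
have [I [iI sI cI]] := rk_witness M Q.
have yI : inl y \notin I by apply/negP => /(subsetP sI) /imsetP[].
have nI : ~~ indep M (inl y |: I).
  apply/negP => iyI; have := rk_ge iyI (subsetT _).
  by rewrite cardsU1 yI cI rQ add1n ltnn.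
(* The [X]-part of a cycle through [y] and elements of [F] expresses the column of [y] by elements
   of Lambda and columns of [Y1] and [C]. *)
have [J [sJ ZJ yJ]] := cycle_ext (tmatroid_cycles A) iI nI.
move: ZJ; rewrite tcycleE => /existsP[K /andP[/eqP xE _]].
have colY y' := (conforming_column_Y cA y').1.
move: xE; rewrite (big_setD1 _ yJ) /= colY => /(congr1 (fun v => v + \sum_(e in J :\ inl y) colx A (ground e))).
rewrite -addrA addvec addr0 => ->.
have span0 : in_span (0 : vec (tX Phi)).
  by exists 0, set0, set0; rewrite !big_set0 !addr0; split=> //; exact: zero_lambda.
apply: in_spanD.
  rewrite (eq_bigr _ (fun c _ => colY (inC c))).
  by exists 0, set0, K; rewrite big_set0 addr0 add0r; split=> //; exact: zero_lambda.
elim/big_ind: _ => //; first exact: in_spanD.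
case=> [y'|z]; rewrite !inE => /andP[ny eJ].
  have := subsetP sJ _ eJ; rewrite !inE (negPf ny) /= => /(subsetP sI) /imsetP[] //.
have [[zL _]|[j [r0 [-> _]]]] := conforming_column_F cA z.
  by exists (colx A (inr z)), set0, set0; rewrite !big_set0 !addr0.
exists 0, [set j], set0; rewrite big_set0 big_set1 addr0 add0r; split=> //; exact: zero_lambda.
Qed.

Theorem theorem9p2 (VTH : vertical_template_hypothesis) :
  exists k n : nat,
    [/\ (0 < k)%N, (0 < n)%N &
      forall (T : finType) (M : matroid T),
        binary M -> vertically_connected k M ->
        has_minor M (cycle_matroid (complete_graph n)) ->
        ([/\ forall e, ~ has_minor M (delete PG32 [set e]),
             ~ has_minor M L19
           & ~ has_minor M L11]
         <-> even_cycle M)].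
Proof.
have [k0 [n0 [s [t [Phi [Psi [_ PhiK _ PhiM _]]]]]]] := VTH _ excluded_class_proper.
have noPG i : no_PG32 (Phi i) by move=> T M /PhiK[].
have noL i : no_L11 (Phi i) by move=> T M /PhiK[].
(* [m] bounds every [|Y_0|]. The summand [m.+2] puts [k] above [|Y_0| + 1] and makes the rank of the
   complete graph, one less than its number of vertices, exceed [|Y_0|]. *)
pose m := (\sum_i #|tY0 (Phi i)|)%N.
exists (k0 + m.+2)%N, (n0 + m.+2)%N; split; rewrite ?addnS // => T M.
have le_m i : (#|tY0 (Phi i)| <= m)%N by rewrite /m (bigD1 i) //= leq_addr.
set k := (k0 + m).+2; set n := (n0 + m).+2.
have simple_case (T' : finType) (M' : matroid T') : excluded_class M' -> simple M' ->
    vertically_connected k M' -> has_minor M' (cycle_matroid (complete_graph n)) -> even_cycle M'.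
  move=> KM sM vM mM.
  have [||i cM] := PhiM _ _ KM sM; first by apply: vertically_connected_le vM; rewrite /k -addnS -addnS leq_addr.
    by apply: minor_trans mM _; apply: complete_graph_minor; rewrite /n -addnS -addnS leq_addr.
  have /conformsP[R [F [A [cA iA]]]] := cM.
  apply: (even_cycle_minor (M := tmatroid A)); last exact: iso_minor iA.
  apply: conforming_even_cycle => //.
  apply: (conforming_vertically_connected_span cA) (vertically_connected_iso iA vM) _.
    by rewrite /k !ltnS (leq_trans (le_m i)) // leq_addl.
  have mA : has_minor (tmatroid A) (cycle_matroid (complete_graph n)).
    exact: minor_trans (iso_minor iA) mM.
  by apply: leq_trans (complete_minor_rank mA); rewrite ltnS (leq_trans (le_m i)) // leq_addl.
move=> bM vM mM; split=> [[nPG n19 n11]|eM]; last first.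
  split=> [e H|H|H]; have := even_cycle_minor eM H.
  - exact: PG32_not_even_cycle.
  - exact: L19_not_even_cycle.
  exact: L11_not_even_cycle.
have KM : excluded_class M by [].
(* Induction on the ground set: a matroid that is not simple loses a loop or parallel element,
   keeping connectivity and the complete-graph minor. *)
have [N] := ubnP #|T|; elim: N T M {bM nPG n19 n11} KM vM mM => // N IHN T M KM vM mM /ltnSE leN.
have [sM|nsM] := boolP (simple M); first exact: simple_case.
have [bM _ _ _] := KM; have /binaryP[B [A cA]] := bM.
have [e [D [eD leD cD]]] := not_simple_redundant cA nsM.
apply: (delete_even_cycle cA eD leD cD); apply: IHN.
- by apply: excluded_class_minor KM _; exact: delete_minor.
- exact: delete_vertically_connected cA eD leD cD _ vM.
- by apply: (delete_simple_minor cA eD leD cD) mM; exact: complete_graph_indep2.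
apply: leq_trans leN; rewrite card_sig; apply: (@leq_trans #|[set~ e]|.+1).
  by rewrite ltnS; apply/subset_leq_card/subsetP => x; rewrite !inE.
by rewrite cardsC1 prednK //; apply/card_gt0P; exists e.
Qed.
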